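(* Let $R$ be any ring as in the definition of $\mathscr{B}_n^k$, and fix, for each $0\le l\le n$, the sets $\widetilde{\mathcal X}_{l,k}\subseteq\mathscr{B}_n^k$ as described in the context. Then $\mathscr{B}_n^k(R)$ is spanned over $R$ by the set of all elements $$\alpha_{i_1,j_1,n-1}^{s_1}\,\alpha_{i_2,j_2,n-3}^{s_2}\cdots\alpha_{i_m,j_m,n-2m+1}^{s_m}\;\chi\;(\alpha_{g_m,h_m,n-2m}^{t_m})^*\cdots(\alpha_{g_2,h_2,n-4}^{t_2})^*(\alpha_{g_1,h_1,n-2}^{t_1})^*,$$ where $0\le m\le\lfloor n/2\rfloor$, $i_1>i_2>\dots>i_m$, $g_1>g_2>\dots>g_m$, and for each $f=1,\dots,m$: $1\le i_f\le j_f\le n-2f+1$, $1\le g_f\le h_f\le n-2f+1$, $s_f,t_f\in P$, and $\chi\in\widetilde{\mathcal X}_{n-2m,k}$.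
   Context: Fix integers $n\ge 1$, $k\ge 1$. Let $R$ be a unital commutative ring containing units $q_0,q,\lambda$ and further elements $q_1,\dots,q_{k-1},A_0,\dots,A_{k-1}$ such that $\lambda-\lambda^{-1}=\delta(1-A_0)$, where $\delta:=q-q^{-1}$. The cyclotomic BMW algebra $\mathscr{B}_n^k=\mathscr{B}_n^k(R)$ is the unital associative $R$-algebra generated by $Y^{\pm1},X_1^{\pm1},\dots,X_{n-1}^{\pm1},e_1,\dots,e_{n-1}$ subject to the following relations (for all indices for which they make sense): $X_i-X_i^{-1}=\delta(1-e_i)$; $X_iX_j=X_jX_i$, $X_ie_j=e_jX_i$, $e_ie_j=e_je_i$ for $|i-j|\ge 2$; $X_iX_{i+1}X_i=X_{i+1}X_iX_{i+1}$; $X_ie_i=e_iX_i=\lambda e_i$; $X_iX_je_i=e_je_i=e_jX_iX_j$ for $|i-j|=1$; $e_ie_{i\pm1}e_i=e_i$; $e_i^2=A_0e_i$; $Y^k=\sum_{i=0}^{k-1}q_iY^i$; $X_1YX_1Y=YX_1YX_1$; $YX_i=X_iY$ and $Ye_i=e_iY$ for $i>1$; $YX_1Ye_1=\lambda^{-1}e_1=e_1YX_1Y$; $e_1Y^me_1=A_me_1$ for $0\le m\le k-1$. For $1\le i\le n$ put $Y_i':=X_{i-1}\cdots X_2X_1\,Y\,X_1X_2\cdots X_{i-1}$ (so $Y_1'=Y$). Let $^*$ be the unique $R$-algebra anti-involution of $\mathscr{B}_n^k$ fixing $Y$, all $X_i$ and all $e_i$. For $1\le i\le j\le l+1$, $l\le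 n-1$ and $p\in\mathbb Z$, define $\alpha_{i,j,l}^p:=(Y_i')^p X_iX_{i+1}\cdots X_{j-1}\,e_je_{j+1}\cdots e_l$ (empty products are $1$). Let $P:=\{\lfloor k/2\rfloor-(k-1),\dots,\lfloor k/2\rfloor\}$ (a set of $k$ consecutive integers). Ariki–Koike algebra: for $l\ge 0$, $\mathfrak h_{l,k}(R)$ is the unital $R$-algebra with generators $T_0^{\pm1},T_1^{\pm1},\dots,T_{l-1}^{\pm1}$ and relations $T_0T_1T_0T_1=T_1T_0T_1T_0$; $T_iT_{i+1}T_i=T_{i+1}T_iT_{i+1}$; $T_iT_j=T_jT_i$ for $|i-j|\ge2$; $T_0^k=\sum_{i=0}^{k-1}q_iT_0^i$; $T_i^2=(q^2-1)T_i+q^2$ for $1\le i\le l-1$ (and $\mathfrak h_{0,k}(R)=R$). It is $R$-free of rank $k^l l!$. There is a surjective $R$-algebra homomorphism $\pi_l:\mathscr{B}_l^k(R)\to\mathfrak h_{l,k}(R)$ with $Y\mapsto T_0$, $X_i\mapsto q^{-1}T_i$, $e_i\mapsto 0$. For each $0\le l\le n$ fix an $R$-basis $\mathcal X_{l,k}$ of $\mathfrak h_{l,k}(R)$ (with $\mathcal X_{0,k}=\{1\}$), choose a subset $\overline{\mathcal X}_{l,k}\subseteq\mathscr{B}_l^k(R)$ mapped by $\pi_l$ bijectively onto $\mathcal X_{l,k}$, and let $\widetilde{\mathcal X}_{l,k}$ be the image of $\overline{\mathcal X}_{l,k}$ under the natural homomorphism $\mathscr{B}_l^k(R)\to\mathscr{B}_n^k(R)$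 sending each generator to the generator of the same name (for $l=0$, $\widetilde{\mathcal X}_{0,k}=\{1\}$). *)

(* Defs.v *)
From HB Require Import structures.
From mathcomp Require Import all_boot all_order all_algebra.
Set Implicit Arguments. Unset Strict Implicit. Unset Printing Implicit Defensive.
Import Order.TTheory GRing.Theory Num.Theory.
Local Open Scope ring_scope.

(* Presented (unital associative) R-algebras: formal terms over generators  *)
(* G with central scalars from R, modulo the smallest congruence containing *)
(* the R-algebra axioms and a given set of defining relations.               *)
Section Terms.
Variable R : comUnitRingType.
Variable G : Type.

Inductive term : Type :=
  | TC of R
  | TG of G
  | TAdd of term & term
  | TMul of term & term.

Definition tsub (a b : term) : term := TAdd a (TMul (TC (-1)) b).
Definition tscale (r : R) (a : term) : term := TMul (TC r) a.
Definition tprod (s : seq term) : term := foldr TMul (TC 1) s.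
Definition tsum (s : seq term) : term := foldr TAdd (TC 0) s.
Definition tpow (a : term) (m : nat) : term := tprod (nseq m a).

Fixpoint tstar (a : term) : term :=
  match a with
  | TC r => TC r
  | TG g => TG g
  | TAdd x y => TAdd (tstar x) (tstar y)
  | TMul x y => TMul (tstar y) (tstar x)
  end.

Variable rel : term -> term -> Prop.

Inductive teq : term -> term -> Prop :=
  | teq_rel a b : rel a b -> teq a b
  | teq_refl a : teq a a
  | teq_sym a b : teq a b -> teq b a
  | teq_trans a b c : teq a b -> teq b c -> teq a c
  | teq_addm a a' b b' : teq a a' -> teq b b' -> teq (TAdd a b) (TAdd a' b')
  | teq_mulm a a' b b' : teq a a' -> teq b b' -> teq (TMul a b) (TMul a' b')
  | teq_addA a b c : teq (TAdd a (TAdd b c)) (TAdd (TAdd a b) c)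
  | teq_addC a b : teq (TAdd a b) (TAdd b a)
  | teq_add0 a : teq (TAdd (TC 0) a) a
  | teq_addN a : teq (TAdd (TMul (TC (-1)) a) a) (TC 0)
  | teq_mulA a b c : teq (TMul a (TMul b c)) (TMul (TMul a b) c)
  | teq_mul1l a : teq (TMul (TC 1) a) a
  | teq_mul1r a : teq (TMul a (TC 1)) a
  | teq_mulDl a b c : teq (TMul (TAdd a b) c) (TAdd (TMul a c) (TMul b c))
  | teq_mulDr a b c : teq (TMul a (TAdd b c)) (TAdd (TMul a b) (TMul a c))
  | teq_CD r s : teq (TAdd (TC r) (TC s)) (TC (r + s))
  | teq_CM r s : teq (TMul (TC r) (TC s)) (TC (r * s))
  | teq_Ccomm r a : teq (TMul (TC r) a) (TMul a (TC r)).

End Terms.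

Fixpoint tmap (R : comUnitRingType) (G G' : Type) (f : G -> term R G')
    (a : term R G) : term R G' :=
  match a with
  | TC r => TC G' r
  | TG g => f g
  | TAdd x y => TAdd (tmap f x) (tmap f y)
  | TMul x y => TMul (tmap f x) (tmap f y)
  end.

Inductive bgen : Type := BY | BYi | BX of nat | BXi of nat | BE of nat.

Definition bgen_ok (n : nat) (x : bgen) : bool :=
  match x with
  | BY | BYi => true
  | BX i | BXi i | BE i => (0 < i < n)%N
  end.

Fixpoint twf (R : comUnitRingType) (G : Type) (ok : G -> bool)
    (a : term R G) : bool :=
  match a with
  | TC _ => true
  | TG g => ok g
  | TAdd x y => twf ok x && twf ok y
  | TMul x y => twf ok x && twf ok y
  end.

(* a term lies in (the image of) B_n^k, i.e. uses only generators of B_n^k *)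
Definition bwf (R : comUnitRingType) (n : nat) (a : term R bgen) : bool :=
  twf (bgen_ok n) a.

Section BMW.
Variables (R : comUnitRingType) (q0 q lam : R) (qs As : nat -> R) (n k : nat).

Local Notation bterm := (term R bgen).
Local Notation Y := (TG R BY).
Local Notation Yi := (TG R BYi).
Local Notation X i := (TG R (BX i)).
Local Notation Xi i := (TG R (BXi i)).
Local Notation E i := (TG R (BE i)).
Local Notation valid i := (0 < i < n)%N.

Definition bdelta : R := q - q^-1.

Inductive brel : bterm -> bterm -> Prop :=
  | br_Yinv1 : brel (TMul Y Yi) (TC _ 1)
  | br_Yinv2 : brel (TMul Yi Y) (TC _ 1)
  | br_Xinv1 i : valid i -> brel (TMul (X i) (Xi i)) (TC _ 1)
  | br_Xinv2 i : valid i -> brel (TMul (Xi i) (X i)) (TC _ 1)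
  | br_skein i : valid i ->
      brel (tsub (X i) (Xi i)) (tscale bdelta (tsub (TC _ 1) (E i)))
  | br_XXc i j : valid i -> valid j -> ((i + 2 <= j) || (j + 2 <= i))%N ->
      brel (TMul (X i) (X j)) (TMul (X j) (X i))
  | br_XEc i j : valid i -> valid j -> ((i + 2 <= j) || (j + 2 <= i))%N ->
      brel (TMul (X i) (E j)) (TMul (E j) (X i))
  | br_EEc i j : valid i -> valid j -> ((i + 2 <= j) || (j + 2 <= i))%N ->
      brel (TMul (E i) (E j)) (TMul (E j) (E i))
  | br_braid i : valid i -> valid i.+1 ->
      brel (tprod [:: X i; X i.+1; X i]) (tprod [:: X i.+1; X i; X i.+1])
  | br_XE i : valid i -> brel (TMul (X i) (E i)) (tscale lam (E i))
  | br_EX i : valid i -> brel (TMul (E i) (X i)) (tscale lam (E i))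
  | br_XXE i j : valid i -> valid j -> ((i == j.+1) || (j == i.+1)) ->
      brel (tprod [:: X i; X j; E i]) (TMul (E j) (E i))
  | br_EXX i j : valid i -> valid j -> ((i == j.+1) || (j == i.+1)) ->
      brel (TMul (E j) (E i)) (tprod [:: E j; X i; X j])
  | br_EEE i j : valid i -> valid j -> ((i == j.+1) || (j == i.+1)) ->
      brel (tprod [:: E i; E j; E i]) (E i)
  | br_EE i : valid i -> brel (TMul (E i) (E i)) (tscale (As 0) (E i))
  | br_Yk : brel (tpow Y k) (tsum [seq tscale (qs i) (tpow Y i) | i <- iota 0 k])
  | br_YXYX : valid 1 ->
      brel (tprod [:: X 1; Y; X 1; Y]) (tprod [:: Y; X 1; Y; X 1])
  | br_YXc i : valid i -> (1 < i)%N -> brel (TMul Y (X i)) (TMul (X i) Y)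
  | br_YEc i : valid i -> (1 < i)%N -> brel (TMul Y (E i)) (TMul (E i) Y)
  | br_YXYE : valid 1 ->
      brel (tprod [:: Y; X 1; Y; E 1]) (tscale lam^-1 (E 1))
  | br_EYXY : valid 1 ->
      brel (tprod [:: E 1; Y; X 1; Y]) (tscale lam^-1 (E 1))
  | br_EYE m : valid 1 -> (m < k)%N ->
      brel (tprod [:: E 1; tpow Y m; E 1]) (tscale (As m) (E 1)).

End BMW.

Inductive hgen : Type := HT of nat | HTi of nat.

Definition hgen_ok (l : nat) (x : hgen) : bool :=
  match x with HT i | HTi i => (i < l)%N end.

Definition hwf (R : comUnitRingType) (l : nat) (a : term R hgen) : bool :=
  twf (hgen_ok l) a.

Section AK.
Variables (R : comUnitRingType) (q : R) (qs : nat -> R) (l k : nat).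

Local Notation hterm := (term R hgen).
Local Notation T i := (TG R (HT i)).
Local Notation Ti i := (TG R (HTi i)).

Inductive hrel : hterm -> hterm -> Prop :=
  | hr_inv1 i : (i < l)%N -> hrel (TMul (T i) (Ti i)) (TC _ 1)
  | hr_inv2 i : (i < l)%N -> hrel (TMul (Ti i) (T i)) (TC _ 1)
  | hr_T01 : (1 < l)%N ->
      hrel (tprod [:: T 0; T 1; T 0; T 1]) (tprod [:: T 1; T 0; T 1; T 0])
  | hr_braid i : (0 < i)%N -> (i.+1 < l)%N ->
      hrel (tprod [:: T i; T i.+1; T i]) (tprod [:: T i.+1; T i; T i.+1])
  | hr_comm i j : (i < l)%N -> (j < l)%N -> ((i + 2 <= j) || (j + 2 <= i))%N ->
      hrel (TMul (T i) (T j)) (TMul (T j) (T i))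
  | hr_T0k : hrel (tpow (T 0) k)
                  (tsum [seq tscale (qs i) (tpow (T 0) i) | i <- iota 0 k])
  | hr_quad i : (0 < i < l)%N ->
      hrel (TMul (T i) (T i))
           (TAdd (tscale (q ^+ 2 - 1) (T i)) (TC _ (q ^+ 2))).

End AK.

Definition pi_gen (R : comUnitRingType) (q : R) (x : bgen) : term R hgen :=
  match x with
  | BY => TG R (HT 0)
  | BYi => TG R (HTi 0)
  | BX i => tscale q^-1 (TG R (HT i))
  | BXi i => tscale q (TG R (HTi i))
  | BE _ => TC _ 0
  end.

Definition piAK (R : comUnitRingType) (q : R) (a : term R bgen) : term R hgen :=
  tmap (pi_gen q) a.

Section Alpha.
Variable R : comUnitRingType.
Local Notation bterm := (term R bgen).
Local Notation Y := (TG R BY).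
Local Notation Yi := (TG R BYi).
Local Notation X i := (TG R (BX i)).
Local Notation Xi i := (TG R (BXi i)).
Local Notation E i := (TG R (BE i)).

Definition Yp (i : nat) : bterm :=
  tprod ([seq X j | j <- rev (iota 1 i.-1)] ++ Y :: [seq X j | j <- iota 1 i.-1]).
Definition Ypinv (i : nat) : bterm :=
  tprod ([seq Xi j | j <- rev (iota 1 i.-1)] ++ Yi :: [seq Xi j | j <- iota 1 i.-1]).

Definition Yppow (i : nat) (p : int) : bterm :=
  match p with
  | Posz m => tpow (Yp i) m
  | Negz m => tpow (Ypinv i) m.+1
  end.

Definition alpha (i j l : nat) (p : int) : bterm :=
  tprod (Yppow i p :: [seq X x | x <- iota i (j - i)] ++
                      [seq E x | x <- iota j (l.+1 - j)]).

Definition inP (k : nat) (s : int) : bool :=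
  ((k./2)%:Z - (k.-1)%:Z <= s) && (s <= (k./2)%:Z).

(* w is one of the displayed elements; chi l y (y < d l) enumerates the
   set \overline{X}_{l,k} (viewed in B_n^k), and X~_{0,k} = {1}. *)
Definition spanning_elt (n k : nat) (d : nat -> nat) (chi : nat -> nat -> bterm)
    (w : bterm) : Prop :=
  exists (m : nat) (i j g h : nat -> nat) (s t : nat -> int) (x : bterm),
    [/\ (m <= n./2)%N,
        (forall f, (1 <= f)%N -> (f < m)%N -> (i f.+1 < i f)%N /\ (g f.+1 < g f)%N),
        (forall f, (1 <= f <= m)%N ->
           [/\ (1 <= i f <= j f)%N, (j f <= n - 2 * f + 1)%N,
               (1 <= g f <= h f)%N, (h f <= n - 2 * f + 1)%N &
               inP k (s f) && inP k (t f)]),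
        (if (n - 2 * m == 0)%N then x = TC _ 1
         else exists2 y, (y < d (n - 2 * m))%N & x = chi (n - 2 * m)%N y) &
        w = tprod ([seq alpha (i f) (j f) (n - 2 * f + 1) (s f) | f <- iota 1 m]
                   ++ x ::
                   [seq tstar (alpha (g f) (h f) (n - 2 * f) (t f))
                   | f <- rev (iota 1 m)])].

End Alpha.

(* Main.v *)
Require Import Defs.
From HB Require Import structures.
From mathcomp Require Import all_boot all_order all_algebra zify ring generic_quotient.
From mathcomp.classical Require Import boolp.
Import Order.TTheory GRing.Theory Num.Theory.
Local Open Scope ring_scope.
Set Implicit Arguments.
Unset Strict Implicit.
Unset Printing Implicit Defensive.

(** Let L be the span of the elements alpha_{i,j,n-1}^s B_{n-2}, with s in Z.
    The commutation rules between X_i, e_i, Y_i' and Y_{i+1}' show that L is a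
    left ideal of B_n containing e_{n-1}, hence L = B_n e_{n-1} B_{n-2}; the
    exponents are brought into P by induction on i, since Y_{i+1}'^s is
    X_i^{-1} Y_i'^s X_i or X_i Y_i'^s X_i^{-1} up to terms with smaller |s| or
    smaller i.  Applying the anti-involution, the elements
    alpha_{i,j,n-1}^s b (alpha_{g,h,n-2}^t)^* with b in B_{n-2} span the ideal
    of B_n generated by the e_i, and modulo this ideal B_n is spanned by the
    lifts of a basis of the Ariki-Koike algebra.  Iterating over n, n-2, ...
    gives all words; they are made decreasing with the identity
    e_i...e_{n-1} alpha_{a,b,n-3}^r = alpha_{a+2,b+2,n-1}^r e_i...e_{n-3} for
    i <= a, which increases the first index: the remaining factor
    X_j^{-1}...X_{i+1}^{-1} of alpha_{i,j,n-1} does not bring it back to i. *)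

(** An exponent can be reduced modulo the equation for [Y] only at index 1, and conjugating down to
    index 1 lowers the first index. Such a reduction after the raising step would undo the work of
    making a word decreasing, so that step must never leave P. Left multiplication by X_a and e_a
    never increases |s|, but it produces both signs, because Y_{a+1}'^s e_a = Y_a'^{-s} e_a.
    Symmetric intervals of exponents therefore survive without any reduction, and this is why P is
    centred at 0. For k odd P is symmetric. For k even the exponent k/2 has no opposite in P and is
    followed by hand: moving x^{-1} over z^r leaves only powers z^b with 0 <= b < r. Stability of
    the span under X_a and reduction of the exponents at index a + 1 depend on each other, so both
    come out of a single induction on the index. In a two-sided word the last e's of the factors
    commute with the middle coefficient and can be counted with either half. The anti-involution
    thus exchanges the two halves, and one ordering argument serves both. *)

(** * Right spans over a subalgebra *)

Section Spans.
Variables (R : comUnitRingType) (A : unitAlgType R).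
Implicit Types (S B W : A -> Prop) (a b x y : A).

Definition subalgebra B :=
  [/\ forall r : R, B r%:A, forall x y, B x -> B y -> B (x + y)
    & forall x y, B x -> B y -> B (x * y)].

Definition linear_closed B W :=
  [/\ W 0, forall x y, W x -> W y -> W (x + y)
    & forall x b, W x -> B b -> W (x * b)].

(** Coefficients act on the right because L is a right module over B_{n-2}; with B = [scalar] this
    is the plain R-span. *)
Inductive rspan S B : A -> Prop :=
  | rspan0 : rspan S B 0
  | rspan_gen v b : S v -> B b -> rspan S B (v * b)
  | rspanD x y : rspan S B x -> rspan S B y -> rspan S B (x + y).

Definition scalar x := exists r : R, x = r%:A.

Lemma scalar_subalgebra : subalgebra scalar.
Proof.
split=> [r|x y [r ->] [s ->]|x y [r ->] [s ->]]; first by exists r.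
- by exists (r + s); rewrite scalerDl.
- by exists (r * s); rewrite -scalerAl mul1r scalerA.
Qed.

Lemma subalgebra1 B : subalgebra B -> B 1.
Proof. by case=> h _ _; rewrite -[1]scale1r; apply: h. Qed.

Lemma subalgebraZ B r x : subalgebra B -> B x -> B (r *: x).
Proof. by case=> h _ hM Bx; rewrite -mulr_algl; apply: hM. Qed.

Lemma subalgebra_linear B : subalgebra B -> linear_closed B B.
Proof. by case=> h hD hM; split=> //; rewrite -(scale0r 1); apply: h. Qed.

Lemma linear_closedZ B W r x :
  subalgebra B -> linear_closed B W -> W x -> W (r *: x).
Proof.
by case=> h _ _ [_ _ hM] Wx; rewrite -mulr_algr; apply: hM.
Qed.

Lemma linear_closedN B W x :
  subalgebra B -> linear_closed B W -> W x -> W (- x).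
Proof. by move=> hB hW Wx; rewrite -scaleN1r; apply: linear_closedZ hW _. Qed.

Lemma linear_closedB B W x y :
  subalgebra B -> linear_closed B W -> W x -> W y -> W (x - y).
Proof.
by move=> hB hW Wx Wy; case: (hW) => _ hD _; apply: hD => //; apply: linear_closedN hW _.
Qed.

Lemma rspan_linear S B : subalgebra B -> linear_closed B (rspan S B).
Proof.
move=> [_ _ hM]; split; [exact: rspan0 | exact: rspanD|].
move=> x b hx Bb; elim: hx => [|v c Sv Bc|u v _ hu _ hv].
- by rewrite mul0r; apply: rspan0.
- by rewrite -mulrA; apply: rspan_gen => //; apply: hM.
- by rewrite mulrDl; apply: rspanD.
Qed.

Lemma rspan_in S B v : subalgebra B -> S v -> rspan S B v.
Proof.
by move=> hB Sv; rewrite -[v]mulr1; apply: rspan_gen => //; apply: subalgebra1.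
Qed.

Lemma rspanZ S B r x : subalgebra B -> rspan S B x -> rspan S B (r *: x).
Proof. by move=> hB; apply: linear_closedZ (rspan_linear S hB). Qed.

Lemma rspanB S B x y :
  subalgebra B -> rspan S B x -> rspan S B y -> rspan S B (x - y).
Proof. by move=> hB; apply: linear_closedB (rspan_linear S hB). Qed.

Lemma rspan_min S B W x : linear_closed B W -> (forall v, S v -> W v) ->
  rspan S B x -> W x.
Proof.
case=> h0 hD hM hS; elim=> [|v b Sv Bb|u v _ hu _ hv] //; last exact: hD.
by apply: hM => //; apply: hS.
Qed.

Lemma rspan_minl S B W a x : linear_closed B W ->
  (forall v, S v -> W (a * v)) -> rspan S B x -> W (a * x).
Proof.
case=> h0 hD hM hS; elim=> [|v b Sv Bb|u v _ hu _ hv].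
- by rewrite mulr0.
- by rewrite mulrA; apply: hM => //; apply: hS.
- by rewrite mulrDr; apply: hD.
Qed.

(** The coefficients commute with c, so they move past it to the right end, where W absorbs them.
    Typically c is a tail X...e... with indices too large to meet B. *)
Lemma rspan_minlr S B B' W a c x : linear_closed B' W ->
  (forall b, B b -> B' b) -> (forall b, B b -> c * b = b * c) ->
  (forall v, S v -> W (a * v * c)) -> rspan S B x -> W (a * x * c).
Proof.
case=> h0 hD hM hB hc hS; elim=> [|v b Sv Bb|u v _ hu _ hv].
- by rewrite mulr0 mul0r.
- rewrite mulrA -mulrA -hc // mulrA; apply: hM; first exact: hS.
  exact: hB.
- by rewrite mulrDr mulrDl; apply: hD.
Qed.

Lemma linear_closed_sub B B' W : (forall b, B b -> B' b) ->
  linear_closed B' W -> linear_closed B W.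
Proof. by move=> h [h0 hD hM]; split=> // x b Wx /h; apply: hM. Qed.

Lemma scalar_sub B b : subalgebra B -> scalar b -> B b.
Proof. by case=> h _ _ [r ->]. Qed.

Lemma scalar_comm a b : scalar b -> a * b = b * a.
Proof. by case=> r ->; rewrite mulr_algl mulr_algr. Qed.

Lemma span_min S W a c x : linear_closed scalar W ->
  (forall v, S v -> W (a * v * c)) -> rspan S scalar x -> W (a * x * c).
Proof. by move=> hW; apply: (@rspan_minlr _ scalar scalar) => // b /scalar_comm. Qed.

Lemma mulCA a b c t : a * b = c -> a * (b * t) = c * t.
Proof. by rewrite mulrA => ->. Qed.

Lemma mulCA3 a b d c t : a * (b * d) = c -> a * (b * (d * t)) = c * t.
Proof. by rewrite !mulrA => ->. Qed.

Lemma commCA a b t : a * b = b * a -> a * (b * t) = b * (a * t).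
Proof. by rewrite !mulrA => ->. Qed.

Lemma exprz_fixl a b (s : int) : a \is a GRing.unit -> a * b = b -> a ^ s * b = b.
Proof.
move=> ua ab; elim/int_rect: s => [|n IH|n IH]; first by rewrite expr0z mul1r.
- by rewrite exprSzr -mulrA ab.
- have -> : - (n.+1%:Z) = - n%:Z + -1 by lia.
  by rewrite exprzDr // exprN1 -mulrA -[in X in _ * (_ * X)]ab mulKr.
Qed.

Lemma exprz_fixr a b (s : int) : a \is a GRing.unit -> b * a = b -> b * a ^ s = b.
Proof.
move=> ua ab; elim/int_rect: s => [|n IH|n IH]; first by rewrite expr0z mulr1.
- by rewrite exprSz mulrA ab.
- have -> : - (n.+1%:Z) = -1 + - n%:Z by lia.
  by rewrite exprzDr // exprN1 mulrA -[in X in X * _ * _]ab mulrK.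
Qed.

Lemma exprz_comm a b (s : int) : a * b = b * a -> a ^ s * b = b * a ^ s.
Proof. by move=> h; apply/esym; apply: commrXz; rewrite /GRing.comm. Qed.

Lemma exprz_comm2 a b (s t : int) : a * b = b * a -> a ^ s * b ^ t = b ^ t * a ^ s.
Proof. by move=> h; apply: exprz_comm; apply/esym/exprz_comm/esym. Qed.
End Spans.

(* Decides linear identities in an R-module by comparing the coefficients of
   each atom; products are atoms, since [ring] needs commutativity. *)
Section LinearIdentities.
Variables (R : comUnitRingType) (V : lmodType R).

Inductive lexp :=
  | LAtom of nat
  | LZero
  | LAdd of lexp & lexp
  | LOpp of lexp
  | LScale of R & lexp.

Fixpoint leval (env : seq V) (e : lexp) : V :=
  match e with
  | LAtom i => nth 0 env i
  | LZero => 0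
  | LAdd e1 e2 => leval env e1 + leval env e2
  | LOpp e1 => - leval env e1
  | LScale r e1 => r *: leval env e1
  end.

(** The test is [Nat.eqb] so that [cbn] computes the coefficients and leaves only scalar identities
    to [ring]. *)
Fixpoint lcoef (e : lexp) (i : nat) : R :=
  match e with
  | LAtom j => if Nat.eqb j i then 1 else 0
  | LZero => 0
  | LAdd e1 e2 => lcoef e1 i + lcoef e2 i
  | LOpp e1 => - lcoef e1 i
  | LScale r e1 => r * lcoef e1 i
  end.

Fixpoint lagree (n : nat) (e1 e2 : lexp) : Prop :=
  if n is m.+1 then lcoef e1 m = lcoef e2 m /\ lagree m e1 e2 else True.

Lemma leval_coef env e :
  leval env e = \sum_(i < size env) lcoef e i *: nth 0 env i.
Proof.
elim: e => [j||e1 IH1 e2 IH2|e1 IH1|r e1 IH1] /=; rewrite ?IH1 ?IH2.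
- have [hj|hj] := ltnP j (size env).
    rewrite (bigD1 (Ordinal hj)) //= big1 => [|i hi].
      by rewrite addr0 (introT (PeanoNat.Nat.eqb_spec _ _)) // scale1r.
    case: PeanoNat.Nat.eqb_spec => [h|_]; last by rewrite scale0r.
    by case/eqP: hi; apply: val_inj.
  rewrite nth_default // big1 // => i _.
  case: PeanoNat.Nat.eqb_spec => [h|_]; last by rewrite scale0r.
  by move: (ltn_ord i); rewrite -h ltnNge hj.
- by rewrite big1 // => i _; rewrite scale0r.
- by rewrite -big_split; apply: eq_bigr => i _; rewrite scalerDl.
- by rewrite -sumrN; apply: eq_bigr => i _; rewrite scaleNr.
- by rewrite scaler_sumr; apply: eq_bigr => i _; rewrite scalerA.
Qed.

Lemma leval_eq env e1 e2 : lagree (size env) e1 e2 -> leval env e1 = leval env e2.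
Proof.
move=> h; rewrite !leval_coef; apply: eq_bigr => -[i hi] _ /=; congr (_ *: _).
elim: (size env) h hi => [|n IH] //= [h1 h2]; rewrite ltnS leq_eqVlt.
by case/orP => [/eqP ->|/(IH h2)].
Qed.
End LinearIdentities.

(* Equality of atoms up to the path by which the ring structure was found. *)
Ltac lin_same a b :=
  first
    [ constr_eq a b
    | lazymatch a with
      | @GRing.one _ => lazymatch b with @GRing.one _ => idtac end
      | @GRing.mul _ ?a1 ?a2 =>
          lazymatch b with @GRing.mul _ ?b1 ?b2 => lin_same a1 b1; lin_same a2 b2 end
      | @GRing.inv _ ?a1 =>
          lazymatch b with @GRing.inv _ ?b1 => lin_same a1 b1 end
      | @exprz _ ?a1 ?m =>
          lazymatch b with @exprz _ ?b1 ?n => lin_same a1 b1; constr_eq m n end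
      end ].

Ltac lin_mem a l :=
  lazymatch l with
  | nil => constr:(false)
  | cons ?b ?l' =>
      match constr:(Set) with
      | _ => let _ := match constr:(Set) with _ => lin_same a b end in constr:(true)
      | _ => lin_mem a l'
      end
  end.

Ltac lin_index a l :=
  lazymatch l with
  | cons ?b ?l' =>
      match constr:(Set) with
      | _ => let _ := match constr:(Set) with _ => lin_same a b end in constr:(O)
      | _ => let i := lin_index a l' in constr:(S i)
      end
  end.

Ltac lin_atoms t l :=
  lazymatch t with
  | @GRing.zero _ => l
  | @GRing.add _ ?a ?b => let l1 := lin_atoms a l in lin_atoms b l1
  | @GRing.opp _ ?a => lin_atoms a l
  | @GRing.scale _ _ _ ?a => lin_atoms a l
  | _ => lazymatch lin_mem t l with true => l | false => constr:(cons t l) end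
  end.

Ltac lin_reify R t l :=
  lazymatch t with
  | @GRing.zero _ => constr:(LZero R)
  | @GRing.add _ ?a ?b =>
      let u := lin_reify R a l in let v := lin_reify R b l in constr:(@LAdd R u v)
  | @GRing.opp _ ?a => let u := lin_reify R a l in constr:(@LOpp R u)
  | @GRing.scale _ _ ?r ?a => let u := lin_reify R a l in constr:(@LScale R r u)
  | _ => let i := lin_index t l in constr:(@LAtom R i)
  end.

Ltac linear_identity R A :=
  lazymatch goal with
  | |- ?a = ?b =>
    let l0 := lin_atoms a (@nil A) in
    let l := lin_atoms b l0 in
    let u := lin_reify R a l in
    let v := lin_reify R b l in
    refine (@leval_eq R A l u v _); cbn [size lagree lcoef Nat.eqb];
    repeat split; ring
  end.

Ltac expand_products :=
  repeat progress rewrite ?(mulrDl, mulrDr, mulNr, mulrN, mulr1, mul1r, mulr0, mul0r)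
    -?scalerAl -?scalerAr -?mulrA.

(** * Commutation rules between two consecutive Jucys-Murphy elements *)

Definition between (s b : int) := ((0 <= b) && (b <= s)) || ((s <= b) && (b <= 0)).

Section RankTwo.
Variables (R : comUnitRingType) (A : unitAlgType R).
Implicit Types (x y z e : A) (lam dl : R) (B C : A -> Prop).

(* The relations between X_i, Y_i', Y_{i+1}', e_i
   and the images C of B_{i-1} and B of B_i. *)
Record rank_two x y z e lam dl C B : Prop := RankTwo {
  r2_ux : x \is a GRing.unit;
  r2_uy : y \is a GRing.unit;
  r2_zE : z = x * y * x;
  r2_yz : y * z = z * y;
  r2_skein : x - x^-1 = dl *: (1 - e);
  r2_xe : x * e = lam *: e;
  r2_ex : e * x = lam *: e;
  r2_yze : y * z * e = e;
  r2_eyz : e * (y * z) = e;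
  r2_C : subalgebra C;
  r2_B : subalgebra B;
  r2_CB u : C u -> B u;
  r2_yB : forall s : int, B (y ^ s);
  r2_om : forall s : int, exists w, [/\ C w, e * w = w * e & e * y ^ s * e = w * e] }.

Variables (x y z e : A) (lam dl : R) (C B : A -> Prop).
Hypothesis r2 : rank_two x y z e lam dl C B.
Let ux := r2_ux r2.
Let uy := r2_uy r2.
Let zE := r2_zE r2.
Let yz := r2_yz r2.
Let skein := r2_skein r2.
Let xe := r2_xe r2.
Let ex := r2_ex r2.
Let yze := r2_yze r2.
Let eyz := r2_eyz r2.
Let hC := r2_C r2.
Let hB := r2_B r2.
Let CB := r2_CB r2.
Let yB := r2_yB r2.
Let om := r2_om r2.
Implicit Types (s a b m : int) (c : int -> bool).

Let hS := @scalar_subalgebra R A.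

Lemma rank2_unitz : z \is a GRing.unit.
Proof. by rewrite zE !unitrMr. Qed.
Let uz := rank2_unitz.

Lemma rank2_yz s b : y ^ s * z ^ b = z ^ b * y ^ s.
Proof. exact: exprz_comm2. Qed.

(** The commuting product yz fixes e, so z acts on e as y^{-1}. This is where exponents change
    sign. *)
Lemma rank2_ze s : z ^ s * e = y ^ (- s) * e.
Proof.
have uyz : y * z \is a GRing.unit by rewrite unitrMr // rank2_unitz.
rewrite -[in RHS](exprz_fixl s uyz yze) exprMz_comm // !mulrA -exprzDr //.
by rewrite addNr expr0z mul1r.
Qed.

Lemma rank2_ez s : e * z ^ s = e * y ^ (- s).
Proof.
have uyz : y * z \is a GRing.unit by rewrite unitrMr // rank2_unitz.
rewrite -[in RHS](exprz_fixr s uyz eyz) yz exprMz_comm // -!mulrA -exprzDr //.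
by rewrite subrr expr0z mulr1.
Qed.

Lemma rank2_xV : x^-1 = x - dl *: 1 + dl *: e.
Proof.
have -> : x^-1 = x - (x - x^-1) by linear_identity R A.
by rewrite skein; linear_identity R A.
Qed.

Lemma rank2_xx : x * x = 1 + dl *: x - (dl * lam) *: e.
Proof.
have h : x * x^-1 = 1 by exact: mulrV.
have -> : x * x = x * x^-1 + dl *: x - dl *: (x * e).
  by rewrite rank2_xV; expand_products; linear_identity R A.
by rewrite h xe scalerA.
Qed.

Let xy : x * y = z * x^-1. Proof. by rewrite zE mulrK. Qed.
Let yx : y * x = x^-1 * z. Proof. by rewrite zE -mulrA mulKr. Qed.

(* [zye] and [zey] hold the correction terms in x y^s = z^s x + ... and
   y^s x = x z^s + ... respectively. *)
Definition zye c s v :=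
  exists2 b, c b & v = z ^ b * y ^ (s - b) \/ v = y ^ (- b) * e * y ^ (s - b).
Definition zey c s v :=
  exists2 b, c b & v = z ^ b * y ^ (s - b) \/ v = y ^ (s - b) * e * y ^ (- b).
(** Left factors which, once followed by a tail X_{i+1}...e_{n-1}, give words of first index i + 1
    (powers of z) or i (the others). The parameters c and m record which exponents may occur at each
    of the two indices. *)
Definition zyx c m v :=
  (exists2 b, c b & v = z ^ b) \/
  (exists2 a, `|a| <= m & v = y ^ a * x \/ v = y ^ a * e).

Local Notation span S := (rspan S (@scalar R A)).

Let zye_mulr c c' s t u : (forall b, c b -> c' b) ->
  span (zye c s) u -> span (zye c' (s + t)) (u * y ^ t).
Proof.
move=> hc hu; rewrite -[u]mul1r; apply: span_min hu => [|v [b hb hv]].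
  exact: rspan_linear.
apply: rspan_in => //; exists b; first exact: hc.
have -> : s + t - b = (s - b) + t by lia.
by rewrite exprzDr // mul1r; case: hv => ->; [left|right]; rewrite -!mulrA.
Qed.

Let zey_mull c c' s t u : (forall b, c b -> c' b) ->
  span (zey c s) u -> span (zey c' (s + t)) (y ^ t * u).
Proof.
move=> hc hu; rewrite -[u]mulr1 mulrA; apply: span_min hu => [|v [b hb hv]].
  exact: rspan_linear.
apply: rspan_in => //; exists b; first exact: hc.
have -> : s + t - b = t + (s - b) by lia.
rewrite exprzDr // mulr1; case: hv => ->; [left|right]; rewrite ?mulrA //.
by rewrite rank2_yz.
Qed.

Let span1 c s b u v (r : R) : c b -> u = z ^ b * y ^ (s - b) ->
  v = y ^ (- b) * e * y ^ (s - b) -> span (zye c s) (- r *: u + r *: v).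
Proof.
move=> hc hu hv.
by apply: rspanD; apply: rspanZ => //; apply: rspan_in => //; exists b; auto.
Qed.

Let span2 c s b u v (r : R) : c b -> u = z ^ b * y ^ (s - b) ->
  v = y ^ (s - b) * e * y ^ (- b) -> span (zey c s) (- r *: u + r *: v).
Proof.
move=> hc hu hv.
by apply: rspanD; apply: rspanZ => //; apply: rspan_in => //; exists b; auto.
Qed.

(** Each passage over one y costs xy = z x^{-1} = zx - dl z + dl ze. The remaining y's stay on the
    right of these corrections, and z^b e is rewritten as y^{-b} e. *)
Lemma rank2_xyn (n : nat) :
  span (zye (fun b => (0 <= b) && (b <= n%:Z)) n) (x * y ^ n - z ^ n * x).
Proof.
elim: n => [|n IH]; first by rewrite !expr0z mulr1 mul1r subrr; apply: rspan0.
have -> : x * y ^ n.+1 - z ^ n.+1 * x = (x * y ^ n - z ^ n * x) * y ^ 1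
  + (- dl *: (z ^ n * z) + dl *: (z ^ n * (z * e))).
  have h : x * y = z * x - dl *: z + dl *: (z * e).
    by rewrite xy rank2_xV; expand_products.
  rewrite expr1z !exprSzr; expand_products; rewrite h.
  by expand_products; linear_identity R A.
have -> : n.+1%:Z = n%:Z + 1 by lia.
apply: rspanD; first by apply: zye_mulr IH => b; lia.
apply: (span1 (b := n%:Z + 1)); rewrite ?subrr ?expr0z ?mulr1; first by lia.
  by rewrite exprzDr.
by rewrite mulrA -exprSzr rank2_ze; congr (y ^ _ * _); lia.
Qed.

Lemma rank2_xyN (n : nat) :
  span (zye (fun b => (- n%:Z < b) && (b <= 0)) (- n%:Z))
    (x * y ^ (- n%:Z) - z ^ (- n%:Z) * x).
Proof.
elim: n => [|n IH]; first by rewrite !expr0z mulr1 mul1r subrr; apply: rspan0.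
have e1 : - n.+1%:Z = - n%:Z + -1 by lia.
have -> : x * y ^ (- n.+1%:Z) - z ^ (- n.+1%:Z) * x
  = (x * y ^ (- n%:Z) - z ^ (- n%:Z) * x) * y ^ (-1)
  + (- (- dl) *: (z ^ (- n%:Z) * y^-1) + (- dl) *: (z ^ (- n%:Z) * e * y^-1)).
  have h : z^-1 * x = x * y^-1 - dl *: y^-1 + dl *: (e * y^-1).
    have -> : z^-1 * x = x^-1 * y^-1.
      by apply: (mulrI uz); rewrite mulVKr // mulrA -xy mulrK.
    by rewrite rank2_xV; expand_products.
  rewrite e1 !exprzDr // !exprN1; expand_products; rewrite h.
  by expand_products; linear_identity R A.
rewrite e1; apply: rspanD; first by apply: zye_mulr IH => b; lia.
have e2 : - n%:Z + -1 - - n%:Z = -1 by lia.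
apply: (span1 (b := - n%:Z)); rewrite ?e2 ?exprN1 //; first by lia.
by rewrite rank2_ze.
Qed.

Lemma rank2_xVyn (n : nat) :
  span (zye (fun b => (0 <= b) && (b < n%:Z)) n) (x^-1 * y ^ n - z ^ n * x^-1).
Proof.
elim: n => [|n IH]; first by rewrite !expr0z mulr1 mul1r subrr; apply: rspan0.
have -> : x^-1 * y ^ n.+1 - z ^ n.+1 * x^-1 = (x^-1 * y ^ n - z ^ n * x^-1) * y ^ 1
  + (- dl *: (z ^ n * y) + dl *: (z ^ n * e * y)).
  have h : x^-1 * y = z * x^-1 - dl *: y + dl *: (e * y).
    by rewrite -xy rank2_xV; expand_products.
  rewrite expr1z !exprSzr; expand_products; rewrite h.
  by expand_products; linear_identity R A.
have -> : n.+1%:Z = n%:Z + 1 by lia.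
apply: rspanD; first by apply: zye_mulr IH => b; lia.
have e2 : n%:Z + 1 - n%:Z = 1 by lia.
apply: (span1 (b := n%:Z)); rewrite ?e2 ?expr1z //; first by lia.
by rewrite rank2_ze.
Qed.

Lemma rank2_ynx (n : nat) :
  span (zey (fun b => (0 <= b) && (b <= n%:Z)) n) (y ^ n * x - x * z ^ n).
Proof.
elim: n => [|n IH]; first by rewrite !expr0z mulr1 mul1r subrr; apply: rspan0.
have -> : y ^ n.+1 * x - x * z ^ n.+1 = y ^ 1 * (y ^ n * x - x * z ^ n)
  + (- dl *: (z * z ^ n) + dl *: (e * z * z ^ n)).
  have h : y * x = x * z - dl *: z + dl *: (e * z).
    by rewrite yx rank2_xV; expand_products.
  rewrite expr1z !exprSz; expand_products.
  have -> : y * (x * z ^ n) = y * x * z ^ n by rewrite mulrA.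
  by rewrite h; expand_products; linear_identity R A.
have -> : n.+1%:Z = n%:Z + 1 by lia.
apply: rspanD; first by apply: zey_mull IH => b; lia.
apply: (span2 (b := n%:Z + 1)); rewrite ?subrr ?expr0z ?mulr1 ?mul1r; first by lia.
  by rewrite addrC exprzDr // expr1z.
by rewrite -mulrA -exprSz rank2_ez; congr (_ * y ^ _); lia.
Qed.

Lemma rank2_yNx (n : nat) :
  span (zey (fun b => (- n%:Z < b) && (b <= 0)) (- n%:Z))
    (y ^ (- n%:Z) * x - x * z ^ (- n%:Z)).
Proof.
elim: n => [|n IH]; first by rewrite !expr0z mulr1 mul1r subrr; apply: rspan0.
have e1 : - n.+1%:Z = -1 + - n%:Z by lia.
have -> : y ^ (- n.+1%:Z) * x - x * z ^ (- n.+1%:Z)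
  = y ^ (-1) * (y ^ (- n%:Z) * x - x * z ^ (- n%:Z))
  + (- (- dl) *: (y^-1 * z ^ (- n%:Z)) + (- dl) *: (y^-1 * (e * z ^ (- n%:Z)))).
  have h : x * z^-1 = y^-1 * x - dl *: y^-1 + dl *: (y^-1 * e).
    have -> : x * z^-1 = y^-1 * x^-1.
      by apply: (mulIr uz); rewrite mulrVK // -mulrA -yx mulKr.
    by rewrite rank2_xV; expand_products.
  rewrite e1 !exprzDr // !exprN1; expand_products; rewrite [x * (z^-1 * _)]mulrA h.
  by expand_products; linear_identity R A.
have -> : - n.+1%:Z = - n%:Z + -1 by lia.
apply: rspanD; first by apply: zey_mull IH => b; lia.
have e2 : - n%:Z + -1 - - n%:Z = -1 by lia.
apply: (span2 (b := - n%:Z)); rewrite ?e2 ?exprN1 //; first by lia.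
  by rewrite -exprN1 rank2_yz.
by rewrite rank2_ez mulrA.
Qed.

(** Serves the exponent k/2 for even k in [XVprod_raise]: all powers of z in the corrections are
    nonnegative and strictly below n. *)
Lemma rank2_xVzn (n : nat) :
  span (zey (fun b => (0 <= b) && (b < n%:Z)) n) (x^-1 * z ^ n - y ^ n * x^-1).
Proof.
elim: n => [|n IH]; first by rewrite !expr0z mulr1 mul1r subrr; apply: rspan0.
have -> : x^-1 * z ^ n.+1 - y ^ n.+1 * x^-1 = y ^ 1 * (x^-1 * z ^ n - y ^ n * x^-1)
  + (- (- dl) *: (y * z ^ n) + (- dl) *: (y * (e * z ^ n))).
  have h : x^-1 * z = y * x^-1 + dl *: y - dl *: (y * e).
    by rewrite -yx rank2_xV; expand_products; linear_identity R A.
  rewrite expr1z !exprSz; expand_products.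
  by rewrite [x^-1 * (z * _)]mulrA h; expand_products; linear_identity R A.
have -> : n.+1%:Z = n%:Z + 1 by lia.
apply: rspanD; first by apply: zey_mull IH => b; lia.
have e2 : n%:Z + 1 - n%:Z = 1 by lia.
apply: (span2 (b := n%:Z)); rewrite ?e2 ?expr1z //; first by lia.
  by apply: (rank2_yz 1).
by rewrite rank2_ez mulrA.
Qed.

Lemma rank2_xys s : span (zye (between s) s) (x * y ^ s - z ^ s * x).
Proof.
case: (intP s) => [|n|n]; first by rewrite !expr0z mulr1 mul1r subrr; apply: rspan0.
- apply: rspan_min (rank2_xyn n.+1) => [|v [b hb hv]]; first exact: rspan_linear.
  by apply: rspan_in => //; exists b; rewrite // /between; lia.
- apply: rspan_min (rank2_xyN n.+1) => [|v [b hb hv]]; first exact: rspan_linear.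
  by apply: rspan_in => //; exists b; rewrite // /between; lia.
Qed.

Lemma rank2_ysx s : span (zey (between s) s) (y ^ s * x - x * z ^ s).
Proof.
case: (intP s) => [|n|n]; first by rewrite !expr0z mulr1 mul1r subrr; apply: rspan0.
- apply: rspan_min (rank2_ynx n.+1) => [|v [b hb hv]]; first exact: rspan_linear.
  by apply: rspan_in => //; exists b; rewrite // /between; lia.
- apply: rspan_min (rank2_yNx n.+1) => [|v [b hb hv]]; first exact: rspan_linear.
  by apply: rspan_in => //; exists b; rewrite // /between; lia.
Qed.

Let BM u v : B u -> B v -> B (u * v).
Proof. by case: hB => _ _; apply. Qed.

Let eyeC s : exists2 w, C w & e * y ^ s * e = e * w.
Proof. by have [w [Bw ew ->]] := om s; exists w. Qed.
Let eye s : exists2 w, B w & e * y ^ s * e = e * w.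
Proof. by have [w /CB Bw ->] := eyeC s; exists w. Qed.

(** Moving x to the left over y^s brings it next to e, where e x = lam e and e z = e y^{-1}; in the
    corrections, e y^t e is absorbed by [r2_om]. *)
Lemma rank2_eyx s : exists2 w, B w & e * y ^ s * x = e * w.
Proof.
pose W u := exists2 w, B w & u = e * w.
have hW : linear_closed B W.
  case: hB => hr hD _; split=> [|u v [a Ba ->] [b Bb ->]|u b [a Ba ->] Bb].
  - by exists 0; rewrite ?mulr0 // -(scale0r 1).
  - by exists (a + b); rewrite ?mulrDr //; apply: hD.
  - by exists (a * b); rewrite ?mulrA //; apply: BM.
have hWS := linear_closed_sub (fun u => @scalar_sub R A B u hB) hW.
have -> : e * y ^ s * x = lam *: (e * y ^ (- s)) + e * (y ^ s * x - x * z ^ s) * 1.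
  by rewrite mulr1 -rank2_ez scalerAl -ex mulrBr !mulrA addrC subrK.
case: (hW) => _ WD _; apply: WD.
  by apply: (linear_closedZ _ hB hW); exists (y ^ (- s)).
apply: span_min (rank2_ysx s) => // v [b _ [] ->].
  exists (y ^ (- b) * y ^ (s - b)); first exact: BM.
  by rewrite mulr1 mulrA rank2_ez mulrA.
have [w Bw hw] := eye (s - b).
by exists (w * y ^ (- b)); [exact: BM | rewrite mulr1 !mulrA hw].
Qed.

Lemma rank2_xye s :
  rspan (fun v => exists2 a, `|a| <= `|s| & v = y ^ a * e) C (x * y ^ s * e).
Proof.
set S := fun v => _.
have hW := rspan_linear S hC.
have hWS := linear_closed_sub (fun u => @scalar_sub R A C u hC) hW.
have -> : x * y ^ s * e = lam *: (y ^ (- s) * e) + 1 * (x * y ^ s - z ^ s * x) * e.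
  by rewrite mul1r -rank2_ze scalerAr -xe mulrBl !mulrA addrC subrK.
apply: rspanD.
  by apply: rspanZ => //; apply: rspan_in => //; exists (- s); rewrite ?normrN.
apply: span_min (rank2_xys s) => // v [b hb [] ->].
  apply: rspan_in => //; exists (s - b - b); first by move: hb; rewrite /between; lia.
  by rewrite mul1r -rank2_yz -mulrA rank2_ze mulrA -exprzDr.
have [w Bw hw]   := eyeC (s - b).
rewrite mul1r -!mulrA [e * _]mulrA hw mulrA; apply: rspan_gen => //.
by exists (- b) => //; move: hb; rewrite /between; lia.
Qed.

Section Combinations.
Variables (c : int -> bool) (m : int).
Local Notation G := (rspan (zyx c m) B).

Let G_z b u : c b -> B u -> G (z ^ b * u).
Proof. by move=> hb Bu; apply: rspan_gen => //; left; exists b. Qed.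
Let G_yx a u : `|a| <= m -> B u -> G (y ^ a * x * u).
Proof. by move=> ha Bu; apply: rspan_gen => //; right; exists a; auto. Qed.
Let G_ye a u : `|a| <= m -> B u -> G (y ^ a * e * u).
Proof. by move=> ha Bu; apply: rspan_gen => //; right; exists a; auto. Qed.

Let hG : linear_closed B G := rspan_linear _ hB.
Let hGS : linear_closed (@scalar R A) G :=
  linear_closed_sub (fun u => @scalar_sub R A B u hB) hG.

Let G_zx a b : (forall b', between b b' -> c b') -> `|a| + `|b| <= m ->
  G (y ^ a * z ^ b * x).
Proof.
move=> hc hab.
have -> : y ^ a * z ^ b * x
    = y ^ a * x * y ^ b - y ^ a * (x * y ^ b - z ^ b * x) * 1.
  by rewrite mulr1 mulrBr !mulrA opprB addrC subrK.
apply: rspanB => //; first by apply: G_yx => //; lia.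
apply: span_min (rank2_xys b) => // v [b' hb' [] ->]; rewrite mulr1.
  by rewrite mulrA rank2_yz -mulrA; apply: G_z; [exact: hc | exact: BM].
rewrite !mulrA -exprzDr // ; apply: G_ye => //.
by move: hb'; rewrite /between; lia.
Qed.

Let G_eyx a s : `|a| <= m -> G (y ^ a * e * y ^ s * x).
Proof.
move=> ha; have [w Bw hw] := rank2_eyx s.
by rewrite -!mulrA [e * _]mulrA hw mulrA; apply: G_ye.
Qed.

Let G_eye a s : `|a| <= m -> G (y ^ a * e * y ^ s * e).
Proof.
move=> ha; have [w Bw hw] := eye s.
by rewrite -!mulrA [e * _]mulrA hw mulrA; apply: G_ye.
Qed.

Lemma rank2_xzs s : (forall b, between s b -> c b) -> `|s| <= m -> G (x * z ^ s).
Proof.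
move=> hc hm.
have -> : x * z ^ s = y ^ s * x * 1 - 1 * (y ^ s * x - x * z ^ s) * 1.
  by rewrite mul1r !mulr1 opprB addrC subrK.
apply: rspanB => //; first by apply: G_yx => //; apply: subalgebra1.
apply: span_min (rank2_ysx s) => // v [b hb [] ->]; rewrite mul1r mulr1.
  by apply: G_z => //; apply: hc.
by apply: G_ye => //; move: hb; rewrite /between; lia.
Qed.

(** Moving the first x over y^s leaves z^s x x, and the quadratic relation for x returns z^s, z^s x
    and z^s e. *)
Lemma rank2_xysx s : (forall b, between s b -> c b) -> `|s| <= m ->
  G (x * y ^ s * x).
Proof.
move=> hc hm.
have -> : x * y ^ s * x = z ^ s * 1 + dl *: (y ^ 0 * z ^ s * x)
    - (dl * lam) *: (y ^ (- s) * e * 1) + 1 * (x * y ^ s - z ^ s * x) * x.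
  rewrite mul1r !mulr1 expr0z mul1r mulrBl -rank2_ze -[z ^ s * x * x]mulrA rank2_xx.
  by expand_products; linear_identity R A.
apply: rspanD; first apply: rspanB => //; first apply: rspanD.
- apply: G_z; [by apply: hc; rewrite /between; lia|exact: subalgebra1].
- by apply: rspanZ => //; apply: G_zx => //; rewrite normr0 add0r.
- by apply: rspanZ => //; apply: G_ye; rewrite ?normrN //; apply: subalgebra1.
apply: span_min (rank2_xys s) => // v [b hb [] ->]; rewrite mul1r.
  rewrite -rank2_yz; apply: G_zx; last by move: hb; rewrite /between; lia.
  by move=> b' hb'; apply: hc; move: hb hb'; rewrite /between; lia.
by apply: G_eyx; move: hb; rewrite /between; lia.
Qed.

(** The sign of the exponent selects the conjugate: x^{-1} y^n x for positive powers, x y^{-n}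
    x^{-1} for negative ones. For these the corrections omit the extreme power of z, so they can be
    used in an induction on |s|. *)
Lemma rank2_zpos (n : nat) : (forall b, 0 <= b < n%:Z -> c b) -> n%:Z <= m ->
  G (z ^ n - x^-1 * y ^ n * x).
Proof.
move=> hc hm.
have -> : z ^ n - x^-1 * y ^ n * x = 0 - 1 * (x^-1 * y ^ n - z ^ n * x^-1) * x.
  by rewrite mul1r mulrBl mulrVK // opprB add0r.
apply: rspanB => //; first exact: rspan0.
apply: span_min (rank2_xVyn n) => // v [b hb [] ->]; rewrite mul1r.
  rewrite -rank2_yz; apply: G_zx; last by lia.
  by move=> b' hb'; apply: hc; move: hb hb'; rewrite /between; lia.
by apply: G_eyx; lia.
Qed.

Lemma rank2_zneg (n : nat) : (forall b, - n%:Z < b <= 0 -> c b) -> n%:Z <= m ->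
  G (z ^ (- n%:Z) - x * y ^ (- n%:Z) * x^-1).
Proof.
move=> hc hm; set s := - n%:Z.
have -> : z ^ s - x * y ^ s * x^-1 = 0 - 1 * (x * y ^ s - z ^ s * x) * x^-1.
  by rewrite mul1r mulrBl mulrK // opprB add0r.
apply: rspanB => //; first exact: rspan0.
have xV u : u * x^-1 = u * x - dl *: u + dl *: (u * e).
  by rewrite rank2_xV; expand_products.
apply: span_min (rank2_xyN n) => // v [b hb [] ->]; rewrite mul1r xV;
  (apply: rspanD; first apply: rspanB => //); try apply: rspanZ => //.
- rewrite -rank2_yz; apply: G_zx; last by lia.
  by move=> b' hb'; apply: hc; move: hb hb'; rewrite /between; lia.
- by apply: G_z => //; apply: hc; lia.
- rewrite -rank2_yz -mulrA rank2_ze mulrA -exprzDr // -[_ * e]mulr1.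
  by apply: G_ye; [lia | exact: subalgebra1].
- by apply: G_eyx; lia.
- by apply: G_ye => //; lia.
- by apply: G_eye; lia.
Qed.
End Combinations.
End RankTwo.

(** * Interpretation of terms in an algebra *)

Section Evaluation.
Variables (R : comUnitRingType) (A : unitAlgType R) (G : Type).

Fixpoint ev (f : G -> A) (a : term R G) : A :=
  match a with
  | TC r => r%:A
  | TG g => f g
  | TAdd x y => ev f x + ev f y
  | TMul x y => ev f x * ev f y
  end.

Variable f : G -> A.

Lemma ev_tscale r a : ev f (tscale r a) = r *: ev f a.
Proof. by rewrite /= mulr_algl. Qed.

Lemma ev_tsub a b : ev f (tsub a b) = ev f a - ev f b.
Proof. by rewrite /= mulr_algl scaleN1r. Qed.

Lemma ev_tprod s : ev f (tprod s) = foldr *%R 1 [seq ev f a | a <- s].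
Proof. by elim: s => [|a s IH] /=; rewrite ?scale1r // -IH. Qed.

Lemma ev_tsum s : ev f (tsum s) = \sum_(a <- s) ev f a.
Proof. by elim: s => [|a s IH] /=; rewrite ?big_nil ?big_cons ?scale0r // -IH. Qed.

Lemma ev_tpow a m : ev f (tpow a m) = ev f a ^+ m.
Proof.
by rewrite /tpow ev_tprod map_nseq; elim: m => // m IH; rewrite exprS -IH.
Qed.

Lemma ev_tcomb (c : nat -> R) (w : nat -> term R G) m :
  ev f (tsum [seq tscale (c y) (w y) | y <- iota 0 m])
  = \sum_(y < m) c y *: ev f (w y).
Proof.
have e : iota 0 m = index_iota 0 m by rewrite /index_iota subn0.
rewrite ev_tsum big_map e big_mkord.
by apply: eq_bigr => i _; rewrite ev_tscale.
Qed.
End Evaluation.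

(** * Jucys-Murphy elements *)

Definition far (i j : nat) := ((i + 2 <= j) || (j + 2 <= i))%N.
Definition adjacent (i j : nat) := (i == j.+1) || (j == i.+1).

Section Relations.
Variables (R : comUnitRingType) (A : unitAlgType R) (N k : nat).
Variables (q lam : R) (qs As : nat -> R) (X XI E : nat -> A) (Y : A) (st : A -> A).
Local Notation dl := (q - q^-1).
Local Notation valid i := (0 < i < N)%N.

(** The relations are imposed on elements of an arbitrary algebra, so that the argument takes place
    in a ring with inverses. [XI] stays separate because it is known to be the inverse of [X] only
    at valid indices. *)
Record bmw_relations : Prop := BmwRelations {
  bmw_uY : Y \is a GRing.unit;
  bmw_uX i : valid i -> X i \is a GRing.unit;
  bmw_XI i : valid i -> XI i = (X i)^-1;
  bmw_skein i : valid i -> X i - (X i)^-1 = dl *: (1 - E i);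
  bmw_XX i j : valid i -> valid j -> far i j -> X i * X j = X j * X i;
  bmw_XEf i j : valid i -> valid j -> far i j -> X i * E j = E j * X i;
  bmw_EEf i j : valid i -> valid j -> far i j -> E i * E j = E j * E i;
  bmw_braid i : valid i -> valid i.+1 -> X i * (X i.+1 * X i) = X i.+1 * (X i * X i.+1);
  bmw_XE i : valid i -> X i * E i = lam *: E i;
  bmw_EX i : valid i -> E i * X i = lam *: E i;
  bmw_XXE i j : valid i -> valid j -> adjacent i j -> X i * (X j * E i) = E j * E i;
  bmw_EXX i j : valid i -> valid j -> adjacent i j -> E j * E i = E j * (X i * X j);
  bmw_EEE i j : valid i -> valid j -> adjacent i j -> E i * (E j * E i) = E i;
  bmw_EE i : valid i -> E i * E i = As 0 *: E i;
  bmw_Yk : Y ^+ k = \sum_(i < k) qs i *: Y ^+ i;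
  bmw_YXYX : valid 1 -> X 1 * (Y * (X 1 * Y)) = Y * (X 1 * (Y * X 1));
  bmw_YX i : valid i -> (1 < i)%N -> Y * X i = X i * Y;
  bmw_YE i : valid i -> (1 < i)%N -> Y * E i = E i * Y;
  bmw_YXYE : valid 1 -> Y * (X 1 * (Y * E 1)) = lam^-1 *: E 1;
  bmw_EYXY : valid 1 -> E 1 * (Y * (X 1 * Y)) = lam^-1 *: E 1;
  bmw_EYE m : valid 1 -> (m < k)%N -> E 1 * (Y ^+ m * E 1) = As m *: E 1 }.

Record bmw_star : Prop := BmwStar {
  stD u v : st (u + v) = st u + st v;
  stM u v : st (u * v) = st v * st u;
  stZ r u : st (r *: u) = r *: st u;
  st1 : st 1 = 1;
  stX i : st (X i) = X i;
  stXI i : st (XI i) = XI i;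
  stE i : st (E i) = E i;
  stY : st Y = Y;
  stK u : st (st u) = u }.

Hypotheses (rel : bmw_relations) (str : bmw_star).
Hypotheses (uq0 : qs 0 \is a GRing.unit) (ulam : lam \is a GRing.unit).
Hypothesis k_gt0 : (0 < k)%N.

Let uY := bmw_uY rel.
Let uX := bmw_uX rel.

Lemma st_exprz u (s : int) : u \is a GRing.unit -> st u = u -> st (u ^ s) = u ^ s.
Proof.
move=> uu su; have suV : st u^-1 = u^-1.
  apply: (mulrI uu); rewrite mulrV //.
  by have := congr1 st (mulVr uu); rewrite (stM str) su (st1 str).
have hX v (n : nat) : st v = v -> st (v ^+ n) = v ^+ n.
  move=> sv; elim: n => [|n IH]; first by rewrite expr0 (st1 str).
  by rewrite {1}exprS (stM str) IH sv exprSr.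
by case: s => n; [exact: hX | rewrite NegzE -exprz_inv; apply: hX].
Qed.

(* The image of B_l^k in A. *)
Inductive subBMW (l : nat) : A -> Prop :=
  | subBMW_scalar (r : R) : subBMW l r%:A
  | subBMW_Y : (0 < l)%N -> subBMW l Y
  | subBMW_YV : (0 < l)%N -> subBMW l Y^-1
  | subBMW_X i : (0 < i < l)%N -> subBMW l (X i)
  | subBMW_E i : (0 < i < l)%N -> subBMW l (E i)
  | subBMWD u v : subBMW l u -> subBMW l v -> subBMW l (u + v)
  | subBMWM u v : subBMW l u -> subBMW l v -> subBMW l (u * v).

Lemma subBMW_subalgebra l : subalgebra (subBMW l).
Proof. by split; [exact: subBMW_scalar | exact: subBMWD | exact: subBMWM]. Qed.

Lemma subBMW1 l : subBMW l 1.
Proof. exact: subalgebra1 (subBMW_subalgebra l). Qed.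

Lemma subBMW_le l m u : (l <= m)%N -> subBMW l u -> subBMW m u.
Proof.
move=> lm; elim=> [r|h|h|i h|i h|a b _ ? _ ?|a b _ ? _ ?].
- exact: subBMW_scalar.
- by apply: subBMW_Y; lia.
- by apply: subBMW_YV; lia.
- by apply: subBMW_X; lia.
- by apply: subBMW_E; lia.
- exact: subBMWD.
- exact: subBMWM.
Qed.

Lemma skeinV i : valid i -> (X i)^-1 = X i - dl *: 1 + dl *: E i.
Proof.
move=> hi; have -> : (X i)^-1 = X i - (X i - (X i)^-1) by linear_identity R A.
by rewrite (bmw_skein rel) //; linear_identity R A.
Qed.

Lemma subBMW_XV l i : (l <= N)%N -> (0 < i < l)%N -> subBMW l (X i)^-1.
Proof.
move=> lN hi; have hB := subBMW_subalgebra l.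
rewrite skeinV; last by lia.
apply: subBMWD; last by apply: subalgebraZ => //; apply: subBMW_E.
apply: subBMWD; first exact: subBMW_X.
by rewrite -scaleNr; apply: subBMW_scalar.
Qed.

Lemma subBMW_comm l u : ((0 < l)%N -> u * Y = Y * u) ->
  (forall i, (0 < i < l)%N -> u * X i = X i * u) ->
  (forall i, (0 < i < l)%N -> u * E i = E i * u) ->
  forall b, subBMW l b -> u * b = b * u.
Proof.
move=> hY hX hE b; elim=> [r|h|h|i h|i h|a c _ IH1 _ IH2|a c _ IH1 _ IH2].
- by rewrite mulr_algl mulr_algr.
- exact: hY.
- by apply: commrV; apply: hY.
- exact: hX.
- exact: hE.
- by rewrite mulrDr mulrDl IH1 IH2.
- by rewrite mulrA IH1 -!mulrA IH2.
Qed.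

Lemma X_subBMW j l b : valid j -> (l < j)%N -> subBMW l b -> X j * b = b * X j.
Proof.
move=> hj lj; apply: subBMW_comm => [h|i hi|i hi].
- by rewrite (bmw_YX rel) //; lia.
- by apply: (bmw_XX rel) => //; rewrite /far; lia.
- by apply: (bmw_XEf rel) => //; rewrite /far; lia.
Qed.

Lemma E_subBMW j l b : valid j -> (l < j)%N -> subBMW l b -> E j * b = b * E j.
Proof.
move=> hj lj; apply: subBMW_comm => [h|i hi|i hi].
- by rewrite (bmw_YE rel) //; lia.
- by apply/esym/(bmw_XEf rel) => //; rewrite /far; lia.
- by apply: (bmw_EEf rel) => //; rewrite /far; lia.
Qed.

Fixpoint jm_rec (i : nat) : A :=
  match i with
  | 0 => 1
  | i'.+1 => if i' is 0 then Y else X i' * jm_rec i' * X i'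
  end.

(* [JM i] is Y_i' for 1 <= i; [JM 0] is junk. *)
Definition JM := locked jm_rec.

Lemma JMS i : (0 < i)%N -> JM i.+1 = X i * JM i * X i.
Proof. by rewrite /JM -lock; case: i. Qed.

Lemma JM0 : JM 0 = 1. Proof. by rewrite /JM -lock. Qed.
Lemma JM1 : JM 1 = Y. Proof. by rewrite /JM -lock. Qed.

Lemma JM_unit i : (0 < i <= N)%N -> JM i \is a GRing.unit.
Proof.
elim: i => // -[|i] IH hi; first by rewrite JM1; apply: uY.
have ui : X i.+1 \is a GRing.unit by apply: uX; lia.
by rewrite JMS // !unitrMr // IH //; lia.
Qed.

Lemma subBMW_JMV i : (0 < i <= N)%N -> subBMW i (JM i) /\ subBMW i (JM i)^-1.
Proof.
elim: i => // -[|i] IH hi; first by rewrite JM1; split; [exact: subBMW_Y|exact: subBMW_YV].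
have [] := IH _; first lia.
have hi1 : (i.+1 <= i.+2)%N by lia.
move=> /(subBMW_le hi1) h1 /(subBMW_le hi1) h2.
have ui : X i.+1 \is a GRing.unit by apply: uX; lia.
have hX : subBMW i.+2 (X i.+1) by apply: subBMW_X; lia.
have hXV : subBMW i.+2 (X i.+1)^-1 by apply: subBMW_XV; lia.
have uJ : JM i.+1 \is a GRing.unit by apply: JM_unit; lia.
rewrite JMS // !invrM ?unitrMr //; by split; do ![apply: subBMWM => //].
Qed.

Lemma subBMW_JM i l (s : int) : (0 < i <= l)%N -> (l <= N)%N -> subBMW l (JM i ^ s).
Proof.
move=> hi lN; have [|h1 h2] := @subBMW_JMV i; first by lia.
have hM u (n : nat) : subBMW i u -> subBMW i (u ^+ n).
  move=> hu; elim: n => [|n IH]; first by rewrite expr0; apply: subBMW1.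
  by rewrite exprS; apply: subBMWM.
apply: (@subBMW_le i); first by lia.
case: s => n; first exact: hM.
by rewrite NegzE -exprz_inv; apply: hM.
Qed.

Lemma braidA i t : valid i -> valid i.+1 ->
  X i * (X i.+1 * (X i * t)) = X i.+1 * (X i * (X i.+1 * t)).
Proof. by move=> h1 h2; rewrite (mulCA3 _ (bmw_braid rel h1 h2)) -!mulrA. Qed.

(** The computation is the case i = j + 2: the braid relation turns X_j into X_{j+1}, which passes
    Y_j', and a second braid move turns it back. Larger i follow by far commutation. *)
Lemma X_JM j i : valid j -> (j.+1 < i)%N -> (i <= N)%N -> X j * JM i = JM i * X j.
Proof.
move=> hj; elim: i => // i IH ji iN; rewrite JMS; last by lia.
have hi : valid i by lia.
have [jj|jj] := ltnP j.+1 i.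
  rewrite -!mulrA (mulCA _ (bmw_XX rel hj hi _)) /far; last by lia.
  rewrite -!mulrA (mulCA _ (IH _ _)) //; last by lia.
  by rewrite -!mulrA (bmw_XX rel hj hi) // /far; lia.
have -> : i = j.+1 by lia.
have hj1 : valid j.+1 by lia.
rewrite JMS; last by lia.
have c t : X j.+1 * (JM j * t) = JM j * (X j.+1 * t).
  apply: commCA; apply: (X_subBMW hj1 (ltnSn j)).
  by rewrite -[JM j]expr1z; apply: subBMW_JM; lia.
by rewrite -!mulrA braidA // c (bmw_braid rel hj hj1).
Qed.

Lemma E_JM j i : valid j -> (j.+1 < i)%N -> (i <= N)%N -> E j * JM i = JM i * E j.
Proof.
move=> hj; elim: i => // i IH ji iN; rewrite JMS; last by lia.
have hi : valid i by lia.
have fij : far i j \/ i = j.+1 by rewrite /far; lia.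
case: fij => [fij|ij].
  have c := esym (bmw_XEf rel hi hj fij).
  rewrite -!mulrA (mulCA _ c) -!mulrA (mulCA _ (IH _ _)); try lia.
    by rewrite -!mulrA c.
  by move: fij; rewrite /far; lia.
rewrite ij JMS; last by lia.
have hj1 : valid j.+1 by lia.
have c t : E j.+1 * (JM j * t) = JM j * (E j.+1 * t).
  apply: commCA; apply: (E_subBMW hj1 (ltnSn j)).
  by rewrite -[JM j]expr1z; apply: subBMW_JM; lia.
have a1 : adjacent j j.+1 by rewrite /adjacent eqxx orbT.
have a2 : adjacent j.+1 j by rewrite /adjacent eqxx.
have h1 t : E j * (X j.+1 * (X j * t)) = X j.+1 * (X j * (E j.+1 * t)).
  rewrite (mulCA3 _ (esym (bmw_EXX rel hj1 hj a2))).
  by rewrite [RHS](mulCA3 _ (bmw_XXE rel hj1 hj a2)).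
rewrite -!mulrA h1 c -(bmw_EXX rel hj hj1 a1) -(bmw_XXE rel hj hj1 a1).
by rewrite !mulrA.
Qed.

Lemma Y_JM i : (1 < i <= N)%N -> Y * JM i = JM i * Y.
Proof.
elim: i => // -[|[|i]] IH hi //.
  by rewrite JMS // JM1 -!mulrA -(bmw_YXYX rel) //; lia.
rewrite JMS //; have c : Y * X i.+2 = X i.+2 * Y by rewrite (bmw_YX rel) //; lia.
rewrite -!mulrA (mulCA _ c) -!mulrA (mulCA _ (IH _)); last by lia.
by rewrite -!mulrA c.
Qed.

Lemma JM_subBMW i b : (0 < i <= N)%N -> subBMW i.-1 b -> JM i * b = b * JM i.
Proof.
move=> hi; apply: subBMW_comm => [h|j hj|j hj]; last 2 first.
- by apply/esym/X_JM; lia.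
- by apply/esym/E_JM; lia.
by apply/esym/Y_JM; lia.
Qed.

Lemma JM_JMS i : valid i -> JM i * JM i.+1 = JM i.+1 * JM i.
Proof.
move=> hi; apply/esym/JM_subBMW; first by lia.
by rewrite -[JM i]expr1z; apply: subBMW_JM; lia.
Qed.

Lemma st_JM i : st (JM i) = JM i.
Proof.
elim: i => [|[|i] IH]; [by rewrite JM0 st1 | by rewrite JM1 stY |].
by rewrite JMS // !(stM str) IH !(stX str) mulrA.
Qed.

(** With i the old index, Y_{i+1}' Y_{i+2}' = X_i X_{i+1} (Y_i' Y_{i+1}') X_{i+1} X_i. On e_{i+1}
    the last two factors give e_i e_{i+1}, the induction hypothesis removes the bracket, and the
    outer X's give e_{i+1} e_i e_{i+1} = e_{i+1}. *)
Lemma JM_JM_E i : valid i -> JM i * JM i.+1 * E i = E i.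
Proof.
elim: i => // -[|i] IH hi.
  rewrite (@JMS 1) // JM1 -!mulrA (bmw_XE rel) // -!scalerAr (bmw_YXYE rel) //.
  by rewrite scalerA mulrV // scale1r.
have hi1 : valid i.+1 by lia.
have a1 : adjacent i.+1 i.+2 by rewrite /adjacent eqxx orbT.
have a2 : adjacent i.+2 i.+1 by rewrite /adjacent eqxx.
have c t : X i.+2 * (JM i.+1 * t) = JM i.+1 * (X i.+2 * t).
  apply: commCA; apply: (X_subBMW hi (ltnSn _)).
  by rewrite -[JM i.+1]expr1z; apply: subBMW_JM; lia.
have -> : JM i.+2 * JM i.+3
    = X i.+1 * (X i.+2 * (JM i.+1 * JM i.+2 * (X i.+2 * X i.+1))).
  rewrite ![JM i.+3]JMS // ![JM i.+2]JMS // -!mulrA braidA // -c.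
  by rewrite [X i.+2 * (JM i.+1 * (X i.+1 * X i.+2))]c -(bmw_braid rel hi1 hi).
rewrite -!mulrA (bmw_XXE rel hi hi1 a2) !mulrA -[_ * JM i.+1 * _]mulrA.
rewrite -[_ * (JM i.+1 * JM i.+2) * E _]mulrA IH //.
by rewrite -!mulrA (mulCA3 _ (bmw_XXE rel hi1 hi a1)) -mulrA (bmw_EEE rel hi hi1 a2).
Qed.

Lemma E_JM_JM i : valid i -> E i * (JM i * JM i.+1) = E i.
Proof.
move=> hi; have := congr1 st (JM_JM_E hi).
by rewrite !(stM str) (stE str) !st_JM -JM_JMS // .
Qed.

Lemma XVE i j : valid i -> valid j -> adjacent i j ->
  (X j)^-1 * E i = X i * (E j * E i).
Proof.
move=> hi hj a; have uj := uX hj; have a' : adjacent j i by move: a; rewrite /adjacent orbC.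
apply: (mulrI uj); rewrite mulVKr //.
by rewrite (mulCA3 _ (bmw_XXE rel hj hi a')) -mulrA (bmw_EEE rel hi hj a).
Qed.

Lemma EXV i j : valid i -> valid j -> adjacent i j ->
  E i * (X j)^-1 = E i * (E j * X i).
Proof.
move=> hi hj a; have uj := uX hj; have a' : adjacent j i by move: a; rewrite /adjacent orbC.
apply: (mulIr uj); rewrite mulrVK // -!mulrA -(bmw_EXX rel hi hj a).
by rewrite (bmw_EEE rel hi hj a).
Qed.

Lemma EXE i j : valid i -> valid j -> adjacent i j -> E i * (X j * E i) = lam^-1 *: E i.
Proof.
move=> hi hj a; have := congr1 ( *%R (E i)) (bmw_XXE rel hi hj a).
rewrite (mulCA _ (bmw_EX rel hi)) (bmw_EEE rel hi hj a) -scalerAl => h.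
by rewrite -[in RHS]h scalerA mulVr // scale1r.
Qed.

(* Multiplication by Y and Y^-1 keeps any window of k consecutive powers, because
   Y satisfies a monic equation of degree k with invertible constant term. *)
Lemma Y_window (a s : int) :
  rspan (fun v => exists2 t : int, a <= t < a + k%:Z & v = Y ^ t) (@scalar R A) (Y ^ s).
Proof.
set S := fun v => _; have hS := @scalar_subalgebra R A.
have hL := rspan_linear S hS.
have gen t : a <= t < a + k%:Z -> rspan S (@scalar R A) (Y ^ t).
  by move=> ht; apply: rspan_in => //; exists t.
have sumL (I : eqType) (r : seq I) (P : pred I) (F : I -> A) :
    (forall i, i \in r -> P i -> rspan S (@scalar R A) (F i)) ->
    rspan S (@scalar R A) (\sum_(i <- r | P i) F i).
  move=> h; rewrite big_seq_cond; elim/big_rec: _ => [|i u /andP[hi Pi] hu]; first exact: rspan0.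
  by apply: rspanD => //; apply: h.
have Ykz t : Y ^ (t + k%:Z) = \sum_(i < k) qs i *: Y ^ (t + i%:Z).
  rewrite exprzDr // -[Y ^ k%:Z]/(Y ^+ k) (bmw_Yk rel) mulr_sumr.
  by apply: eq_bigr => i _; rewrite -scalerAr exprzDr.
have up : forall u, rspan S (@scalar R A) u -> rspan S (@scalar R A) (Y * u).
  move=> u; apply: rspan_minl => // v [t ht ->].
  rewrite -{1}[Y]expr1z -exprzDr //.
  have [h|h] := boolP (1 + t < a + k%:Z); first by apply: gen; lia.
  have -> : 1 + t = a + k%:Z by lia.
  rewrite Ykz; apply: sumL => i _ _; apply: rspanZ => //; apply: gen.
  by have := ltn_ord i; lia.
have down : forall u, rspan S (@scalar R A) u -> rspan S (@scalar R A) (Y^-1 * u).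
  move=> u; apply: rspan_minl => // v [t ht ->].
  rewrite -exprN1 -exprzDr //.
  have [h|h] := boolP (a <= -1 + t); first by apply: gen; lia.
  have -> : -1 + t = a - 1 by lia.
  have -> : Y ^ (a - 1) = (qs 0)^-1 *: (Y ^ (a - 1 + k%:Z)
     - \sum_(i < k | i != Ordinal k_gt0) qs i *: Y ^ (a - 1 + i%:Z)).
    rewrite Ykz (bigD1 (Ordinal k_gt0)) //= addrK scalerA mulVr // scale1r.
    by rewrite addr0.
  apply: rspanZ => //; apply: rspanB => //; first by apply: gen; lia.
  apply: sumL => i _ ni; apply: rspanZ => //; apply: gen.
  have : (i : nat) <> 0%N by move=> h0; case/eqP: ni; apply: val_inj.
  by have := ltn_ord i; lia.
suff h (t : int) u : rspan S (@scalar R A) u -> rspan S (@scalar R A) (Y ^ t * u).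
  have -> : Y ^ s = Y ^ (s - a) * Y ^ a by rewrite -exprzDr // subrK.
  by apply: h; apply: gen; lia.
elim/int_rect: t u => [|n IH|n IH] u hu; first by rewrite expr0z mul1r.
  by rewrite exprSzr -mulrA; apply: IH; apply: up.
have -> : - n.+1%:Z = - n%:Z + -1 by lia.
by rewrite exprzDr // exprN1 -mulrA; apply: IH; apply: down.
Qed.

(** The last axiom stays a hypothesis because its proof at index i + 1 uses the rules at index i;
    [rank_two_BMW] discharges it. *)
Lemma rank_two_JM i : valid i ->
  (forall s : int, exists2 w, subBMW i.-1 w & E i * JM i ^ s * E i = w * E i) ->
  rank_two (X i) (JM i) (JM i.+1) (E i) lam dl (subBMW i.-1) (subBMW i).
Proof.
move=> hi hom; have i0 : (0 < i)%N by lia.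
split.
- exact: uX.
- by apply: JM_unit; lia.
- exact: JMS.
- exact: JM_JMS.
- exact: (bmw_skein rel).
- exact: (bmw_XE rel).
- exact: (bmw_EX rel).
- exact: JM_JM_E.
- exact: E_JM_JM.
- exact: subBMW_subalgebra.
- exact: subBMW_subalgebra.
- by move=> u; apply: subBMW_le; lia.
- by move=> s; apply: subBMW_JM; lia.
move=> s; have [w hw e] := hom s; exists w; split=> //.
by apply: (E_subBMW hi _ hw); lia.
Qed.

(** At index 1 the window 0, ..., k - 1 is the one in which the relations e_1 Y^m e_1 = A_m e_1 are
    given. Above, an induction on |s| compares the power with its conjugate at the previous index;
    the corrections are harmless since e_i X_{i-1} e_i and e_i e_{i-1} e_i are multiples of e_i. *)
Lemma E_JM_E i (s : int) : valid i ->
  exists2 w, subBMW i.-1 w & E i * JM i ^ s * E i = w * E i.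
Proof.
pose W i u := exists2 w, subBMW i.-1 w & E i * u * E i = w * E i.
rewrite -/(W i (JM i ^ s)).
have hW j : valid j -> linear_closed (subBMW j.-1) (W j).
  move=> hj; split=> [|u v [a Ba ea] [b Bb eb]|u b [a Ba ea] Bb].
  - exists 0; last by rewrite mulr0 !mul0r.
    by rewrite -(scale0r 1); apply: subBMW_scalar.
  - by exists (a + b); [exact: subBMWD | rewrite mulrDr !mulrDl ea eb].
  - exists (a * b); first exact: subBMWM.
    have c : b * E j = E j * b by apply/esym; apply: (E_subBMW hj _ Bb); lia.
    by rewrite -!mulrA c [u * _]mulrA [E j * _]mulrA [E j * _]mulrA ea -!mulrA.
have hB := subBMW_subalgebra.
elim: i s => // -[|i] IH s hi.
  have hL := linear_closed_sub (fun b => @scalar_sub R A _ b (hB 0%N)) (hW 1%N hi).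
  rewrite JM1; apply: (rspan_min hL) (Y_window 0 s) => v [t ht ->].
  case: t ht => // t ht; exists (As t)%:A; first exact: subBMW_scalar.
  by rewrite -[Y ^ t]/(Y ^+ t) -mulrA (bmw_EYE rel) ?mulr_algl.
have hi1 : valid i.+1 by lia.
have hr := rank_two_JM hi1 (fun s => IH s hi1).
have a1 : adjacent i.+1 i.+2 by rewrite /adjacent eqxx orbT.
have a2 : adjacent i.+2 i.+1 by rewrite /adjacent eqxx.
have hJ t : subBMW i.+1 (JM i.+1 ^ t) by apply: subBMW_JM; lia.
have cJ t u : JM i.+1 ^ t * (E i.+2 * u) = E i.+2 * (JM i.+1 ^ t * u).
  by rewrite (commCA _ (E_subBMW hi (ltnSn _) (hJ _))).
have WL := hW i.+2 hi; have hB1 := hB i.+1.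
have G_W (c : int -> bool) m u : (forall b, c b -> W i.+2 (JM i.+2 ^ b)) ->
    rspan (zyx (X i.+1) (JM i.+1) (JM i.+2) (E i.+1) c m) (subBMW i.+1) u ->
    W i.+2 u.
  move=> hc; apply: rspan_min => // v [[b hb ->]|[a ha [] ->]]; first exact: hc.
  - exists (lam^-1 *: JM i.+1 ^ a); first by apply: subalgebraZ => //; apply: subBMW_JM; lia.
    rewrite -!mulrA -cJ (EXE hi hi1 a2) -scalerAr -scalerAl //.
  - exists (JM i.+1 ^ a); first by apply: subBMW_JM; lia.
    by rewrite -!mulrA -cJ (bmw_EEE rel hi hi1 a2).
(* Between two copies of e_{i+2}, conjugation by X_{i+1} becomes e_{i+1} times a conjugation by
   X_{i+2} times e_{i+1}. As X_{i+2} commutes with Y_{i+1}', it cancels, and the induction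
   hypothesis on i evaluates the rest. *)
have Wconj t : W i.+2 (X i.+1 * JM i.+1 ^ t * (X i.+1)^-1) /\
               W i.+2 ((X i.+1)^-1 * JM i.+1 ^ t * X i.+1).
  have [w hw e] := IH t hi1.
  have c0 : w * E i.+2 = E i.+2 * w by apply/esym; apply: (E_subBMW hi _ hw); lia.
  have hw' : subBMW i.+1 w by apply: subBMW_le hw; lia.
  have cX u : X i.+2 * (JM i.+1 ^ t * u) = JM i.+1 ^ t * (X i.+2 * u).
    exact: commCA (X_subBMW hi (ltnSn _) (hJ _)).
  have XVX u : X i.+2 * (JM i.+1 ^ t * ((X i.+2)^-1 * u)) = JM i.+1 ^ t * u.
    by rewrite cX mulVKr //; apply: uX.
  have VXX u : (X i.+2)^-1 * (JM i.+1 ^ t * (X i.+2 * u)) = JM i.+1 ^ t * u.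
    by rewrite -cX mulKr //; apply: uX.
  have EJE u : E i.+1 * (JM i.+1 ^ t * (E i.+1 * u)) = w * (E i.+1 * u).
    by rewrite !mulrA -e.
  have EXi : E i.+2 * X i.+1 = E i.+2 * (E i.+1 * (X i.+2)^-1).
    by apply: (mulIr (uX hi)); rewrite -!mulrA mulVr ?mulr1 ?(bmw_EXX rel hi1 hi a1) //; exact: uX.
  have XiE : X i.+1 * E i.+2 = (X i.+2)^-1 * (E i.+1 * E i.+2).
    by apply: (mulrI (uX hi)); rewrite mulVKr ?(bmw_XXE rel hi hi1 a2) //; exact: uX.
  split; exists w => //.
  - rewrite -!mulrA (XVE hi hi1 a2) (mulCA _ EXi) -!mulrA.
    by rewrite VXX EJE -(commCA _ c0) (bmw_EEE rel hi hi1 a2).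
  - rewrite -!mulrA XiE (mulCA _ (EXV hi hi1 a2)) -!mulrA.
    by rewrite XVX EJE -(commCA _ c0) (bmw_EEE rel hi hi1 a2).
have [m] := ubnP `|s|%N; elim: m s => // m IHm s sm.
case: (intP s) sm => [|n|n] sm.
- exists (As 0)%:A; first exact: subBMW_scalar.
  by rewrite expr0z mulr1 (bmw_EE rel) // mulr_algl.
- have := @rank2_zpos _ _ _ _ _ _ _ _ _ _ hr (fun b => 0 <= b < n.+1%:Z) n.+1 n.+1 (fun b => id) (lexx _).
  move/G_W => h.
  rewrite -[JM _ ^ _](subrK ((X i.+1)^-1 * JM i.+1 ^ n.+1 * X i.+1)).
  case: (hW i.+2 hi) => _ hD' _; apply: hD'; last by case: (Wconj n.+1).
  by apply: h => b hb; apply: IHm; lia.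
- have := @rank2_zneg _ _ _ _ _ _ _ _ _ _ hr (fun b => - n.+1%:Z < b <= 0) n.+1 n.+1 (fun b => id) (lexx _).
  move/G_W => h.
  rewrite -[JM _ ^ _](subrK (X i.+1 * JM i.+1 ^ (- n.+1%:Z) * (X i.+1)^-1)).
  case: (hW i.+2 hi) => _ hD' _; apply: hD'; last by case: (Wconj (- n.+1%:Z)).
  by apply: h => b hb; apply: IHm; lia.
Qed.

Lemma rank_two_BMW i : valid i ->
  rank_two (X i) (JM i) (JM i.+1) (E i) lam dl (subBMW i.-1) (subBMW i).
Proof. by move=> hi; apply: rank_two_JM => // s; apply: E_JM_E. Qed.

(** * The left ideal generated by e_{n-1} *)

Definition PX i j := \prod_(i <= t < j) X t.
Definition PE i j := \prod_(i <= t < j) E t.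

Lemma PX_nil i : PX i i = 1. Proof. by rewrite /PX big_geq. Qed.
Lemma PE_nil i : PE i i = 1. Proof. by rewrite /PE big_geq. Qed.
Lemma PX_l i j : (i < j)%N -> PX i j = X i * PX i.+1 j.
Proof. exact: big_ltn. Qed.
Lemma PE_l i j : (i < j)%N -> PE i j = E i * PE i.+1 j.
Proof. exact: big_ltn. Qed.
Lemma PX_r i j : (i <= j)%N -> PX i j.+1 = PX i j * X j.
Proof. exact: big_nat_recr. Qed.
Lemma PX_cat b i j : (i <= b)%N -> (b <= j)%N -> PX i j = PX i b * PX b j.
Proof. exact: big_cat_nat. Qed.
Lemma PE_cat b i j : (i <= b)%N -> (b <= j)%N -> PE i j = PE i b * PE b j.
Proof. exact: big_cat_nat. Qed.

Lemma prod_comm u (F : nat -> A) i j :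
  (forall t, (i <= t < j)%N -> u * F t = F t * u) ->
  u * \prod_(i <= t < j) F t = (\prod_(i <= t < j) F t) * u.
Proof.
move=> h; rewrite big_seq_cond; apply: commr_prod => t.
by rewrite andbT mem_index_iota => /h.
Qed.

Lemma subBMW_PX l i j : (0 < i)%N -> (j <= l)%N -> subBMW l (PX i j).
Proof.
move=> hi hj; rewrite /PX big_seq_cond; elim/big_rec: _ => [|t u]; first exact: subBMW1.
rewrite andbT mem_index_iota => ht hu; apply: subBMWM => //; apply: subBMW_X; lia.
Qed.

Lemma subBMW_PE l i j : (0 < i)%N -> (j <= l)%N -> subBMW l (PE i j).
Proof.
move=> hi hj; rewrite /PE big_seq_cond; elim/big_rec: _ => [|t u]; first exact: subBMW1.
rewrite andbT mem_index_iota => ht hu; apply: subBMWM => //; apply: subBMW_E; lia.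
Qed.

Lemma subBMW_comm_PX l i j b : (l < i)%N -> (j <= N)%N -> subBMW l b ->
  b * PX i j = PX i j * b.
Proof.
by move=> li jN hb; apply: prod_comm => t ht; apply/esym; apply: (X_subBMW _ _ hb); lia.
Qed.

Lemma subBMW_comm_PE l i j b : (l < i)%N -> (j <= N)%N -> subBMW l b ->
  b * PE i j = PE i j * b.
Proof.
by move=> li jN hb; apply: prod_comm => t ht; apply/esym; apply: (E_subBMW _ _ hb); lia.
Qed.

Lemma adjSl i : adjacent i.+1 i. Proof. by rewrite /adjacent eqxx. Qed.
Lemma adjSr i : adjacent i i.+1. Proof. by rewrite /adjacent eqxx orbT. Qed.

Lemma X_PX b i j : (0 < i <= b)%N -> (b.+1 < j <= N)%N ->
  X b.+1 * PX i j = PX i j * X b.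
Proof.
move=> hi hj; have hb : valid b by lia.
have hb1 : valid b.+1 by lia.
rewrite (@PX_cat b) ?(@PX_l b) ?(@PX_l b.+1); try lia.
have c1 : X b.+1 * PX i b = PX i b * X b.+1.
  by apply: (X_subBMW hb1 (ltnSn b)); apply: subBMW_PX; lia.
have c2 : X b * PX b.+2 j = PX b.+2 j * X b.
  by apply: (@subBMW_comm_PX b.+1); [lia|lia|apply: subBMW_X; lia].
by rewrite (commCA _ c1) -!mulrA -c2 -braidA.
Qed.

Lemma E_PX b i j : (0 < i <= b)%N -> (b.+1 < j <= N)%N ->
  E b.+1 * PX i j = PX i j * E b.
Proof.
move=> hi hj; have hb : valid b by lia.
have hb1 : valid b.+1 by lia.
rewrite (@PX_cat b) ?(@PX_l b) ?(@PX_l b.+1); try lia.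
have c1 : E b.+1 * PX i b = PX i b * E b.+1.
  by apply: (E_subBMW hb1 (ltnSn b)); apply: subBMW_PX; lia.
have c2 : E b * PX b.+2 j = PX b.+2 j * E b.
  by apply: (@subBMW_comm_PX b.+1); [lia|lia|apply: subBMW_E; lia].
rewrite (commCA _ c1) -!mulrA -c2 (mulCA3 _ (esym (bmw_EXX rel hb hb1 (adjSr b)))).
by rewrite [X b * (X b.+1 * _)](mulCA3 _ (bmw_XXE rel hb hb1 (adjSr b))).
Qed.

(** The index drops by two through X_{b+1}^{-1}: X_{b+2} e_{b+1} e_{b+2} = X_{b+1}^{-1} e_{b+2} and
    e_b X_{b+1}^{-1} = e_b e_{b+1} X_b. *)
Lemma X_PE b i j : (0 < i <= b)%N -> (b.+2 < j <= N)%N ->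
  X b.+2 * PE i j = PE i j * X b.
Proof.
move=> hi hj; have [hb hb1 hb2] : [/\ valid b, valid b.+1 & valid b.+2] by split; lia.
rewrite (@PE_cat b) ?(@PE_l b) ?(@PE_l b.+1) ?(@PE_l b.+2); try lia.
have c1 : X b.+2 * PE i b = PE i b * X b.+2.
  by apply: (X_subBMW hb2 (leqnSn b.+1)); apply: subBMW_PE; lia.
have c2 : X b * PE b.+3 j = PE b.+3 j * X b.
  by apply: (@subBMW_comm_PE b.+1); [lia|lia|apply: subBMW_X; lia].
have c3 : X b.+2 * E b = E b * X b.+2.
  by apply: (X_subBMW hb2 (ltnSn _)); apply: subBMW_E; lia.
have c4 : X b * E b.+2 = E b.+2 * X b.
  by apply/esym; apply: (E_subBMW hb2 (ltnSn _)); apply: subBMW_X; lia.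
rewrite (commCA _ c1) (commCA _ c3) -!mulrA -c2 -(commCA _ c4).
rewrite (mulCA3 _ (esym (EXV hb hb1 (adjSr b)))).
by rewrite (mulCA3 _ (esym (XVE hb2 hb1 (adjSl b.+1)))) -!mulrA.
Qed.

Lemma E_PE b i j : (0 < i <= b)%N -> (b.+2 < j <= N)%N ->
  E b.+2 * PE i j = PE i j * E b.
Proof.
move=> hi hj; have [hb hb1 hb2] : [/\ valid b, valid b.+1 & valid b.+2] by split; lia.
rewrite (@PE_cat b) ?(@PE_l b) ?(@PE_l b.+1) ?(@PE_l b.+2); try lia.
have c1 : E b.+2 * PE i b = PE i b * E b.+2.
  by apply: (E_subBMW hb2 (leqnSn b.+1)); apply: subBMW_PE; lia.
have c2 : E b * PE b.+3 j = PE b.+3 j * E b.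
  by apply: (@subBMW_comm_PE b.+1); [lia|lia|apply: subBMW_E; lia].
have c3 : E b.+2 * E b = E b * E b.+2.
  by apply: (E_subBMW hb2 (ltnSn _)); apply: subBMW_E; lia.
rewrite (commCA _ c1) (commCA _ c3) -!mulrA -c2 (commCA _ c3).
rewrite (mulCA3 _ (bmw_EEE rel hb hb1 (adjSr b))).
by rewrite (mulCA3 _ (bmw_EEE rel hb2 hb1 (adjSl b.+1))).
Qed.

(* The paper's alpha_{i,j,n-1}^s: the last generator is e_{n-1}. *)
Definition al (i j n : nat) (s : int) := JM i ^ s * PX i j * PE j n.

(** Left multiplication by X_{j+1} turns X_j e_{j+1} into e_j e_{j+1}, and X_{j+1} crosses
    e_i...e_{n-1} as X_{j-1}. Each X removed thus contributes X_{j-1}^{-1} to b. *)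
Lemma E_PX_PE i j n : (0 < i)%N -> (i < j < n)%N -> (n <= N)%N ->
  exists2 b, subBMW n.-2 b & E i * (PX i.+1 j * PE j n) = PE i n * b.
Proof.
move=> i0; elim: j => // j IH ij nN; have [ij'|ij'] := ltnP i j; last first.
  exists 1; first exact: subBMW1.
  have -> : j = i by lia.
  by rewrite PX_nil mul1r mulr1 [RHS]PE_l //; lia.
have [hj hj1] : valid j /\ valid j.+1 by lia.
have [b hb e] := IH ltac:(lia) nN.
exists ((X j.-1)^-1 * b).
  by apply: subBMWM => //; apply: subBMW_XV; lia.
have hj' : valid j.-1 by lia.
apply: (mulrI (uX hj1)).
have h : X j.+1 * PE i n = PE i n * X j.-1.
  by rewrite -(@X_PE j.-1); [congr (X _ * _); lia | lia | lia].
rewrite [RHS](mulCA _ h) -mulrA mulVKr ?uX // -e.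
have c1 : X j.+1 * E i = E i * X j.+1.
  by apply: (bmw_XEf rel); rewrite ?/far; lia.
have c2 : X j.+1 * PX i.+1 j = PX i.+1 j * X j.+1.
  by apply: (X_subBMW hj1 (ltnSn j)); apply: subBMW_PX; lia.
rewrite (commCA _ c1) PX_r; last by lia.
rewrite -mulrA (commCA _ c2) PE_l; last by lia.
rewrite [in RHS]PE_l; last by lia.
rewrite (mulCA3 _ (bmw_XXE rel hj1 hj (adjSl j))) -mulrA -PE_l //; lia.
Qed.

(** * Left multiplication of a factor by X_a and e_a *)

Section Step.
Variables (l : nat) (lN : (l.+2 <= N)%N).
Local Notation n := l.+2.

(** Q ties the exponent to the first index, because exponents can be reduced only at the price of a
    smaller index and both must be controlled together. *)
Definition al_set (Q : nat -> int -> Prop) v := exists i j s,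
  [/\ (0 < i <= j)%N, (j <= l.+1)%N, Q i s & v = al i j n s].
Definition al_span Q := rspan (al_set Q) (subBMW l).

Let hB := subBMW_subalgebra l.

Lemma al_span_linear Q : linear_closed (subBMW l) (al_span Q).
Proof. exact: rspan_linear. Qed.

Lemma al_span_al Q i j s b : (0 < i <= j)%N -> (j <= l.+1)%N -> Q i s ->
  subBMW l b -> al_span Q (al i j n s * b).
Proof. by move=> hi hj hQ hb; apply: rspan_gen => //; exists i, j, s. Qed.

Lemma al_span_al1 Q i j s : (0 < i <= j)%N -> (j <= l.+1)%N -> Q i s ->
  al_span Q (al i j n s).
Proof. by move=> hi hj hQ; apply: rspan_in => //; exists i, j, s. Qed.

(** A gap between the X's and the e's lets the whole front part commute to the right and become a
    coefficient. What remains is a word of first index j and exponent 0. *)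
Lemma JM_PX_comm i c j s : (0 < i <= c)%N -> (c < j)%N -> (c <= l)%N ->
  exists2 b, subBMW l b & JM i ^ s * PX i c * PE j n = al j j n 0 * b.
Proof.
move=> hi hc cl; have hb : subBMW c (JM i ^ s * PX i c).
  by apply: subBMWM; [apply: subBMW_JM; lia | apply: subBMW_PX; lia].
exists (JM i ^ s * PX i c); first exact: subBMW_le hb.
by rewrite /al PX_nil expr0z !mul1r (@subBMW_comm_PE c).
Qed.

Let low a i j s g : (a.+1 < i <= j)%N -> (j <= l.+1)%N ->
  g * JM i = JM i * g ->
  subBMW a.+1 g -> g * al i j n s = al i j n s * g.
Proof.
move=> hi hj hJ hg; rewrite /al.
have c1 : g * JM i ^ s = JM i ^ s * g by apply/esym/exprz_comm/esym.
have c2 : g * PX i j = PX i j * g by apply: (@subBMW_comm_PX a.+1) => //; lia.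
have c3 : g * PE j n = PE j n * g by apply: (@subBMW_comm_PE a.+1) => //; lia.
by rewrite -!mulrA (commCA _ c1) (commCA _ c2) c3.
Qed.

Lemma step_low Q i j s a : (0 < a)%N -> (a.+1 < i <= j)%N -> (j <= l.+1)%N -> Q i s ->
  al_span Q (X a * al i j n s) /\ al_span Q (E a * al i j n s).
Proof.
move=> ha hi hj hQ; split; rewrite (@low a) //.
- by apply: al_span_al => //; [lia | apply: subBMW_X; lia].
- by apply: X_JM; lia.
- by apply: subBMW_X; lia.
- by apply: al_span_al => //; [lia | apply: subBMW_E; lia].
- by apply: E_JM; lia.
- by apply: subBMW_E; lia.
Qed.

(** X_a and e_a commute with Y_i', so the words obtained either keep i and s or, through
    [JM_PX_comm], have a larger first index and exponent 0. *)
Lemma step_high Q i j s a : (0 < i <= j)%N -> (j <= l.+1)%N -> (i < a < n)%N ->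
  Q i s -> (forall i', (i < i')%N -> Q i' 0) ->
  al_span Q (X a * al i j n s) /\ al_span Q (E a * al i j n s).
Proof.
move=> hi hj ha hQ hQ0; have va : valid a by lia.
have hJ : subBMW i (JM i ^ s) by apply: subBMW_JM; lia.
have cX : X a * JM i ^ s = JM i ^ s * X a by apply: (X_subBMW va _ hJ); lia.
have cE : E a * JM i ^ s = JM i ^ s * E a by apply: (E_subBMW va _ hJ); lia.
have [aj|ja|aj] := ltngtP a j.
- case: a ha va cX cE aj => // a ha va cX cE aj; rewrite /al -!mulrA.
  rewrite (commCA _ cX) (mulCA _ (@X_PX a i j _ _)); try lia.
  rewrite (commCA _ cE) (mulCA _ (@E_PX a i j _ _)); try lia.
  have gB : subBMW a.+1 (X a) /\ subBMW a.+1 (E a).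
    by split; [apply: subBMW_X | apply: subBMW_E]; lia.
  case: gB => gX gE.
  rewrite -!mulrA (@subBMW_comm_PE a.+1 j n (X a)) //; try lia.
  rewrite (@subBMW_comm_PE a.+1 j n (E a)) //; try lia.
  by split; rewrite !mulrA; apply: al_span_al => //; [apply: subBMW_X | apply: subBMW_E]; lia.
- have c1X : X a * PX i j = PX i j * X a by apply: (@X_subBMW a j) => //; apply: subBMW_PX; lia.
  have c1E : E a * PX i j = PX i j * E a by apply: (@E_subBMW a j) => //; apply: subBMW_PX; lia.
  rewrite /al -!mulrA (commCA _ cX) (commCA _ c1X) (commCA _ cE) (commCA _ c1E).
  have [aj1|aj1] := ltnP j.+1 a.
    case: a ha va aj1 {ja cX cE c1X c1E} => [|[|a]] // ha va aj1.
    rewrite (@X_PE a); try lia.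
    rewrite (@E_PE a); try lia.
    by split; rewrite !mulrA; apply: al_span_al => //; [apply: subBMW_X | apply: subBMW_E]; lia.
  have -> : a = j.+1 by lia.
  have [vj vj1] : valid j /\ valid j.+1 by lia.
  rewrite (@PE_l j) ?(@PE_l j.+1); try lia.
  have [b hb e] := @JM_PX_comm i j j.+1 s ltac:(lia) ltac:(lia) ltac:(lia).
  rewrite (mulCA3 _ (bmw_EEE rel vj1 vj (adjSl j))).
  rewrite (mulCA3 _ (esym (XVE vj1 vj (adjSl j)))) -!mulrA -PE_l; last by lia.
  rewrite !mulrA e; split; last first.
    by apply: al_span_al => //; [lia | lia | apply: hQ0; lia].
  rewrite skeinV // mulrDr mulrBr !mulrDl mulNr -!scalerAr -!scalerAl mulr1 e.
  apply: rspanD; last first.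
    apply: rspanZ => //; rewrite -[_ * _ * PE _ _]mulrA -PE_l; last by lia.
    by apply: al_span_al1.
  apply: rspanB => //; last first.
    by apply: rspanZ => //; apply: al_span_al => //; [lia | lia | apply: hQ0; lia].
  rewrite -[JM i ^ s * _ * X j]mulrA -PX_r; last by lia.
  by apply: al_span_al1 => //; lia.
- have [c jc] : exists c, j = c.+1 by exists j.-1; lia.
  move: ha va cX cE hj; rewrite aj jc => ha va cX cE hj.
  have vc : valid c by lia.
  have c1X : X c.+1 * PX i c = PX i c * X c.+1.
    by apply: (@X_subBMW _ c) => //; apply: subBMW_PX; lia.
  have c1E : E c.+1 * PX i c = PX i c * E c.+1.
    by apply: (@E_subBMW _ c) => //; apply: subBMW_PX; lia.
  rewrite /al (@PX_r _ c); last by lia.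
  rewrite PE_l; last by lia.
  rewrite -!mulrA (commCA _ cX) (commCA _ c1X) (commCA _ cE) (commCA _ c1E).
  rewrite (mulCA3 _ (bmw_XXE rel va vc (adjSl c))).
  rewrite (mulCA3 _ (EXE va vc (adjSl c))) -!mulrA -PE_l; last by lia.
  rewrite -PE_l; last by lia.
  split; first by rewrite mulrA; apply: al_span_al1 => //; lia.
  have [b hb e] := @JM_PX_comm i c c.+1 s ltac:(lia) ltac:(lia) ltac:(lia).
  rewrite -scalerAl -PE_l; last by lia.
  rewrite -!scalerAr mulrA e; apply: rspanZ => //.
  by apply: al_span_al => //; [lia | apply: hQ0; lia].
Qed.

(** The tail commutes with B_a, so only the generators of [zyx] matter: z^b heads a word at index a
    + 1, y^t x lengthens the X's to start at a, and y^t e is put in form by [E_PX_PE]. *)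
Lemma zyx_al_span (Q : nat -> int -> Prop) (a j : nat) (c : int -> bool) (m : int) u : (0 < a <= l)%N -> (a < j <= l.+1)%N ->
  (forall b, c b -> Q a.+1 b) -> (forall s, `|s| <= m -> Q a s) ->
  rspan (zyx (X a) (JM a) (JM a.+1) (E a) c m) (subBMW a) u ->
  al_span Q (u * (PX a.+1 j * PE j n)).
Proof.
move=> ha hj hQ1 hQ2 hu; rewrite -[u]mul1r.
apply: (rspan_minlr (al_span_linear Q) _ _ _ hu).
- by move=> b; apply: subBMW_le; lia.
- move=> b hb; rewrite -mulrA -(@subBMW_comm_PE a) //; try lia.
  by rewrite !mulrA -(@subBMW_comm_PX a) //; lia.
move=> v [[b hb ->]|[t ht [] ->]]; rewrite mul1r !mulrA.
- by apply: al_span_al1; [lia | lia | apply: hQ1].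
- rewrite -[_ * X a * _]mulrA -PX_l; last by lia.
  by apply: al_span_al1; [lia | lia | apply: hQ2].
have [b hb e] := @E_PX_PE a j n ltac:(lia) ltac:(lia) ltac:(lia).
rewrite -!mulrA e.
have -> : JM a ^ t * (PE a n * b) = al a a n t * b by rewrite /al PX_nil mulr1 !mulrA.
by apply: al_span_al => //; [lia | lia | apply: hQ2].
Qed.

(** The one case where X_a and e_a meet the power of Y_i'. The rank two rules keep exponents at
    index a + 1 between 0 and s, but at index a they only bound the absolute value. *)
Lemma step_mid (Q : nat -> int -> Prop) i j (s : int) a : (0 < a)%N -> (0 < i <= j)%N -> (j <= l.+1)%N ->
  (i == a) || (i == a.+1) -> (forall s' : int, `|s'| <= `|s| -> Q a s') ->
  (forall b, between s b -> Q a.+1 b) ->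
  al_span Q (X a * al i j n s) /\ al_span Q (E a * al i j n s).
Proof.
move=> ha hi hj ia hQ hQ1.
have va : valid a by move: ia; lia.
have r2 := rank_two_BMW va.
have Q0 : Q a 0 by apply: hQ; lia.
have E_rho j' b : (0 < a <= l)%N -> (a < j' <= l.+1)%N -> subBMW a b ->
    al_span Q (E a * b * (PX a.+1 j' * PE j' n)).
  move=> ha' hj' hb.
  have [b' hb' e] := @E_PX_PE a j' n ltac:(lia) ltac:(lia) ltac:(lia).
  have cb : b * (PX a.+1 j' * PE j' n) = PX a.+1 j' * PE j' n * b.
    rewrite mulrA (@subBMW_comm_PX a) //; try lia.
    by rewrite -mulrA (@subBMW_comm_PE a) ?mulrA //; lia.
  rewrite -mulrA cb mulrA e -mulrA.
  have -> : PE a n = al a a n 0 by rewrite /al PX_nil expr0z !mul1r.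
  apply: al_span_al => //; [lia | lia |]; apply: subBMWM => //.
  by apply: subBMW_le hb; lia.
case/orP: ia => /eqP ia; last first.
  move: hi; rewrite ia {i ia} => hi.
  rewrite /al !mulrA -!mulrA [X a * _]mulrA [E a * _]mulrA.
  rewrite (rank2_ez r2); split.
    apply: (@zyx_al_span Q a j (between s) `|s|); try (by lia); first by auto.
      by auto.
    by apply: (rank2_xzs r2).
  by apply: E_rho; [lia | lia | apply: subBMW_JM; lia].
move: hi; rewrite ia {i ia} => hi.
have [ja|aj] := leqP j a.
  have -> : j = a by lia.
  rewrite /al PX_nil mulr1 PE_l; last by lia.
  have hPE b : subBMW a.-1 b -> b * PE a.+1 n = PE a.+1 n * b.
    by move=> hb; apply: (@subBMW_comm_PE a.-1) => //; lia.
  have sub b : subBMW a.-1 b -> subBMW l b by apply: subBMW_le; lia.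
  rewrite !mulrA; split.
    rewrite -[_ * PE _ _]mul1r mulrA.
    apply: (rspan_minlr (al_span_linear Q) _ _ _ (rank2_xye r2 s)) => //.
      by move=> b hb; rewrite hPE.
    move=> v [t ht ->]; rewrite mul1r -mulrA -PE_l; last by lia.
    have -> : JM a ^ t * PE a n = al a a n t by rewrite /al PX_nil mulr1.
    by apply: al_span_al1; [lia | lia | apply: hQ].
  have [w hw ->] := E_JM_E s va.
  rewrite -mulrA -PE_l; last by lia.
  rewrite (@subBMW_comm_PE a.-1) //; try lia.
  have -> : PE a n = al a a n 0 by rewrite /al PX_nil expr0z !mul1r.
  by apply: al_span_al => //; [lia | lia | apply: sub].
rewrite /al PX_l // !mulrA -[_ * PX _ _ * _]mulrA -[E a * _ * _ * PX _ _ * _]mulrA; split.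
  apply: (@zyx_al_span Q a j (between s) `|s|); try (by lia); first by auto.
    by auto.
  by apply: (rank2_xysx r2).
have [w hw ->] := rank2_eyx r2 s.
by apply: E_rho => //; lia.
Qed.

Lemma step (Q : nat -> int -> Prop) i j (s : int) a : (0 < a < n)%N -> (0 < i <= j)%N -> (j <= l.+1)%N ->
  ((a.+1 < i) || (i < a) -> Q i s)%N ->
  (forall i', (i < i')%N && (i < a)%N -> Q i' 0) ->
  ((i == a) || (i == a.+1) ->
     (forall s' : int, `|s'| <= `|s| -> Q a s') /\ (forall b, between s b -> Q a.+1 b)) ->
  al_span Q (X a * al i j n s) /\ al_span Q (E a * al i j n s).
Proof.
move=> ha hi hj h1 h2 h3; have [h|h|h] := ltngtP a.+1 i.
- by apply: step_low; try lia; apply: h1; rewrite h.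
- have [ai|ai] := eqVneq i a.
    by have [] := h3 _; [rewrite ai eqxx | move=> *; apply: step_mid; rewrite // ?ai ?eqxx //; lia].
  apply: step_high; try lia; first by apply: h1; lia.
  by move=> i' hi'; apply: h2; lia.
- have [] := h3 _; first by rewrite h eqxx orbT.
  by move=> *; apply: step_mid; rewrite // ?h ?eqxx ?orbT //; lia.
Qed.

Definition stable (Q : nat -> int -> Prop) a := forall u, al_span Q u ->
  [/\ al_span Q (X a * u), al_span Q (E a * u) & al_span Q ((X a)^-1 * u)].

Lemma stable_gen Q a : (0 < a < n)%N ->
  (forall i j s, (0 < i <= j)%N -> (j <= l.+1)%N -> Q i s ->
    al_span Q (X a * al i j n s) /\ al_span Q (E a * al i j n s)) -> stable Q a.
Proof.
move=> ha h u hu; have va : valid a by lia.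
have hX : al_span Q (X a * u).
  apply: rspan_minl hu => [|v [i [j [s [hi hj hQ ->]]]]]; first exact: al_span_linear.
  by case: (h i j s hi hj hQ).
have hE : al_span Q (E a * u).
  apply: rspan_minl hu => [|v [i [j [s [hi hj hQ ->]]]]]; first exact: al_span_linear.
  by case: (h i j s hi hj hQ).
split=> //; rewrite skeinV // mulrDl mulrBl -!scalerAl mul1r.
by apply: rspanD; [apply: rspanB => // | ]; try apply: rspanZ.
Qed.

Lemma al_span_le Q Q' u : (forall i s, (0 < i <= l.+1)%N -> Q i s -> Q' i s) ->
  al_span Q u -> al_span Q' u.
Proof.
move=> h; apply: rspan_min => [|v [i [j [s [hi hj hQ ->]]]]]; first exact: al_span_linear.
by apply: al_span_al1 => //; apply: h => //; lia.
Qed.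

(* Exponents from a symmetric interval are never increased by X_a and e_a. *)
Definition symQ (i0 : nat) (c : int) (i : nat) (s : int) : Prop := (i0 <= i)%N /\ `|s| <= c.

Lemma stable_sym i0 (c : int) a : 0 <= c -> (0 < a < n)%N -> (i0 <= a)%N -> stable (symQ i0 c) a.
Proof.
move=> hc ha ia; apply: stable_gen => // i j s hi hj [h1 h2].
apply: step => //.
- by move=> i' h; split; lia.
- move=> h; split=> [s' hs'|b hb]; split; rewrite ?(leq_trans ia) //; try lia.
  by move: hb; rewrite /between; lia.
Qed.
End Step.

Lemma inP0 : inP k 0.
Proof. by rewrite /inP; lia. Qed.

(** * Bringing exponents into P *)

Section Window.
Variables (l : nat) (lN : (l.+2 <= N)%N).
Local Notation n := l.+2.
Let hB := subBMW_subalgebra l.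

(* Exponents are arbitrary for indices below [i0] and lie in P otherwise. *)
Definition winQ (i0 : nat) (i : nat) (s : int) := (i < i0)%N || inP k s.
Definition LP := al_span l (fun _ s => inP k s).

Let LP_linear : linear_closed (subBMW l) LP := al_span_linear _ _.

(** X_a takes exponents out of P only at first index a, where [claim] brings them back. With [claim]
    as a hypothesis the lemma is available inside the induction that proves it. *)
Let X_LP_aux a : (0 < a < n)%N -> (forall u, al_span l (winQ a.+1) u -> LP u) -> 
  forall u, LP u -> [/\ LP (X a * u), LP (E a * u) & LP ((X a)^-1 * u)].
Proof.
move=> ha claim; apply: stable_gen => // i j s hi hj hP.
have [] := @step l lN (winQ a.+1) i j s a ha hi hj; last by move=> /claim ? /claim.
- by move=> _; apply/orP; right.
- by move=> i' _; apply/orP; right; apply: inP0.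
(* P is an interval containing 0, hence contains everything between 0 and an element of it. *)
- move=> _; split=> [s' _|b hb]; first by rewrite /winQ ltnSn.
  by rewrite /winQ /inP; move: hb hP; rewrite /inP /between; lia.
Qed.

Lemma window_reduction i0 u : al_span l (winQ i0) u -> LP u.
Proof.
elim: i0 u => [|[|a] IH] u.
- by apply: al_span_le => // i s _; rewrite /winQ.
- by apply: al_span_le => // i s hi; rewrite /winQ => /orP[] //; lia.
apply: rspan_min => // v [i [j [s [hi hj hQ ->]]]].
have [i1|i1] := ltnP i a.+1.
  by apply: IH; apply: al_span_al1; rewrite // /winQ i1.
have [hP|hP] := boolP (inP k s); first exact: al_span_al1.
have ia : i = a.+1 by move: hQ; rewrite /winQ (negPf hP) orbF; lia.
move: hi; rewrite ia {hQ hP i1 ia i} => hi.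
case: a IH hi => [|a] IH hi.
  rewrite /al JM1 -mulrA -[Y ^ s]mul1r.
  apply: span_min (Y_window ((k./2)%:Z - (k.-1)%:Z) s) => [|v' [t ht ->]].
    by apply: linear_closed_sub LP_linear => b; apply: scalar_sub.
  rewrite mul1r -JM1 mulrA; apply: al_span_al1 => //.
  by move: ht; rewrite /inP; lia.
have va : (0 < a.+1 < n)%N by lia.
have va' : valid a.+1 by lia.
have r2 := rank_two_BMW va'; have uXa := uX va'.
have hX := X_LP_aux va IH.
suff key (m : nat) (t : int) j' : `|t| < m%:Z -> (a.+2 <= j' <= l.+1)%N ->
    LP (al a.+2 j' n t) by apply: (key `|s|.+1%N); lia.
elim: m t j' => [|m IHm] {}s {hi hj}j sm hj; first by lia.
have [hP|hP] := boolP (inP k s); first by apply: al_span_al1 => //; lia.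
pose rho := PX a.+2 j * PE j n.
have inLP (c : int -> bool) m' u' :
    (forall b j', c b -> (a.+2 <= j' <= l.+1)%N -> LP (al a.+2 j' n b)) ->
    rspan (zyx (X a.+1) (JM a.+1) (JM a.+2) (E a.+1) c m') (subBMW a.+1) u' ->
    LP (u' * rho).
  move=> hc hu.
  pose Q (i : nat) (t : int) := (i < a.+2)%N \/ i = a.+2 /\ c t.
  have : al_span l Q (u' * rho).
    apply: (@zyx_al_span l lN Q a.+1 j c m') => //; rewrite /Q; by lia.
  apply: rspan_min => // w [i' [j' [t [hi' hj' [h|[ii h]] ->]]]].
    by apply: IH; apply: al_span_al1 => //; rewrite /winQ h.
  by rewrite ii; apply: hc => //; lia.
have alE t : al a.+2 j n t = JM a.+2 ^ t * rho by rewrite /al -mulrA.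
have uB := subBMW_subalgebra a.+1.
have xrho t : LP (JM a.+1 ^ t * (X a.+1 * rho)).
  rewrite mulrA; apply: (inLP (fun=> false) `|t|) => //.
  by apply: rspan_in => //; right; exists t; auto.
have h0 j' : (a.+2 <= j' <= l.+1)%N -> LP (al a.+2 j' n 0).
  by move=> hj'; apply: al_span_al1; [lia | lia | exact: inP0].
rewrite alE; case: (intP s) sm hP => [|p|p] sm hP.
- by move: hP; rewrite inP0.
- have := rank2_zpos r2 (c := fun b => 0 <= b < p.+1%:Z) (fun b => id) (lexx p.+1%:Z).
  set u' := _ - _ => hu.
  have -> : JM a.+2 ^ p.+1 * rho
     = u' * rho + (X a.+1)^-1 * (JM a.+1 ^ p.+1 * (X a.+1 * rho)).
    by rewrite /u' mulrBl -!mulrA subrK.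
  apply: rspanD; last by case: (hX _ (xrho p.+1)).
  by apply: inLP hu => b j' hb hj'; apply: IHm => //; lia.
- have := rank2_zneg r2 (c := fun b => - p.+1%:Z < b <= 0) (fun b => id) (lexx p.+1%:Z).
  set u' := _ - _ => hu.
  have -> : JM a.+2 ^ (- p.+1%:Z) * rho
     = u' * rho + X a.+1 * (JM a.+1 ^ (- p.+1%:Z) * ((X a.+1)^-1 * rho)).
    by rewrite /u' mulrBl -!mulrA subrK.
  apply: rspanD.
    by apply: inLP hu => b j' hb hj'; apply: IHm => //; lia.
  (* The inner inverse does not fit into a word and is expanded by the skein relation. Its scalar
     term produces a word of index a + 2, but with exponent 0, which lies in P. *)
  have [] // := hX (JM a.+1 ^ (- p.+1%:Z) * ((X a.+1)^-1 * rho)).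
  rewrite mulrA; apply: (inLP (fun b => b == 0) p.+1).
    by move=> b j' /eqP -> ; apply: h0.
  have -> : JM a.+1 ^ (- p.+1%:Z) * (X a.+1)^-1
    = JM a.+1 ^ (- p.+1%:Z) * X a.+1 - dl *: (JM a.+2 ^ 0 * JM a.+1 ^ (- p.+1%:Z))
      + dl *: (JM a.+1 ^ (- p.+1%:Z) * E a.+1).
    by rewrite skeinV // expr0z; expand_products.
  apply: rspanD; first apply: rspanB => //.
  + by apply: rspan_in => //; right; exists (- p.+1%:Z); [lia | left].
  + apply: rspanZ => //; apply: rspan_gen; first by left; exists 0.
    by apply: subBMW_JM; lia.
  + apply: rspanZ => //; apply: rspan_in => //; right; exists (- p.+1%:Z); [lia | by right].
Qed.

Lemma LP_al i j (s : int) : (0 < i <= j)%N -> (j <= l.+1)%N -> LP (al i j n s).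
Proof.
move=> hi hj; apply: (@window_reduction i.+1); apply: al_span_al1 => //.
by rewrite /winQ ltnSn.
Qed.

Lemma X_LP a u : (0 < a < n)%N -> LP u ->
  [/\ LP (X a * u), LP (E a * u) & LP ((X a)^-1 * u)].
Proof. by move=> ha; apply: X_LP_aux => // v; apply: window_reduction. Qed.

Lemma LP_left b u : subBMW n b -> LP u -> LP (b * u).
Proof.
have hY (t : int) v : LP v -> LP (Y ^ t * v).
  apply: rspan_minl => // w [i [j [s [hi hj hP ->]]]].
  (* [Y] interacts only with words of first index 1, where the shifted exponent is reduced again by
     [LP_al]. *)
  have [i1|i1] := leqP i 1.
    have -> : i = 1%N by lia.
    rewrite /al JM1 !mulrA -exprzDr // -JM1; apply: LP_al => //.
    by move: hi; lia.
  have c1 : Y ^ t * JM i ^ s = JM i ^ s * Y ^ t.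
    by apply: exprz_comm2; apply: Y_JM; lia.
  have hYt : subBMW 1 (Y ^ t) by rewrite -JM1; apply: subBMW_JM; lia.
  have c2 : Y ^ t * PX i j = PX i j * Y ^ t by apply: (@subBMW_comm_PX 1) => //; lia.
  have c3 : Y ^ t * PE j n = PE j n * Y ^ t by apply: (@subBMW_comm_PE 1) => //; lia.
  rewrite /al -!mulrA (commCA _ c1) (commCA _ c2) c3 !mulrA.
  by apply: al_span_al => //; apply: subBMW_le hYt; lia.
move=> hb; elim: hb u => [r|_|_|i hi|i hi|b1 b2 _ IH1 _ IH2|b1 b2 _ IH1 _ IH2] u hu.
- by rewrite mulr_algl; apply: rspanZ.
- by have := hY 1 u hu; rewrite expr1z.
- by have := hY (-1) u hu; rewrite exprN1.
- by have [] := X_LP hi hu.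
- by have [] := X_LP hi hu.
- by rewrite mulrDl; apply: rspanD; [apply: IH1 | apply: IH2].
- by rewrite -mulrA; apply/IH1/IH2.
Qed.
End Window.

(** * Moving a factor past e_i...e_{n-1} *)

Lemma exprz_intertwine (u v w : A) (s : int) : v \is a GRing.unit -> w \is a GRing.unit ->
  u * v = w * u -> u * v ^ s = w ^ s * u.
Proof.
move=> uv uw h; elim/int_rect: s => [|m IH|m IH]; first by rewrite !expr0z mulr1 mul1r.
  have -> : v ^ m.+1 = v ^ m * v by exact: exprSzr.
  have -> : w ^ m.+1 = w ^ m * w by exact: exprSzr.
  by rewrite mulrA IH -[in LHS]mulrA h mulrA.
have -> : - (m.+1%:Z) = - m%:Z + -1 by lia.
rewrite !exprzDr // mulrA IH -!mulrA; congr (_ * _); rewrite !exprN1.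
have hV : u * v^-1 = w^-1 * u by apply: (mulrI uw); rewrite mulVKr // mulrA -h mulrK.
exact: hV.
Qed.

(** Two sign changes compose: Y_{a+2}' e_{a+1} = Y_{a+1}'^{-1} e_{a+1} and e_a Y_{a+1}'^{-1} = e_a
    Y_a'. *)
Lemma PE_JM i a n (s : int) : (0 < i <= a)%N -> (a.+1 < n <= N)%N ->
  PE i n * JM a ^ s = JM a.+2 ^ s * PE i n.
Proof.
move=> hi hn; apply: exprz_intertwine; try (apply: JM_unit; lia).
have [va va1] : valid a /\ valid a.+1 by lia.
rewrite (@PE_cat a) ?(@PE_l a) ?(@PE_l a.+1); try lia.
have hJ : subBMW a (JM a) by rewrite -[JM a]expr1z; apply: subBMW_JM; lia.
have c1 : JM a.+2 * PE i a = PE i a * JM a.+2.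
  by apply: prod_comm => t ht; apply/esym/E_JM; lia.
have c2 : JM a.+2 * E a = E a * JM a.+2 by apply/esym/E_JM; lia.
have c3 : PE a.+2 n * JM a = JM a * PE a.+2 n.
  by apply/esym/(@subBMW_comm_PE a) => //; lia.
have c4 : E a.+1 * JM a = JM a * E a.+1 by apply: (E_subBMW va1 _ hJ); lia.
have h1 : JM a.+2 * E a.+1 = (JM a.+1)^-1 * E a.+1.
  by have := rank2_ze (rank_two_BMW va1) 1; rewrite expr1z exprN1.
have h2 : E a * (JM a.+1)^-1 = E a * JM a.
  by have := rank2_ez (rank_two_BMW va) (-1); rewrite opprK expr1z exprN1.
rewrite -!mulrA (commCA _ c1) (commCA _ c2) c3 (commCA _ c4) (mulCA _ h1) -!mulrA.
by rewrite [E a * ((JM a.+1)^-1 * _)](mulCA _ h2) -!mulrA.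
Qed.

Lemma PE_PX i a b n : (0 < i <= a)%N -> (a <= b)%N -> (b.+1 < n <= N)%N ->
  PE i n * PX a b = PX a.+2 b.+2 * PE i n.
Proof.
move=> hi; elim: b => [|b IH] ab bn.
  by rewrite /PX !big_geq ?mulr1 ?mul1r //; lia.
have [->|ab'] := eqVneq a b.+1; first by rewrite !PX_nil mulr1 mul1r.
rewrite PX_r ?mulrA ?IH ?(@PX_r _ b.+2); try lia.
by rewrite -!mulrA -(@X_PE b) //; lia.
Qed.

Lemma PE_PE_shift i a b n : (0 < i <= a)%N -> (a <= b)%N -> (b.+1 < n <= N)%N ->
  PE i n * PE a b = PE a.+2 b.+2 * PE i n.
Proof.
move=> hi; elim: b => [|b IH] ab bn.
  by rewrite /PE (@big_geq _ _ _ a) ?(@big_geq _ _ _ a.+2) ?mulr1 ?mul1r //; lia.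
have [->|ab'] := eqVneq a b.+1; first by rewrite !PE_nil mulr1 mul1r.
have r c d : (c <= d)%N -> PE c d.+1 = PE c d * E d by exact: big_nat_recr.
rewrite r ?mulrA ?IH ?(r _ b.+2); try lia.
by rewrite -!mulrA -(@E_PE b) //; lia.
Qed.

(** All e's but the last shift by two. The last one also shortens the long product: e_{l+1} e_{l+2}
    e_{l+1} = e_{l+1} deletes e_{l+2} and frees e_{l+3} to move to the left. *)
Lemma PE_PE i b l : (0 < i <= b)%N -> (b <= l.+1)%N -> (l.+4 <= N)%N ->
  PE i l.+4 * PE b l.+2 = PE b.+2 l.+4 * PE i l.+2.
Proof.
move=> hi hb hl.
have r c d : (c <= d)%N -> PE c d.+1 = PE c d * E d by exact: big_nat_recr.
have [v1 v2 v3] : [/\ valid l.+1, valid l.+2 & valid l.+3] by split; lia.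
rewrite (r b) // mulrA (@PE_PE_shift i b l.+1) //; try lia.
rewrite (r b.+2 l.+3); last by lia.
rewrite -!mulrA; congr (_ * _).
rewrite (r i l.+3) ?(r i l.+2) ?(r i l.+1); try lia.
have c1 : E l.+3 * E l.+1 = E l.+1 * E l.+3.
  by apply: (E_subBMW v3 (leqnn _)); apply: subBMW_E; lia.
have c2 : E l.+3 * PE i l.+1 = PE i l.+1 * E l.+3.
  by apply: (E_subBMW v3 (leqnSn _)); apply: subBMW_PE; lia.
by rewrite -!mulrA c1 (mulCA3 _ (bmw_EEE rel v1 v2 (adjSr _))) (commCA _ c2) c1.
Qed.

Fixpoint XVprod (i m : nat) : A :=
  if m is m'.+1 then (X (i + m)%N)^-1 * XVprod i m' else 1.

(** Uses X_j e_{j+1} = X_{j+1}^{-1} e_j e_{j+1} once for every X. The exchange exposes e_i...e_{n-1}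
    to the next factor and leaves in front only inverses of index above i. *)
Lemma PX_PE_XVprod i m n : (0 < i)%N -> (i + m < n <= N)%N ->
  PX i (i + m) * PE (i + m) n = XVprod i m * PE i n.
Proof.
move=> hi; elim: m => [|m IH] hm; first by rewrite addn0 PX_nil.
set j := (i + m)%N; have [vj vj1] : valid j /\ valid j.+1 by rewrite /j; lia.
rewrite /= addnS -/j -mulrA -IH; last by lia.
apply: (mulrI (uX vj1)); rewrite mulVKr ?uX //.
have c2 : X j.+1 * PX i j = PX i j * X j.+1.
  by apply: (X_subBMW vj1 (ltnSn j)); apply: subBMW_PX; rewrite /j; lia.
rewrite PX_r; last by rewrite /j; lia.
rewrite -mulrA (commCA _ c2) [in LHS]PE_l; last by lia.
rewrite [in RHS]PE_l; last by lia.
rewrite (mulCA3 _ (bmw_XXE rel vj1 vj (adjSl j))) -mulrA -PE_l //; lia.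
Qed.

(** * Raising the first index *)

Section Raise.
Variables (l : nat) (lN : (l.+2 <= N)%N).
Local Notation n := l.+2.
Let hB := subBMW_subalgebra l.

Lemma XVprod_stable Q i m u : (i + m <= l.+1)%N ->
  (forall a, (i < a <= i + m)%N -> stable l Q a) -> al_span l Q u ->
  al_span l Q (XVprod i m * u).
Proof.
elim: m => [|m IH] hm hs hu /=; first by rewrite mul1r.
have hu' : al_span l Q (XVprod i m * u).
  apply: IH => //; first by lia.
  by move=> a ha; apply: hs; lia.
by rewrite -mulrA; have [] := hs (i + m.+1)%N ltac:(lia) _ hu'.
Qed.

Definition aboveQ i (i' : nat) (s : int) := (i < i')%N /\ inP k s.

Lemma XVprod_raise i m u b r : (0 < i)%N -> (i.+1 < u <= b)%N -> (b <= l.+1)%N ->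
  (i + m <= l.+1)%N -> inP k r -> al_span l (aboveQ i) (XVprod i m * al u b n r).
Proof.
move=> hi hu hb hm hr.
(* Here -c is the least element of P, which is [-c, c] for k odd and [-c, c + 1] for k even. *)
pose c : int := (k.-1)%:Z - (k./2)%:Z.
have hc : 0 <= c by rewrite /c; lia.
have symP i' s : symQ i.+1 c i' s -> aboveQ i i' s.
  by case=> h1 h2; split=> //; move: h2; rewrite /inP /c; lia.
have [rc|rc] := boolP (`|r| <= c).
  apply: (@al_span_le l lN (symQ i.+1 c)) => [i' s _|]; first exact: symP.
  apply: XVprod_stable => // [a ha|]; first by apply: stable_sym => //; lia.
  by apply: al_span_al1  => //; try (split => //); lia.
have r_eq : r = c + 1 by move: hr rc; rewrite /inP /c; lia.
have r_gt0 : 0 < r by lia.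
have {}hr : r <= (k./2)%:Z by move: hr; rewrite /inP; lia.
pose a := u.-1; have va : valid a by rewrite /a; lia.
have ua : u = a.+1 by rewrite /a; lia.
have al0 : (0 < a)%N by rewrite /a; lia.
have ial : (a <= l)%N by rewrite /a; lia.
have ia : (i < a)%N by rewrite /a; lia.
(* The second kind of generator keeps Y_a'^t outside the word: X_t^{-1} with t > a then acts on a
   word of exponent 0, and no negative counterpart of the exponent k/2 can arise. *)
pose S v := al_set l (symQ i.+1 c) v \/
  exists2 t : int, 0 <= t <= r & exists2 v', al_set l (symQ a 0) v' & v = JM a ^ t * v'.
pose V := rspan S (subBMW l).
have VL : linear_closed (subBMW l) V by apply: rspan_linear.
have V_sym w : al_span l (symQ i.+1 c) w -> V w.
  by apply: rspan_min => // v hv; apply: rspan_in => //; left.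
have V_JM t w : 0 <= t <= r -> al_span l (symQ a 0) w -> V (JM a ^ t * w).
  move=> ht; apply: rspan_minl => // v hv; apply: rspan_in => //; right.
  by exists t => //; exists v.
have V_stable t w : (u <= t <= l.+1)%N -> V w -> V ((X t)^-1 * w).
  move=> ht; apply: rspan_minl => // v [hv|[p hp [v' hv' ->]]].
    apply: V_sym; have [|||_ _] // := @stable_sym l lN i.+1 c t hc _ _ v; try lia.
    exact: rspan_in.
  have cX : X t * JM a ^ p = JM a ^ p * X t.
    by apply: (@X_subBMW _ a); [lia | lia | apply: subBMW_JM; lia].
  have cXV : (X t)^-1 * JM a ^ p = JM a ^ p * (X t)^-1.
    by apply/esym/commrV/esym.
  rewrite mulrA cXV -mulrA; apply: V_JM => //.
  have [|||_ _] // := @stable_sym l lN a 0 t (lexx 0) _ _ v'; try lia.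
  exact: rspan_in.
have V_T w : V w -> al_span l (aboveQ i) w.
  apply: rspan_min; first exact: al_span_linear.
  move=> v [[i' [j' [s [h1 h2 h3 ->]]]]|[p hp [_ [i' [j' [s [h1 h2 [h3 h4] ->]]]] ->]]].
    by apply: al_span_al1 => //; apply: symP.
  have -> : s = 0 by lia.
  have [ia'|ia'] := eqVneq i' a.
    have -> : JM a ^ p * al i' j' n 0 = al a j' n p.
      by rewrite /al ia' expr0z mul1r mulrA.
    by apply: al_span_al1; [lia | lia | split => //; rewrite /inP; lia].
  have hJ : subBMW a (JM a ^ p) by apply: subBMW_JM; lia.
  have -> : JM a ^ p * al i' j' n 0 = al i' j' n 0 * JM a ^ p.
    rewrite /al expr0z mul1r mulrA (@subBMW_comm_PX a) //; try lia.
    by rewrite -!mulrA (@subBMW_comm_PE a) //; lia.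
  apply: al_span_al => //; last by apply: subBMW_le hJ; lia.
  by split; [lia | rewrite /inP; lia].
pose rho := PX u b * PE b n.
have alE s : al u b n s = JM u ^ s * rho by rewrite /al -mulrA.
have rho_comm w : subBMW a w -> w * rho = rho * w.
  move=> hw; rewrite /rho mulrA (@subBMW_comm_PX a) //; try lia.
  by rewrite -!mulrA (@subBMW_comm_PE a) //; lia.
have sub_al w : subBMW a w -> subBMW l w by apply: subBMW_le; lia.
have sym0 i' : (a <= i')%N -> symQ a 0 i' 0 by split.
have Erho : al_span l (symQ a 0) (E a * rho).
  rewrite /rho ua; have [w hw ->] := @E_PX_PE a b n al0 ltac:(lia) ltac:(lia).
  have -> : PE a n = al a a n 0 by rewrite /al PX_nil expr0z !mul1r.
  by apply: al_span_al => //; try apply: sym0; lia.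
have base : V ((X a)^-1 * al u b n r).
  have r2 := rank_two_BMW va.
  have rE : r = `|r|%N by lia.
  have -> : (X a)^-1 * al u b n r
      = 1 * ((X a)^-1 * JM u ^ `|r|%N - JM a ^ `|r|%N * (X a)^-1) * rho
        + JM a ^ r * ((X a)^-1 * rho).
    by rewrite mul1r alE mulrBl -!mulrA -rE subrK.
  case: (VL) => _ VD VM; apply: VD; last first.
    apply: V_JM; first by lia.
    rewrite skeinV // mulrDl mulrBl -!scalerAl mul1r.
    apply: rspanD; last by apply: rspanZ.
    apply: rspanB => //; last first.
      apply: rspanZ => //; have -> : rho = al u b n 0 by rewrite alE expr0z mul1r.
      by apply: al_span_al1 => //; try apply: sym0; lia.
    have -> : X a * rho = al a b n 0.
      by rewrite /al expr0z mul1r [in RHS]PX_l -?ua -?mulrA //; lia.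
    by apply: al_span_al1 => //; try apply: sym0; lia.
  have VS : linear_closed (@scalar R A) V.
    by apply: linear_closed_sub VL => w; apply: scalar_sub.
  rewrite ua; apply: span_min VS _ (rank2_xVzn r2 `|r|%N) => v [p hp [] ->].
    rewrite mul1r -mulrA rho_comm; last by apply: subBMW_JM; lia.
    rewrite mulrA -ua -alE; apply: VM; last by apply: sub_al; apply: subBMW_JM; lia.
    apply: V_sym; by apply: al_span_al1 => //; try split; lia.
  rewrite mul1r -!mulrA rho_comm; last by apply: subBMW_JM; lia.
  rewrite !mulrA; apply: VM; last by apply: sub_al; apply: subBMW_JM; lia.
  by rewrite -!mulrA; apply: V_JM => //; lia.
have hV m' : (i + m' <= a.-1)%N -> subBMW a (XVprod i m') /\
    XVprod i m' * al u b n r = al u b n r * XVprod i m'.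
  elim: m' => [|m' IH] hm' /=; first by rewrite mul1r mulr1; split=> //; apply: subBMW1.
  have [IH1 IH2] := IH ltac:(lia).
  have hXV : subBMW a (X (i + m'.+1)%N)^-1 by apply: subBMW_XV; lia.
  split; first exact: subBMWM.
  have cJ : (X (i + m'.+1)%N)^-1 * JM u ^ r = JM u ^ r * (X (i + m'.+1)%N)^-1.
    by apply/esym/commrV; apply/exprz_comm/esym; apply: X_JM; lia.
  have cA : (X (i + m'.+1)%N)^-1 * al u b n r = al u b n r * (X (i + m'.+1)%N)^-1.
    by rewrite alE mulrA cJ -mulrA (rho_comm _ hXV) mulrA.
  by rewrite -mulrA IH2 (commCA _ cA).
have [mu|mu] := leqP (i + m) a.-1.
  have [h1 ->] := hV m mu.
  by apply: al_span_al => //; [lia | split; [lia | rewrite /inP; lia] | apply: sub_al].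
apply: V_T; have [d md] : exists d, m = (a - i + d)%N by exists (m - (a - i))%N; lia.
move: hm; rewrite md {mu md m}; elim: d => [|d IH] hm; last first.
  rewrite addnS /= -mulrA; apply: V_stable; first by lia.
  by apply: IH; lia.
have [m1 am1] : exists m1, (a - i = m1.+1)%N by exists (a - i).-1; lia.
rewrite addn0 am1 /=; have -> : (i + m1.+1 = a)%N by lia.
have [h1 h2] := hV m1 ltac:(lia).
by rewrite -mulrA h2 mulrA; case: VL => _ _; apply => //; apply: sub_al.
Qed.
End Raise.

(** * Decreasing words *)

Lemma al_swap l i a b (r : int) : (0 < i <= a)%N -> (a <= b)%N -> (b <= l.+1)%N ->
  (l.+4 <= N)%N ->
  PE i l.+4 * al a b l.+2 r = al a.+2 b.+2 l.+4 r * PE i l.+2.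
Proof.
move=> hi ab hb hl; rewrite /al !mulrA PE_JM; try lia.
rewrite -!mulrA [PE i _ * (_ * _)]mulrA PE_PX; try lia.
by rewrite -!mulrA PE_PE //; lia.
Qed.

(** The shift by two in [al_swap] gives [XVprod_raise] the room it needs. Once the first index
    exceeds i, Y_i'^s commutes with the new first factor and joins the coefficient c in the
    middle. *)
Lemma al_swap_raise l W i j a b (s r : int) y : (0 < i <= j)%N -> (j <= l.+3)%N ->
  (i <= a <= b)%N -> (b <= l.+1)%N -> (l.+4 <= N)%N -> inP k r ->
  linear_closed (@scalar R A) W ->
  (forall i' j' s' c, (i < i' <= j')%N -> (j' <= l.+3)%N -> inP k s' ->
     subBMW l.+2 c -> W (al i' j' l.+4 s' * (c * (al i i l.+2 0 * y)))) ->
  W (al i j l.+4 s * (al a b l.+2 r * y)).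
Proof.
move=> hi hj ha hb hl hr [W0 WD _] hW.
have [m jm] : exists m, j = (i + m)%N by exists (j - i)%N; lia.
have -> : al i j l.+4 s * (al a b l.+2 r * y)
    = JM i ^ s * ((XVprod i m * al a.+2 b.+2 l.+4 r) * (al i i l.+2 0 * y)).
  have -> : al i j l.+4 s = JM i ^ s * (XVprod i m * PE i l.+4).
    by rewrite /al jm -mulrA PX_PE_XVprod //; lia.
  have -> : al i i l.+2 0 = PE i l.+2 by rewrite /al PX_nil expr0z !mul1r.
  have := @al_swap l i a b r ltac:(lia) ltac:(lia) hb hl.
  by move: (al a b _ r) (al a.+2 _ _ _) => u v sw; rewrite -!mulrA (mulCA _ sw) -!mulrA.
have := @XVprod_raise l.+2 hl i m a.+2 b.+2 r ltac:(lia) ltac:(lia) ltac:(lia) ltac:(lia) hr.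
elim=> [|v c [i' [j' [s' [h1 h2 [h3 h4] ->]]]] hc|u v _ IHu _ IHv].
- by rewrite mul0r mulr0.
- have hJ : subBMW i (JM i ^ s) by apply: subBMW_JM; lia.
  have cJ : JM i ^ s * al i' j' l.+4 s' = al i' j' l.+4 s' * JM i ^ s.
    have c1 : JM i ^ s * JM i' ^ s' = JM i' ^ s' * JM i ^ s.
      apply: exprz_comm2; apply/esym/JM_subBMW; first by lia.
      by rewrite -[JM i]expr1z; apply: subBMW_JM; lia.
    have c2 : JM i ^ s * PX i' j' = PX i' j' * JM i ^ s by apply: (@subBMW_comm_PX i) => //; lia.
    have c3 : JM i ^ s * PE j' l.+4 = PE j' l.+4 * JM i ^ s.
      by apply: (@subBMW_comm_PE i) => //; lia.
    by rewrite /al -!mulrA (commCA _ c1) (commCA _ c2) c3.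
  have -> : JM i ^ s * (al i' j' l.+4 s' * c * (al i i l.+2 0 * y))
      = al i' j' l.+4 s' * (JM i ^ s * c * (al i i l.+2 0 * y)).
    by rewrite -[_ * c * _]mulrA (commCA _ cJ); congr (_ * _); apply: mulrA.
  apply: hW => //; try lia.
  by apply: subBMWM => //; apply: subBMW_le hJ; lia.
- by rewrite mulrDl mulrDr; apply: WD.
Qed.

Definition word := seq (nat * nat * int).

Fixpoint lw (n : nat) (w : word) : A :=
  if w is (i, j, s) :: w' then al i j n s * lw n.-2 w' else 1.

Fixpoint okw (n : nat) (w : word) : bool :=
  if w is (i, j, s) :: w'
  then [&& (0 < i)%N, (i <= j)%N, (j < n)%N, inP k s & okw n.-2 w'] else true.

Definition decw (w : word) : bool := sorted (fun x y => (y.1.1 < x.1.1)%N) w.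

Definition word_span n m :=
  rspan (fun v => exists w, [/\ okw n w, size w = m & v = lw n w]) (subBMW (n - m.*2)).
Definition dec_span n m :=
  rspan (fun v => exists w, [/\ okw n w, decw w, size w = m & v = lw n w])
    (subBMW (n - m.*2)).

Lemma word_span_linear n m : linear_closed (subBMW (n - m.*2)) (word_span n m).
Proof. by apply: rspan_linear; apply: subBMW_subalgebra. Qed.
Lemma dec_span_linear n m : linear_closed (subBMW (n - m.*2)) (dec_span n m).
Proof. by apply: rspan_linear; apply: subBMW_subalgebra. Qed.

Lemma sub2S n m : (n.-2 - m.*2 = n - m.+1.*2)%N.
Proof. lia. Qed.

Lemma word_span_cons n m i j s x : (0 < i <= j)%N -> (j < n)%N -> inP k s ->
  word_span n.-2 m x -> word_span n m.+1 (al i j n s * x).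
Proof.
move=> hi hj hs; apply: rspan_minl.
  by rewrite sub2S; apply: word_span_linear.
move=> v [w [w1 w2 ->]]; apply: rspan_in; first exact: subBMW_subalgebra.
by exists ((i, j, s) :: w); split; rewrite /= ?w2 //; apply/and5P; split; lia.
Qed.

(** Acting on the first factor leaves a coefficient of B_{n-2} behind it, which acts on the
    remaining word in the same way. *)
Lemma word_span_left n m b x : (n <= N)%N -> subBMW n b ->
  word_span n m x -> word_span n m (b * x).
Proof.
elim: m n b x => [|m IH] n b x nN hb.
  have hB := subBMW_subalgebra n.
  move=> hx; have : subBMW n x.
    apply: rspan_min hx => [|v [w [_ /size0nil -> ->]]]; last exact: subBMW1.
    by rewrite subn0; apply: subalgebra_linear.
  move=> {}hx; rewrite -[b * x]mul1r; apply: rspan_gen; first by exists nil.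
  by rewrite subn0; apply: subBMWM.
apply: rspan_minl; first exact: word_span_linear.
move=> v [[|[[i j] s] w] [] //= /and5P[h1 h2 h3 h4 h5] [w2] ->].
have [l nl] : exists l, n = l.+2 by exists n.-2; lia.
move: nN hb h3 h5; rewrite nl => nN hb h3 h5.
suff h z : LP l z -> word_span l.+2 m.+1 (z * lw l w).
  have -> : b * (al i j l.+2 s * lw l.+2.-2 w) = (b * al i j l.+2 s) * lw l w.
    exact: mulrA.
  by apply: h; apply: LP_left => //; apply: LP_al => //; lia.
elim=> [|u c [i' [j' [s' [h1' h2' h3' ->]]]] hc|u v' _ IHu _ IHv].
- by rewrite mul0r; apply: rspan0.
- rewrite -(mulrA (al i' j' _ s')); apply: word_span_cons => //; apply: IH => //.
    by lia.
  apply: rspan_in; first exact: subBMW_subalgebra.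
  by exists w.
- by rewrite mulrDl; apply: rspanD.
Qed.

(* Induction on n - i: a non-decreasing pair of factors is replaced by products
   whose first index is larger than i. *)
Lemma word_span_dec n m x : (n <= N)%N -> word_span n m x -> dec_span n m x.
Proof.
elim: m n x => [|m IHm] n x nN.
  apply: rspan_min; first exact: dec_span_linear.
  move=> v [w [w1 w2 ->]]; apply: rspan_in; first exact: subBMW_subalgebra.
  by exists w; split=> //; case: w w2 {w1}.
suff key d i j s y : (n - i <= d)%N -> (0 < i <= j)%N -> (j < n)%N -> inP k s ->
    word_span n.-2 m y -> dec_span n m.+1 (al i j n s * y).
  apply: rspan_min; first exact: dec_span_linear.
  move=> v [[|[[i j] s] w] [] //= /and5P[h1 h2 h3 h4 h5] [w2] ->].
  apply: (key (n - i)%N) => //; first by lia.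
  by apply: rspan_in; [exact: subBMW_subalgebra | exists w].
elim: d i j s y => [|d IHd] i j s y hd hi hj hs hy; first by lia.
(* [key] asks only that y lie in [word_span]: each replacement spoils the order of the tail, which
   the outer induction restores here. *)
have {hy} := IHm n.-2 y ltac:(lia) hy.
apply: rspan_minl; first by rewrite sub2S; apply: dec_span_linear.
move=> v [w [w1 w2 w3 ->]].
have dec_in w' : okw n w' -> decw w' -> size w' = m.+1 -> dec_span n m.+1 (lw n w').
  by move=> *; apply: rspan_in; [exact: subBMW_subalgebra | exists w'].
case: w w1 w2 w3 => [|[[a b] r] w] w1 w2 w3.
  have -> : al i j n s * lw n.-2 [::] = lw n [:: (i, j, s)] by [].
  apply: dec_in => //; last by rewrite -w3.
  by rewrite /= hj hs; move: hi => /andP[-> ->].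
have [ai|ia] := ltnP a i.
  apply: (dec_in [:: (i, j, s), (a, b, r) & w]); last by rewrite /= -w3.
    have -> : okw n [:: (i, j, s), (a, b, r) & w]
      = [&& (0 < i)%N, (i <= j)%N, (j < n)%N, inP k s & okw n.-2 ((a, b, r) :: w)] by [].
    by rewrite w1 hj hs; move: hi => /andP[-> ->].
  by rewrite /decw /= ai; exact: w2.
move: w1 => /= /and5P[b1 b2 b3 b4 b5].
have [l nl] : exists l, n = l.+4 by exists (n - 4)%N; lia.
move: hi hj b3 b5 nN hd IHd dec_in; rewrite nl => hi hj b3 b5 nN hd IHd _.
case: m w3 {IHm} IHd => // m [w3] IHd.
have bl : (b <= l.+1)%N by exact: b3.
have il : (i < l.+2)%N by apply: leq_ltn_trans ia (leq_ltn_trans b2 b3).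
have ii : (0 < i <= i)%N by move: hi => /andP[-> _] /=.
have idx i' : (i < i')%N -> (l.+4 - i' <= d)%N by move: hd; clear; lia.
apply: (@al_swap_raise l (dec_span l.+4 m.+2)) => //; first by rewrite ia b2.
  apply: linear_closed_sub (dec_span_linear _ _) => c; apply: scalar_sub.
  exact: subBMW_subalgebra.
move=> i' j' s' c hi' hj' hs' hc; case/andP: (hi') => ii' i'j'.
apply: IHd => //; first exact: idx.
  by rewrite i'j' (leq_trans _ ii').
apply: word_span_left => //; first exact: leq_trans (leq_trans (leqnSn _) (leqnSn _)) nN.
apply: word_span_cons => //; first exact: inP0.
by apply: rspan_in; [exact: subBMW_subalgebra | exists w].
Qed.

(** * The ideal of the e_i and the Ariki-Koike quotient *)

Lemma subBMW_st l u : subBMW l u -> subBMW l (st u).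
Proof.
elim=> [r|h|h|i h|i h|a b _ IHa _ IHb|a b _ IHa _ IHb].
- by rewrite (stZ str) (st1 str); apply: subBMW_scalar.
- by rewrite (stY str); apply: subBMW_Y.
- by rewrite -exprN1 st_exprz ?(stY str) // exprN1; apply: subBMW_YV.
- by rewrite (stX str); apply: subBMW_X.
- by rewrite (stE str); apply: subBMW_E.
- by rewrite (stD str); apply: subBMWD.
- by rewrite (stM str); apply: subBMWM.
Qed.

Lemma alE_r i j n s : (j <= n)%N -> al i j n.+1 s = al i j n s * E n.
Proof. by move=> h; rewrite /al /PE big_nat_recr // mulrA. Qed.

Section Ideal.
Variables (l : nat) (lN : (l.+2 <= N)%N).

(** Only the left factor carries e_{l+1}. If both did, the product would gain a factor A_0 from
    e_{l+1}^2, and A_0 need not be invertible. *)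
Definition ideal_set v := exists i j s b g h t,
  [/\ [/\ (0 < i <= j)%N, (j <= l.+1)%N & inP k s], subBMW l b,
      [/\ (0 < g <= h)%N, (h <= l.+1)%N & inP k t]
    & v = al i j l.+2 s * b * st (al g h l.+1 t)].

(* The two-sided ideal of B_{l+2} generated by e_{l+1}. *)
Definition E_ideal := rspan ideal_set (@scalar R A).

Let hS := @scalar_subalgebra R A.
Let J_linear : linear_closed (@scalar R A) E_ideal := rspan_linear _ hS.

Lemma E_ideal_left b u : subBMW l.+2 b -> E_ideal u -> E_ideal (b * u).
Proof.
move=> hb; apply: rspan_minl => // v [i [j [s [b0 [g [h [t [[i1 i2 i3] hb0 hg ->]]]]]]]].
have : LP l (b * al i j l.+2 s) by apply: LP_left => //; apply: LP_al.
have -> : b * (al i j l.+2 s * b0 * st (al g h l.+1 t))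
   = b * al i j l.+2 s * b0 * st (al g h l.+1 t).
  by move: (al i j _ s) => z; rewrite !mulrA.
elim=> [|_ c [i' [j' [s' [h1 h2 h3 ->]]]] hc|x y _ IHx _ IHy].
- by rewrite !mul0r; apply: rspan0.
- rewrite -(mulrA (al i' j' _ s')); apply: rspan_in => //.
  by exists i', j', s', (c * b0), g, h, t; split => //; apply: subBMWM.
- by rewrite !mulrDl; apply: rspanD.
Qed.

(** Since e_{l+1} commutes with B_l, it can be handed to the right factor, whose image under [st] is
    then a full word on which B_{l+2} acts from the left. *)
Lemma E_ideal_right b u : subBMW l.+2 b -> E_ideal u -> E_ideal (u * b).
Proof.
move=> hb hu; rewrite -[u]mul1r.
apply: (span_min J_linear) hu => v [i [j [s [b0 [g [h [t [hi hb0 [g1 g2 g3] ->]]]]]]]].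
have [i1 i2 i3] := hi.
have vl : valid l.+1 by lia.
have cE c : subBMW l c -> E l.+1 * c = c * E l.+1.
  by move=> hc; apply: (E_subBMW vl _ hc).
pose F z := al i j l.+1 s * b0 * st z.
have FE g' h' t' c : (h' <= l.+1)%N -> subBMW l c ->
    F (al g' h' l.+2 t' * c)
    = al i j l.+2 s * (b0 * st c) * st (al g' h' l.+1 t').
  move=> hh hc; rewrite /F (alE_r _ _ hh) (alE_r _ _ i2).
  move: (al i j _ s) (al g' h' _ t') => z z'; rewrite !(stM str) (stE str).
  by rewrite -!mulrA (commCA _ (cE _ hb0)) (commCA _ (cE _ (subBMW_st hc))).
have -> : 1 * (al i j l.+2 s * b0 * st (al g h l.+1 t)) * b
    = F (st b * al g h l.+2 t).
  have e := FE g h t 1 g2 (subBMW1 l); rewrite mulr1 (st1 str) mulr1 in e.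
  rewrite mul1r -e /F; move: (al g h _ t) => z.
  rewrite (stM str) (stK str); exact: esym (mulrA _ _ _).
have : LP l (st b * al g h l.+2 t).
  exact: (LP_left lN (subBMW_st hb) (LP_al lN t g1 g2)).
elim=> [|_ c [i' [j' [s' [h1 h2 h3 ->]]]] hc|x y _ IHx _ IHy].
- have st0 : st 0 = 0 by have := stZ str 0 1; rewrite !scale0r.
  by rewrite /F st0 mulr0; apply: rspan0.
- rewrite FE //; apply: rspan_in => //.
  exists i, j, s, (b0 * st c), i', j', s'; split => //.
  by apply: subBMWM => //; apply: subBMW_st.
- by rewrite /F (stD str) mulrDr; apply: rspanD.
Qed.

Lemma E_ideal_E i : (0 < i < l.+2)%N -> E_ideal (E i).
Proof.
move=> hi; have [d id] : exists d, i = (l.+1 - d)%N by exists (l.+1 - i)%N; lia.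
elim: d i hi id => [|d IH] i hi id.
  have -> : i = l.+1 by lia.
  apply: rspan_in => //; exists l.+1, l.+1, 0, 1, l.+1, l.+1, 0.
  split; [by split; rewrite ?inP0 /= ?leqnn | exact: subBMW1 | by split; rewrite ?inP0 /= ?leqnn |].
  rewrite /al !PX_nil PE_nil expr0z !mul1r (st1 str) !mulr1 PE_l //.
  by rewrite PE_nil mulr1.
have v1 : valid i by lia.
have v2 : valid i.+1 by lia.
rewrite -(bmw_EEE rel v1 v2 (adjSr i)).
apply: E_ideal_left; first by apply: subBMW_E; lia.
apply: E_ideal_right; first by apply: subBMW_E; lia.
by apply: IH; lia.
Qed.
End Ideal.

(** For L <= 1 there is no e_i, and the ideal is zero. *)
Definition e_ideal (L : nat) (x : A) : Prop :=
  if L is l.+2 then E_ideal l x else x = 0.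

Section CyclotomicQuotient.
Variables (L : nat) (L0 : (0 < L <= N)%N).

Let hS := @scalar_subalgebra R A.

Lemma e_ideal0 : e_ideal L 0.
Proof. by case: L => [|[|l]] //=; apply: rspan0. Qed.
Lemma e_idealD x y : e_ideal L x -> e_ideal L y -> e_ideal L (x + y).
Proof. by case: L => [|[|l]] /=; [move=> -> ->; rewrite addr0 .. | apply: rspanD]. Qed.
Lemma e_idealZ r x : e_ideal L x -> e_ideal L (r *: x).
Proof. by case: L => [|[|l]] /=; [move=> ->; rewrite scaler0 .. | apply: rspanZ]. Qed.
Lemma e_idealN x : e_ideal L x -> e_ideal L (- x).
Proof. by rewrite -scaleN1r; apply: e_idealZ. Qed.
Lemma e_idealMl b x : subBMW L b -> e_ideal L x -> e_ideal L (b * x).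
Proof.
move: L0; case: L => [|[|l]] /= lN; [by move=> _ ->; rewrite mulr0 .. |].
exact: E_ideal_left.
Qed.
Lemma e_idealMr b x : subBMW L b -> e_ideal L x -> e_ideal L (x * b).
Proof.
move: L0; case: L => [|[|l]] /= lN; [by move=> _ ->; rewrite mul0r .. |].
exact: E_ideal_right.
Qed.
Lemma e_ideal_E i : (0 < i < L)%N -> e_ideal L (E i).
Proof. by move: L0; case: L => [|[|l]] lN hi; [lia | lia | apply: E_ideal_E]. Qed.

Lemma e_ideal_mul a a' b b' : subBMW L b -> subBMW L a' ->
  e_ideal L (a - a') -> e_ideal L (b - b') -> e_ideal L (a * b - a' * b').
Proof.
move=> hb ha' h1 h2.
have -> : a * b - a' * b' = (a - a') * b + a' * (b - b').
  by rewrite mulrBl mulrBr addrA subrK.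
by apply: e_idealD; [apply: e_idealMr | apply: e_idealMl].
Qed.

(* Modulo the e_i this inverts pi_L; generators outside h_L are sent to 0. *)
Definition hecke_gen (g : hgen) : A :=
  match g with
  | HT i => if (i < L)%N then if i is 0 then Y else q *: X i else 0
  | HTi i => if (i < L)%N then if i is 0 then Y^-1 else q^-1 *: (X i)^-1 else 0
  end.

Lemma subBMW_hecke a : subBMW L (ev hecke_gen a).
Proof.
have hB := subBMW_subalgebra L.
have h0 : subBMW L 0 by rewrite -(scale0r 1); apply: subBMW_scalar.
elim: a => [r|[i|i]|a IHa b IHb|a IHa b IHb] /=.
- exact: subBMW_scalar.
- case: ltnP => // iL; case: i iL => [|i] iL; first by apply: subBMW_Y; lia.
  by apply: subalgebraZ => //; apply: subBMW_X; lia.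
- case: ltnP => // iL; case: i iL => [|i] iL; first by apply: subBMW_YV; lia.
  by apply: subalgebraZ => //; apply: subBMW_XV; lia.
- exact: subBMWD.
- exact: subBMWM.
Qed.

Hypothesis uq : q \is a GRing.unit.

(** Every defining relation of h_L holds exactly except the quadratic one, whose defect is a
    multiple of e_i. A derivation may pass through generators outside h_L, so these need values in
    B_L too. *)
Lemma hecke_teq a b : teq (hrel q qs L k) a b ->
  e_ideal L (ev hecke_gen a - ev hecke_gen b).
Proof.
have eqE x y : x = y -> e_ideal L (x - y) by move=> ->; rewrite subrr; apply: e_ideal0.
elim=> {a b}.
- move=> a b; case.
  + move=> i iL; apply: eqE => /=; rewrite iL scale1r; case: i iL => [|i] iL.
      by rewrite mulrV.
    rewrite -scalerAl -scalerAr scalerA mulrV // scale1r mulrV //; apply: uX; lia.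
  + move=> i iL; apply: eqE => /=; rewrite iL scale1r; case: i iL => [|i] iL.
      by rewrite mulVr.
    rewrite -scalerAl -scalerAr scalerA mulVr // scale1r mulVr //; apply: uX; lia.
  + move=> L1; apply: eqE => /=; rewrite L1 (ltnW L1) !scale1r !mulr1.
    expand_products; rewrite (bmw_YXYX rel) //; lia.
  + move=> i i0 iL; apply: eqE => /=; rewrite iL (ltnW iL) !scale1r !mulr1.
    case: i i0 iL => // i i0 iL; expand_products.
    by rewrite (bmw_braid rel) //; lia.
  + move=> i j iL jL hf; apply: eqE => /=; rewrite iL jL.
    case: i iL hf => [|i] iL hf; case: j jL hf => [|j] jL hf //.
    * by rewrite -scalerAl -scalerAr (bmw_YX rel) //; lia.
    * by rewrite -scalerAl -scalerAr (bmw_YX rel) //; lia.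
    * by rewrite -!scalerAl -!scalerAr (bmw_XX rel) //; lia.
  + apply: eqE; rewrite ev_tpow ev_tcomb.
    have -> : ev hecke_gen (TG R (HT 0)) = Y by rewrite /=; case: ltnP => //; lia.
    rewrite (bmw_Yk rel); apply: eq_bigr => i _; congr (_ *: _).
    rewrite ev_tpow; congr (_ ^+ _); rewrite /=; case: ltnP => //; lia.
  + move=> i hi; rewrite /= mulr_algl; case/andP: hi => i0 iL; rewrite iL.
    case: i i0 iL => // i i0 iL.
    have v : valid i.+1 by lia.
    have XX := rank2_xx (rank_two_BMW v).
    have -> : q *: X i.+1 * (q *: X i.+1) - ((q ^+ 2 - 1) *: (q *: X i.+1) + (q ^+ 2)%:A)
      = (- (q ^+ 2 * (dl * lam))) *: E i.+1.
      have qd : q * q^-1 = 1 by exact: mulrV.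
      rewrite -scalerAl -scalerAr XX.
      have -> : q ^+ 2 - 1 = q * dl by rewrite mulrBr qd expr2.
      by linear_identity R A.
    by apply: e_idealZ; apply: e_ideal_E; lia.
- by move=> a; apply: eqE.
- by move=> a b _ IH; rewrite -opprB; apply: e_idealN.
- by move=> a b c _ IH1 _ IH2; rewrite -(subrKA (ev hecke_gen b)); apply: e_idealD.
- move=> a a' b b' _ IH1 _ IH2 /=; rewrite opprD addrACA; exact: e_idealD.
- move=> a a' b b' _ IH1 _ IH2 /=; apply: e_ideal_mul => //; exact: subBMW_hecke.
- by move=> a b c; apply: eqE; rewrite /= addrA.
- by move=> a b; apply: eqE; rewrite /= addrC.
- by move=> a; apply: eqE; rewrite /= scale0r add0r.
- by move=> a; apply: eqE; rewrite /= scale0r mulr_algl scaleN1r addNr.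
- by move=> a b c; apply: eqE; rewrite /= mulrA.
- by move=> a; apply: eqE; rewrite /= scale1r mul1r.
- by move=> a; apply: eqE; rewrite /= scale1r mulr1.
- by move=> a b c; apply: eqE; rewrite /= mulrDl.
- by move=> a b c; apply: eqE; rewrite /= mulrDr.
- by move=> r s; apply: eqE; rewrite /= scalerDl.
- by move=> r s; apply: eqE; rewrite /= mulr_algl scalerA.
- by move=> r a; apply: eqE; rewrite /= mulr_algl mulr_algr.
Qed.
End CyclotomicQuotient.

Definition bmw_gen (g : bgen) : A :=
  match g with
  | BY => Y
  | BYi => Y^-1
  | BX i => X i
  | BXi i => XI i
  | BE i => E i
  end.

Lemma subBMW_ev L a : (0 < L <= N)%N -> bwf L a -> subBMW L (ev bmw_gen a).
Proof.
move=> L0; elim: a => [r|g|a IHa b IHb|a IHa b IHb] /=.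
- by move=> _; apply: subBMW_scalar.
- case: g => [||i|i|i] /=; rewrite /bwf /=.
  + by move=> _; apply: subBMW_Y; lia.
  + by move=> _; apply: subBMW_YV; lia.
  + exact: subBMW_X.
  + by move=> hi; rewrite (bmw_XI rel) //; [apply: subBMW_XV => //; lia | lia].
  + exact: subBMW_E.
- by case/andP=> /IHa ? /IHb ?; apply: subBMWD.
- by case/andP=> /IHa ? /IHb ?; apply: subBMWM.
Qed.

(** [piAK] acts on terms, so elements of the subalgebra are lifted to terms before it is applied. *)
Lemma ev_subBMW L u : subBMW L u -> exists2 a, bwf L a & ev bmw_gen a = u.
Proof.
elim=> [r|h|h|i h|i h|a b _ [ta ha ea] _ [tb hb eb]|a b _ [ta ha ea] _ [tb hb eb]].
- by exists (TC _ r).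
- by exists (TG R BY).
- by exists (TG R BYi).
- by exists (TG R (BX i)).
- by exists (TG R (BE i)).
- by exists (TAdd ta tb); rewrite /bwf /= ?ea ?eb //; apply/andP.
- by exists (TMul ta tb); rewrite /bwf /= ?ea ?eb //; apply/andP.
Qed.

Lemma hwf_piAK L a : (0 < L)%N -> bwf L a -> hwf L (piAK q a).
Proof.
move=> L0; elim: a => [r|g|a IHa b IHb|a IHa b IHb] //=.
- by case: g => [||i|i|i] //=; rewrite /bwf /hwf /= => /andP[].
- by case/andP=> /IHa ? /IHb ?; apply/andP.
- by case/andP=> /IHa ? /IHb ?; apply/andP.
Qed.

Lemma ev_piAK L a : (0 < L <= N)%N -> q \is a GRing.unit -> bwf L a ->
  e_ideal L (ev bmw_gen a - ev (hecke_gen L) (piAK q a)).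
Proof.
move=> L0 uq; have eqE x y : x = y -> e_ideal L (x - y).
  by move=> ->; rewrite subrr; apply: e_ideal0.
elim: a => [r|g|a IHa b IHb|a IHa b IHb] /=.
- by move=> _; apply: eqE.
- case: g => [||i|i|i] /=; rewrite /bwf /=.
  + by move=> _; apply: eqE; rewrite ifT //; lia.
  + by move=> _; apply: eqE; rewrite ifT //; lia.
  + move=> hi; apply: eqE; rewrite mulr_algl ifT; last by lia.
    by case: i hi => // i _; rewrite scalerA mulVr // scale1r.
  + move=> hi; apply: eqE; rewrite mulr_algl ifT; last by lia.
    rewrite (bmw_XI rel); last by lia.
    by case: i hi => // i _; rewrite scalerA mulrV // scale1r.
  + by move=> hi; rewrite scale0r subr0; apply: e_ideal_E.
- case/andP=> /IHa ? /IHb ?; rewrite opprD addrACA; exact: e_idealD.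
- case/andP=> ha hb; apply: e_ideal_mul => //; [exact: subBMW_ev | exact: subBMW_hecke | exact: IHa | exact: IHb].
Qed.

(** * Two-sided words *)

Lemma prodl_cat (s1 s2 : seq A) :
  foldr *%R 1 (s1 ++ s2) = foldr *%R 1 s1 * foldr *%R 1 s2.
Proof. by elim: s1 => [|a s IH] /=; rewrite ?mul1r // IH mulrA. Qed.

Lemma prodl_map (T : Type) (F : T -> A) s :
  foldr *%R 1 [seq F x | x <- s] = \prod_(x <- s) F x.
Proof. by elim: s => [|x s IH] /=; rewrite ?big_nil // big_cons IH. Qed.

Lemma prodl_st (s : seq A) : foldr *%R 1 [seq st x | x <- rev s] = st (foldr *%R 1 s).
Proof.
elim: s => [|a s IH] /=; first by rewrite (st1 str).
by rewrite rev_cons -cats1 map_cat prodl_cat IH (stM str) /= mulr1.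
Qed.

Lemma st_inv u : st u = u -> st u^-1 = u^-1.
Proof.
move=> su; have [uu|nu] := boolP (u \is a GRing.unit); last by rewrite invr_out.
by rewrite -exprN1 st_exprz.
Qed.

Lemma ev_tstar a : ev bmw_gen (tstar a) = st (ev bmw_gen a).
Proof.
elim: a => [r|g|a IHa b IHb|a IHa b IHb] /=.
- by rewrite (stZ str) (st1 str).
- by case: g => [||i|i|i] /=; rewrite ?st_inv ?(stY str) ?(stX str) ?(stXI str) ?(stE str).
- by rewrite (stD str) IHa IHb.
- by rewrite (stM str) IHa IHb.
Qed.

Lemma prodl_palindrome (F : nat -> A) y m :
  foldr *%R 1 ([seq F t | t <- rev (iota 1 m.+1)] ++ y :: [seq F t | t <- iota 1 m.+1])
  = F m.+1 * foldr *%R 1 ([seq F t | t <- rev (iota 1 m)] ++ y :: [seq F t | t <- iota 1 m])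
    * F m.+1.
Proof.
have -> : iota 1 m.+1 = rcons (iota 1 m) m.+1 by rewrite -[m.+1 in LHS]addn1 iotaD cats1.
rewrite rev_rcons map_rcons -cats1 /= -cat_cons catA prodl_cat /= mulr1.
by rewrite mulrA.
Qed.

Lemma ev_Yp i : (0 < i)%N -> ev bmw_gen (Yp R i) = JM i.
Proof.
case: i => // i _; rewrite /Yp ev_tprod map_cat /= -!map_comp.
elim: i => [|i IH]; first by rewrite /= mulr1 JM1.
by rewrite prodl_palindrome IH [JM i.+2]JMS.
Qed.

Lemma ev_Ypinv i : (0 < i <= N)%N -> ev bmw_gen (Ypinv R i) = (JM i)^-1.
Proof.
case: i => // i; rewrite /Ypinv ev_tprod map_cat /= -!map_comp.
elim: i => [|i IH] hi; first by rewrite /= mulr1 JM1.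
have ui : X i.+1 \is a GRing.unit by apply: uX; lia.
have uJ : JM i.+1 \is a GRing.unit by apply: JM_unit; lia.
rewrite prodl_palindrome IH; last by lia.
rewrite [JM i.+2]JMS //.
rewrite !invrM ?unitrMr // mulrA -(bmw_XI rel) //; lia.
Qed.

Lemma ev_alpha i j l (s : int) : (0 < i <= N)%N ->
  ev bmw_gen (alpha R i j l s) = al i j l.+1 s.
Proof.
move=> hi; rewrite /alpha ev_tprod /= map_cat prodl_cat -!map_comp !prodl_map.
have -> : ev bmw_gen (Yppow R i s) = JM i ^ s.
  case: s => m; rewrite [LHS]ev_tpow; first by rewrite ev_Yp //; lia.
  by rewrite ev_Ypinv // NegzE -exprz_inv.
by rewrite mulrA.
Qed.

(* [rw n w] is [lw n w] without the last e of each factor, see [lw_rw]. *)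
Fixpoint rw (n : nat) (w : word) : A :=
  if w is (i, j, s) :: w' then al i j n.-1 s * rw n.-2 w' else 1.

(** The last generators e_{n-1}, e_{n-3}, ... of the m factors of a word. Their product is fixed by
    [st] and commutes with B_{n-2m}, so it can belong to either half of a two-sided word. *)
Fixpoint cupE (n m : nat) : A :=
  if m is m'.+1 then E n.-1 * cupE n.-2 m' else 1.

Lemma okw_size n w : okw n w -> ((size w).*2 <= n)%N.
Proof.
elim: w n => [|[[i j] s] w IH] n //= /and5P[h1 h2 h3 _ /IH h5].
by move: h5; rewrite doubleS; lia.
Qed.

Lemma okw_rcons n w i j s : okw n w -> (0 < i <= j)%N -> (j < n - (size w).*2)%N ->
  inP k s -> okw n (rcons w (i, j, s)).
Proof.
elim: w n => [|[[a b] r] w IH] n /=.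
  by rewrite subn0 => _ /andP[-> ->] -> ->.
move=> /and5P[-> -> -> -> h] hi hj hs /=; apply: IH => //.
by move: hj; rewrite doubleS; lia.
Qed.

Lemma lw_rcons n w i j s :
  lw n (rcons w (i, j, s)) = lw n w * al i j (n - (size w).*2) s.
Proof.
elim: w n => [|[[a b] r] w IH] n /=; first by rewrite subn0 mulr1 mul1r.
have e : (n.-2 - (size w).*2 = n - (size w).+1.*2)%N by rewrite doubleS; lia.
by rewrite IH e; exact: mulrA.
Qed.

Lemma rw_rcons n w i j s :
  rw n (rcons w (i, j, s)) = rw n w * al i j (n - (size w).*2).-1 s.
Proof.
elim: w n => [|[[a b] r] w IH] n /=; first by rewrite subn0 mulr1 mul1r.
have e : (n.-2 - (size w).*2 = n - (size w).+1.*2)%N by rewrite doubleS; lia.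
by rewrite IH e; exact: mulrA.
Qed.

Lemma subBMW_al i j n (s : int) : (0 < i <= j)%N -> (j <= n)%N -> (n <= N)%N ->
  subBMW n (al i j n s).
Proof.
move=> hi hj hn; apply: subBMWM; last by apply: subBMW_PE; lia.
by apply: subBMWM; [apply: subBMW_JM; lia | apply: subBMW_PX; lia].
Qed.

Lemma subBMW_rw n w : (n <= N)%N -> okw n w -> subBMW n.-1 (rw n w).
Proof.
elim: w n => [|[[i j] s] w IH] n nN; first by move=> _; apply: subBMW1.
move=> /= /and5P[h1 h2 h3 h4 h5].
apply: subBMWM; first by apply: subBMW_al; lia.
by apply: subBMW_le (IH n.-2 _ h5); lia.
Qed.

Lemma subBMW_cupE n m : (n <= N)%N -> (m.*2 <= n)%N -> subBMW n (cupE n m).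
Proof.
elim: m n => [|m IH] n nN hm; first exact: subBMW1.
move: hm; rewrite doubleS => hm.
apply: subBMWM; first by apply: subBMW_E; lia.
have h : (m.*2 <= n.-2)%N by lia.
by apply: subBMW_le (IH n.-2 _ h); lia.
Qed.

Lemma cupE_comm n m b : (n <= N)%N -> (m.*2 <= n)%N -> subBMW (n - m.*2) b ->
  cupE n m * b = b * cupE n m.
Proof.
elim: m n => [|m IH] n nN hm hb; first by rewrite mulr1 mul1r.
move: hm hb; rewrite doubleS => hm hb /=.
have v : valid n.-1 by lia.
have c : E n.-1 * b = b * E n.-1 by apply: (E_subBMW v _ hb); lia.
have hb' : subBMW (n.-2 - m.*2) b by apply: subBMW_le hb; lia.
by rewrite -mulrA IH ?mulrA ?c //; lia.
Qed.

Lemma st_cupE n m : (n <= N)%N -> (m.*2 <= n)%N -> st (cupE n m) = cupE n m.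
Proof.
elim: m n => [|m IH] n nN hm; first exact: (st1 str).
move: hm; rewrite doubleS => hm /=.
have v : valid n.-1 by lia.
rewrite (stM str) (stE str) IH; try lia.
have h : subBMW n.-2 (cupE n.-2 m) by apply: subBMW_cupE; lia.
by apply/esym; apply: (E_subBMW v _ h); lia.
Qed.

Lemma lw_rw n w : (n <= N)%N -> okw n w -> lw n w = rw n w * cupE n (size w).
Proof.
elim: w n => [|[[i j] s] w IH] n nN /=; first by rewrite mulr1.
move=> /and5P[h1 h2 h3 h4 h5].
have v : valid n.-1 by lia.
have -> : al i j n s = al i j n.-1 s * E n.-1.
  have e : n = n.-1.+1 by lia.
  by rewrite {1}e alE_r //; lia.
have hn : (n.-2 <= N)%N by lia.
have c : E n.-1 * rw n.-2 w = rw n.-2 w * E n.-1.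
  by apply: (E_subBMW v _ (subBMW_rw hn h5)); lia.
rewrite IH //; move: (al i j _ s) => z; rewrite -!mulrA; congr (z * _).
by rewrite (commCA _ c).
Qed.

Definition entry (w : word) t := nth (0%N, 0%N, 0 : int) w t.

Lemma lw_prod n w : lw n w = \prod_(t <- iota 0 (size w))
  al (entry w t).1.1 (entry w t).1.2 (n - t.*2) (entry w t).2.
Proof.
elim: w n => [|[[i j] s] w IH] n; first by rewrite big_nil.
rewrite [iota 0 _]/= big_cons (iotaDl 1 0) big_map /= subn0 IH.
by congr (_ * _); apply: eq_bigr => t _; rewrite add1n doubleS -sub2S.
Qed.

Lemma rw_prod n w : rw n w = \prod_(t <- iota 0 (size w))
  al (entry w t).1.1 (entry w t).1.2 (n - t.*2).-1 (entry w t).2.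
Proof.
elim: w n => [|[[i j] s] w IH] n; first by rewrite big_nil.
rewrite [iota 0 _]/= big_cons (iotaDl 1 0) big_map /= subn0 IH.
by congr (_ * _); apply: eq_bigr => t _; rewrite add1n doubleS -sub2S.
Qed.

Lemma okw_entry n w t : okw n w -> (t < size w)%N ->
  [/\ (0 < (entry w t).1.1 <= (entry w t).1.2)%N,
      ((entry w t).1.2 < n - t.*2)%N & inP k (entry w t).2].
Proof.
elim: w n t => [|[[i j] s] w IH] n [|t] //= /and5P[h1 h2 h3 h4 h5] ht.
  by rewrite h1 h2 subn0.
by have [? ? ?] := IH _ t h5 ht; split=> //; rewrite doubleS -sub2S.
Qed.

(** * Spanning by the displayed elements *)

Section Spanning.
Variables (d : nat -> nat) (chi : nat -> nat -> term R bgen).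
Hypothesis uq : q \is a GRing.unit.
Hypothesis chi_wf : forall l y, (0 < l <= N)%N -> (y < d l)%N -> bwf l (chi l y).
Hypothesis chi_gen : forall l (a : term R hgen), (0 < l <= N)%N -> hwf l a ->
  exists c : nat -> R, teq (hrel q qs l k) a
    (tsum [seq tscale (c y) (piAK q (chi l y)) | y <- iota 0 (d l)]).

Let hS := @scalar_subalgebra R A.

(** Expand the image of b under pi_L in the given basis and apply [hecke_gen], which undoes pi_L
    modulo the ideal on both sides of the expansion. *)
Lemma chi_span L b : (0 < L <= N)%N -> subBMW L b -> exists c : nat -> R,
  e_ideal L (b - \sum_(y < d L) c y *: ev bmw_gen (chi L y)).
Proof.
move=> L0 /ev_subBMW[a wa <-].
have [c hc] := chi_gen L0 (hwf_piAK (proj1 (andP L0)) wa).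
exists c; set S := \sum_(_ < _) _.
have h1 := ev_piAK L0 uq wa; have := hecke_teq L0 uq hc.
rewrite ev_tcomb; set S' := \sum_(_ < _) _ => h2.
have h3 : e_ideal L (S' - S).
  rewrite /S /S' -sumrB; elim/big_rec: _ => [|y u _ hu]; first exact: e_ideal0.
  apply: e_idealD => //; rewrite -scalerBr; apply: e_idealZ.
  by rewrite -opprB; apply: e_idealN; apply: ev_piAK => //; apply: chi_wf.
rewrite -(subrKA (ev (hecke_gen L) (piAK q a))); apply: e_idealD => //.
by rewrite -(subrKA S'); apply: e_idealD.
Qed.

Definition final_span :=
  rspan (fun v => exists2 w, spanning_elt N k d chi w & v = ev bmw_gen w) (@scalar R A).

Lemma final_span_word m ws vs x : okw N ws -> okw N vs -> decw ws -> decw vs ->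
  size ws = m -> size vs = m ->
  (if (N - 2 * m == 0)%N then x = TC _ 1
   else exists2 y, (y < d (N - 2 * m))%N & x = chi (N - 2 * m)%N y) ->
  final_span (lw N ws * ev bmw_gen x * st (rw N vs)).
Proof.
move=> ow ov dw dv sw sv hx; apply: rspan_in => //.
(* Factors are numbered from 1 in [spanning_elt] and from 0 in a word. *)
pose i f := (entry ws f.-1).1.1; pose j f := (entry ws f.-1).1.2.
pose s f := (entry ws f.-1).2.
pose g f := (entry vs f.-1).1.1; pose h f := (entry vs f.-1).1.2.
pose t f := (entry vs f.-1).2.
have mN : (m.*2 <= N)%N by rewrite -sw; apply: okw_size ow.
have ew f : (0 < f <= m)%N -> [/\ (0 < i f <= j f)%N, (j f < N - f.-1.*2)%N & inP k (s f)].
  by move=> hf; apply: okw_entry => //; lia.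
have ev' f : (0 < f <= m)%N -> [/\ (0 < g f <= h f)%N, (h f < N - f.-1.*2)%N & inP k (t f)].
  by move=> hf; apply: okw_entry => //; lia.
exists (tprod ([seq alpha R (i f) (j f) (N - 2 * f + 1) (s f) | f <- iota 1 m]
   ++ x :: [seq tstar (alpha R (g f) (h f) (N - 2 * f) (t f)) | f <- rev (iota 1 m)])).
  exists m, i, j, g, h, s, t, x; split=> //; first by lia.
  - move=> f f1 fm; split.
      by have /(sortedP (0%N, 0%N, 0 : int))/(_ f.-1) := dw; rewrite prednK // sw => /(_ fm).
    by have /(sortedP (0%N, 0%N, 0 : int))/(_ f.-1) := dv; rewrite prednK // sv => /(_ fm).
  - move=> f hf; have [a1 a2 a3] := ew f hf; have [b1 b2 b3] := ev' f hf.
    have bound c : (c < N - f.-1.*2)%N -> (c <= N - 2 * f + 1)%N.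
      by move: hf mN; clear; lia.
    by split; rewrite ?a3 ?b3 ?bound.
rewrite ev_tprod map_cat prodl_cat /= -!map_comp mulrA; congr (_ * _ * _).
  rewrite prodl_map (iotaDl 1 0) big_map lw_prod sw; apply: eq_big_seq => f.
  rewrite mem_iota add1n => hf; have [a1 a2 a3] := ew f.+1 ltac:(lia).
  symmetry; transitivity (al (i f.+1) (j f.+1) (N - 2 * f.+1 + 1).+1 (s f.+1)).
    have e := @ev_alpha (i f.+1) (j f.+1) (N - 2 * f.+1 + 1)%N (s f.+1) ltac:(lia).
    exact e.
  by congr (al _ _ _ _); lia.
rewrite rw_prod sv -prodl_map -prodl_st.
have -> : iota 1 m = [seq (1 + t)%N | t <- iota 0 m] by exact: (iotaDl 1 0 m).
rewrite !map_rev -!map_comp; congr (foldr *%R 1 (rev _)); apply/eq_in_map => f.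
rewrite mem_iota => hf; have [b1 b2 b3] := ev' f.+1 ltac:(lia).
symmetry; transitivity (st (al (g f.+1) (h f.+1) (N - 2 * f.+1).+1 (t f.+1))).
  have e := @ev_alpha (g f.+1) (h f.+1) (N - 2 * f.+1)%N (t f.+1) ltac:(lia).
  have e' := ev_tstar (alpha R (g f.+1) (h f.+1) (N - 2 * f.+1)%N (t f.+1)).
  by rewrite e in e'; exact e'.
by congr (st (al _ _ _ _)); lia.
Qed.

Lemma subBMW0_scalar b : subBMW 0 b -> scalar b.
Proof.
have [_ hD hM] := hS.
elim=> // [r|i hi|i hi|u v _ IHu _ IHv|u v _ IHu _ IHv]; try lia.
- by exists r.
- exact: hD.
- exact: hM.
Qed.

(** Ordering the left word changes only that word and the coefficient. Handing [cupE] over to the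
    right half and applying [st] then makes the right word a full one, which is ordered by the same
    lemma without disturbing the left. *)
Lemma final_span_dec L m : (m.*2 + L = N)%N ->
  (forall ws vs b, okw N ws -> okw N vs -> decw ws -> decw vs ->
     size ws = m -> size vs = m -> subBMW L b ->
     final_span (lw N ws * b * st (rw N vs))) ->
  forall ws vs b, okw N ws -> okw N vs -> size ws = m -> size vs = m ->
    subBMW L b -> final_span (lw N ws * b * st (rw N vs)).
Proof.
move=> mL main ws vs b ow ov sw sv hb.
have LE : L = (N - m.*2)%N by lia.
have mN : (m.*2 <= N)%N by lia.
have in_word w c : okw N w -> size w = m -> subBMW L c -> dec_span N m (lw N w * c).
  move=> o1 o2 hc; apply: word_span_dec => //; apply: rspan_gen; first by exists w.
  by rewrite -LE.
have h0 : linear_closed (@scalar R A) final_span by apply: rspan_linear.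
have st0 : st 0 = 0 by have := stZ str 0 1; rewrite !scale0r.
have := in_word ws b ow sw hb; elim=> [|_ c [ws' [o1 o2 o3 ->]] hc|x y _ IHx _ IHy].
- by rewrite mul0r; apply: rspan0.
- rewrite -LE in hc.
  have -> : lw N ws' * c * st (rw N vs) = rw N ws' * st (lw N vs * st c).
    rewrite !lw_rw // !(stM str) (stK str) sv o3 st_cupE // -!mulrA.
    by congr (_ * _); rewrite !mulrA cupE_comm // -LE.
  have := in_word vs (st c) ov sv (subBMW_st hc).
  elim=> [|_ c' [vs' [p1 p2 p3 ->]] hc'|x y _ IHx _ IHy].
  + by rewrite st0 mulr0; apply: rspan0.
  + rewrite -LE in hc'.
    have -> : rw N ws' * st (lw N vs' * c') = lw N ws' * st c' * st (rw N vs').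
      rewrite !lw_rw // !(stM str) p3 o3 st_cupE // -!mulrA; congr (_ * _).
      by rewrite !mulrA cupE_comm // -LE; apply: subBMW_st.
    by apply: main => //; apply: subBMW_st.
  + by rewrite (stD str) mulrDr; apply: rspanD.
- by rewrite mulrDl; apply: rspanD.
Qed.

(** Induction on L: modulo the ideal of the e_i, b is a combination of the lifts, and a generator of
    the ideal appends one factor to each word and lowers L by 2. Appending can break the order, so
    the words are ordered anew at every level. *)
Lemma final_span_all L m ws vs b : (m.*2 + L = N)%N -> okw N ws -> okw N vs ->
  size ws = m -> size vs = m -> subBMW L b ->
  final_span (lw N ws * b * st (rw N vs)).
Proof.
have [M] := ubnP L; elim: M L m ws vs b => // M IH L m ws vs b LM mL ow ov sw sv hb.
apply: final_span_dec ow ov sw sv hb => // {}ws {}vs {}b ow ov dw dv sw sv hb.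
have hF : linear_closed (@scalar R A) final_span by apply: rspan_linear.
have [L0|L0] := posnP L.
  move: hb; rewrite L0 => /subBMW0_scalar[r ->].
  rewrite mulr_algr -scalerAl; apply: rspanZ => //.
  have := @final_span_word m ws vs (TC _ 1) ow ov dw dv sw sv.
  rewrite /= scale1r mulr1; apply; rewrite ifT //; lia.
have LN : (0 < L <= N)%N by lia.
have LE : (N - 2 * m = L)%N by lia.
have [c hc] := chi_span LN hb.
rewrite -(subrK (\sum_(y < d L) c y *: ev bmw_gen (chi L y)) b) mulrDr mulrDl.
apply: rspanD; last first.
  rewrite mulr_sumr mulr_suml; elim/big_rec: _ => [|y u _ hu]; first exact: rspan0.
  apply: rspanD => //; rewrite -scalerAr -scalerAl; apply: rspanZ => //.
  apply: (@final_span_word m) => //.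
  by rewrite LE (gtn_eqF L0); exists y.
move: hc; set e := b - _; move: e => e {c hb}.
case: L L0 LM mL LN LE => [|[|l]] // L0 LM mL LN LE.
  by move=> /= ->; rewrite mulr0 mul0r; apply: rspan0.
move=> /= he; apply: (span_min hF) he.
move=> _ [i [j [s [b0 [g [h [t [[i1 i2 i3] hb0 [g1 g2 g3] ->]]]]]]]].
have nE : (N - m.*2 = l.+2)%N by rewrite -mL addKn.
have e1 := lw_rcons N ws i j s; have e2 := rw_rcons N vs g h t.
rewrite sw nE in e1; rewrite sv nE /= in e2.
have -> : lw N ws * (al i j l.+2 s * b0 * st (al g h l.+1 t)) * st (rw N vs)
   = lw N (rcons ws (i, j, s)) * b0 * st (rw N (rcons vs (g, h, t))).
  rewrite e1 e2; move: (al i j _ s) (al g h _ t) => z z'.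
  by rewrite (stM str) !mulrA.
apply: (IH l m.+1) => //; first by move: LM; rewrite ltnS => /ltnW.
- by rewrite doubleS -mL !addSn !addnS.
- by apply: okw_rcons => //; rewrite sw nE.
- by apply: okw_rcons => //; rewrite sv nE.
- by rewrite size_rcons sw.
- by rewrite size_rcons sv.
Qed.

Lemma spanning_theorem a : (0 < N)%N -> bwf N a -> final_span (ev bmw_gen a).
Proof.
move=> N0 ha; have h := subBMW_ev (L := N) (a := a) ltac:(lia) ha.
have := @final_span_all N 0 [::] [::] _ (erefl _) isT isT erefl erefl h.
by rewrite /= mul1r (st1 str) mulr1.
Qed.
End Spanning.
End Relations.

(** * The algebra defined by a presentation *)

Section Presentation.
Local Open Scope quotient_scope.
Variables (R : comUnitRingType) (G : Type) (rel : term R G -> term R G -> Prop).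

HB.instance Definition _ := gen_eqMixin (term R G).
HB.instance Definition _ := gen_choiceMixin (term R G).

Definition teqb (a b : term R G) : bool := `[< teq rel a b >].

Lemma teqb_refl : reflexive teqb.
Proof. by move=> a; apply/asboolP/teq_refl. Qed.
Lemma teqb_sym : symmetric teqb.
Proof. by move=> a b; apply/asboolP/asboolP; apply: teq_sym. Qed.
Lemma teqb_trans : transitive teqb.
Proof. by move=> b a c /asboolP ab /asboolP bc; apply/asboolP; apply: teq_trans ab bc. Qed.

Definition teq_equiv := EquivRel teqb teqb_refl teqb_sym teqb_trans.

Hypothesis nontrivial : ~ teq rel (TC G 1) (TC G 0).

(** The type takes the nontriviality proof as an argument because a [unitAlgType] requires 1 to
    differ from 0. *)
Definition presented of (~ teq rel (TC G 1) (TC G 0)) := {eq_quot teq_equiv}.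
Local Notation Q := (presented nontrivial).

HB.instance Definition _ := Choice.on Q.

Definition cls (a : term R G) : Q := \pi_({eq_quot teq_equiv}) a.
Definition rep (x : Q) : term R G := repr (x : {eq_quot teq_equiv}).

Lemma clsP a b : cls a = cls b <-> teq rel a b.
Proof. by split=> [/eqmodP/asboolP|h]; last by apply/eqmodP/asboolP. Qed.

Lemma repK x : cls (rep x) = x.
Proof. exact: reprK. Qed.

Lemma cls_ind (P : Q -> Prop) : (forall a, P (cls a)) -> forall x, P x.
Proof. by move=> h x; rewrite -(repK x). Qed.

Lemma rep_cls a : teq rel (rep (cls a)) a.
Proof. by apply/clsP; rewrite repK. Qed.

Definition qadd (x y : Q) : Q := cls (TAdd (rep x) (rep y)).
Definition qmul (x y : Q) : Q := cls (TMul (rep x) (rep y)).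
Definition qopp (x : Q) : Q := qmul (cls (TC G (-1))) x.
Definition qscale (r : R) (x : Q) : Q := qmul (cls (TC G r)) x.

Lemma qaddE a b : qadd (cls a) (cls b) = cls (TAdd a b).
Proof. by apply/clsP; apply: teq_addm; apply: rep_cls. Qed.
Lemma qmulE a b : qmul (cls a) (cls b) = cls (TMul a b).
Proof. by apply/clsP; apply: teq_mulm; apply: rep_cls. Qed.

Lemma qaddA : associative qadd.
Proof.
elim/cls_ind=> a; elim/cls_ind=> b; elim/cls_ind=> c.
by rewrite !qaddE; apply/clsP/teq_addA.
Qed.
Lemma qaddC : commutative qadd.
Proof. by elim/cls_ind=> a; elim/cls_ind=> b; rewrite !qaddE; apply/clsP/teq_addC. Qed.
Lemma qadd0 : left_id (cls (TC G 0)) qadd.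
Proof. by elim/cls_ind=> a; rewrite !qaddE; apply/clsP/teq_add0. Qed.
Lemma qaddN : left_inverse (cls (TC G 0)) qopp qadd.
Proof. by elim/cls_ind=> a; rewrite /qopp !qmulE !qaddE; apply/clsP/teq_addN. Qed.

HB.instance Definition _ := GRing.isZmodule.Build Q qaddA qaddC qadd0 qaddN.

Lemma qmulA : associative qmul.
Proof.
elim/cls_ind=> a; elim/cls_ind=> b; elim/cls_ind=> c.
by rewrite !qmulE; apply/clsP/teq_mulA.
Qed.
Lemma qmul1l : left_id (cls (TC G 1)) qmul.
Proof. by elim/cls_ind=> a; rewrite !qmulE; apply/clsP/teq_mul1l. Qed.
Lemma qmul1r : right_id (cls (TC G 1)) qmul.
Proof. by elim/cls_ind=> a; rewrite !qmulE; apply/clsP/teq_mul1r. Qed.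
Lemma qmulDl : left_distributive qmul qadd.
Proof.
elim/cls_ind=> a; elim/cls_ind=> b; elim/cls_ind=> c.
by rewrite !(qmulE, qaddE); apply/clsP/teq_mulDl.
Qed.
Lemma qmulDr : right_distributive qmul qadd.
Proof.
elim/cls_ind=> a; elim/cls_ind=> b; elim/cls_ind=> c.
by rewrite !(qmulE, qaddE); apply/clsP/teq_mulDr.
Qed.
Lemma q1_neq0 : cls (TC G 1) != 0 :> Q.
Proof. by apply/eqP => /clsP. Qed.

HB.instance Definition _ :=
  GRing.Zmodule_isNzRing.Build Q qmulA qmul1l qmul1r qmulDl qmulDr q1_neq0.

Lemma qscaleA r s (x : Q) : qscale r (qscale s x) = qscale (r * s) x.
Proof.
by rewrite /qscale qmulA qmulE; congr (qmul _ _); apply/clsP/teq_CM.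
Qed.
Lemma qscale1 : left_id 1 qscale. Proof. exact: qmul1l. Qed.
Lemma qscaleDr : right_distributive qscale +%R.
Proof. by move=> r x y; apply: qmulDr. Qed.
Lemma qscaleDl (x : Q) : {morph qscale^~ x : a b / a + b}.
Proof.
move=> r s; rewrite /qscale; have -> : cls (TC G (r + s)) = qadd (cls (TC G r)) (cls (TC G s)).
  by rewrite qaddE; apply/esym/clsP/teq_CD.
exact: qmulDl.
Qed.

HB.instance Definition _ :=
  GRing.Zmodule_isLmodule.Build R Q qscaleA qscale1 qscaleDr qscaleDl.

Lemma qscaleAl (r : R) (x y : Q) : r *: (x * y) = (r *: x) * y.
Proof. exact: qmulA. Qed.
HB.instance Definition _ := GRing.Lmodule_isLalgebra.Build R Q qscaleAl.

Lemma qscaleAr (r : R) (x y : Q) : r *: (x * y) = x * (r *: y).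
Proof.
rewrite -[LHS]/(qmul (cls (TC G r)) (qmul x y)) -[RHS]/(qmul x (qmul (cls (TC G r)) y)).
rewrite !qmulA; congr (qmul _ _); elim/cls_ind: x => a.
by rewrite !qmulE; apply/clsP/teq_Ccomm.
Qed.
HB.instance Definition _ := GRing.Lalgebra_isAlgebra.Build R Q qscaleAr.

Definition is_unit : pred Q := fun x => `[< exists y, y * x = 1 /\ x * y = 1 >].
Definition qinv (x : Q) : Q :=
  if pselect (exists y, y * x = 1 /\ x * y = 1) is left h
  then projT1 (cid h) else x.

Lemma qmulVr : {in is_unit, left_inverse 1 qinv *%R}.
Proof.
by move=> x /asboolP h; rewrite /qinv; case: pselect => // h'; case: cid => y [].
Qed.
Lemma qmulrV : {in is_unit, right_inverse 1 qinv *%R}.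
Proof.
by move=> x /asboolP h; rewrite /qinv; case: pselect => // h'; case: cid => y [].
Qed.
Lemma qunitP (x y : Q) : y * x = 1 /\ x * y = 1 -> is_unit x.
Proof. by move=> h; apply/asboolP; exists y. Qed.
Lemma qinv_out : {in [predC is_unit], qinv =1 id}.
Proof. by move=> x /asboolP h; rewrite /qinv; case: pselect. Qed.

HB.instance Definition _ :=
  GRing.NzRing_hasMulInverse.Build Q qmulVr qmulrV qunitP qinv_out.

Definition presented_algebra : unitAlgType R := Q.

Lemma ev_cls a : ev (fun g => cls (TG R g) : presented_algebra) a = cls a.
Proof.
elim: a => [r|g|a IHa b IHb|a IHa b IHb] //=.
- rewrite -[LHS]/(qmul (cls (TC G r)) (cls (TC G 1))).
  by rewrite qmulE; apply/clsP/teq_mul1r.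
- by rewrite IHa IHb; apply: qaddE.
- by rewrite IHa IHb; apply: qmulE.
Qed.

Definition qstar (x : presented_algebra) : presented_algebra := cls (tstar (rep x)).

Hypothesis star_rel : forall a b, rel a b -> teq rel (tstar a) (tstar b).

Lemma tstar_teq a b : teq rel a b -> teq rel (tstar a) (tstar b).
Proof.
elim=> /=; eauto using teq.
Qed.

Lemma qstarE a : qstar (cls a) = cls (tstar a).
Proof. by apply/clsP/tstar_teq/rep_cls. Qed.
End Presentation.

(** * The cyclotomic BMW algebra and its anti-involution *)

Section BMWAlgebra.
Variables (R : comUnitRingType) (q lam : R) (qs As : nat -> R) (n k : nat).
Local Notation rel := (brel q lam qs As n k).
Hypothesis nontrivial : ~ teq rel (TC bgen 1) (TC bgen 0).
Local Notation A := (presented_algebra nontrivial).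
Local Notation valid i := (0 < i < n)%N.

Let gen (g : bgen) : A := cls nontrivial (TG R g).

Lemma ev_brel a b : rel a b -> ev gen a = ev gen b.
Proof. by move=> h; rewrite !ev_cls; apply/clsP/teq_rel. Qed.

Lemma invr_unique (x y : A) : x * y = 1 -> y * x = 1 ->
  x \is a GRing.unit /\ y = x^-1.
Proof.
move=> xy yx; have ux : x \is a GRing.unit by apply/unitrP; exists y.
by split=> //; apply: (mulrI ux); rewrite xy mulrV.
Qed.

Lemma BYi_inv : gen BY \is a GRing.unit /\ gen BYi = (gen BY)^-1.
Proof.
by apply: invr_unique; [have := ev_brel (br_Yinv1 _ _ _ _ _ _) | have := ev_brel (br_Yinv2 _ _ _ _ _ _)];
  rewrite /= scale1r.
Qed.

Lemma BXi_inv i : valid i -> gen (BX i) \is a GRing.unit /\ gen (BXi i) = (gen (BX i))^-1.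
Proof.
by move=> hi; apply: invr_unique; [have := ev_brel (br_Xinv1 _ _ _ _ _ hi) | have := ev_brel (br_Xinv2 _ _ _ _ _ hi)];
  rewrite /= scale1r.
Qed.

Lemma presented_relations : bmw_relations n k q lam qs As
  (fun i => gen (BX i)) (fun i => gen (BXi i)) (fun i => gen (BE i)) (gen BY).
Proof.
split.
- by case: BYi_inv.
- by move=> i /BXi_inv[].
- by move=> i /BXi_inv[].
- move=> i hi; have [_ <-] := BXi_inv hi.
  by have := ev_brel (br_skein _ _ _ _ _ hi); rewrite ev_tscale !ev_tsub /= scale1r.
- by move=> i j hi hj hf; have := ev_brel (br_XXc _ _ _ _ _ hi hj hf).
- by move=> i j hi hj hf; have := ev_brel (br_XEc _ _ _ _ _ hi hj hf).
- by move=> i j hi hj hf; have := ev_brel (br_EEc _ _ _ _ _ hi hj hf).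
- by move=> i hi hj; have := ev_brel (br_braid _ _ _ _ _ hi hj); rewrite !ev_tprod /= !mulr1.
- by move=> i hi; have := ev_brel (br_XE _ _ _ _ _ hi); rewrite ev_tscale.
- by move=> i hi; have := ev_brel (br_EX _ _ _ _ _ hi); rewrite ev_tscale.
- by move=> i j hi hj ha; have := ev_brel (br_XXE _ _ _ _ _ hi hj ha); rewrite !ev_tprod /= !mulr1.
- by move=> i j hi hj ha; have := ev_brel (br_EXX _ _ _ _ _ hi hj ha); rewrite !ev_tprod /= !mulr1.
- by move=> i j hi hj ha; have := ev_brel (br_EEE _ _ _ _ _ hi hj ha); rewrite !ev_tprod /= !mulr1.
- by move=> i hi; have := ev_brel (br_EE _ _ _ _ _ hi); rewrite ev_tscale.
- have := ev_brel (br_Yk q lam qs As n k); rewrite ev_tpow ev_tcomb => ->.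
  by apply: eq_bigr => i _; rewrite ev_tpow.
- by move=> h; have := ev_brel (br_YXYX _ _ _ _ _ h); rewrite !ev_tprod /= !mulr1.
- by move=> i hi h1; have := ev_brel (br_YXc _ _ _ _ _ hi h1).
- by move=> i hi h1; have := ev_brel (br_YEc _ _ _ _ _ hi h1).
- by move=> h; have := ev_brel (br_YXYE _ _ _ _ _ h); rewrite ev_tprod ev_tscale /= !mulr1.
- by move=> h; have := ev_brel (br_EYXY _ _ _ _ _ h); rewrite ev_tprod ev_tscale /= !mulr1.
- move=> m h hm; have := ev_brel (br_EYE _ _ _ _ h hm).
  by rewrite ev_tprod ev_tscale /= ev_tpow !mulr1.
Qed.

Lemma adjacent_sym i j : adjacent i j = adjacent j i.
Proof. by rewrite /adjacent orbC. Qed.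

(** Reversal permutes the defining relations up to exchanging sides. The check is made inside the
    quotient, where they are already ring identities. *)
Lemma tstar_brel a b : rel a b -> teq rel (tstar a) (tstar b).
Proof.
have P := presented_relations; move=> h; apply/(clsP nontrivial).
rewrite -!ev_cls -/gen.
have starX m : ev gen (tstar (tpow (TG R BY) m)) = gen BY ^+ m.
  by elim: m => [|m IH]; rewrite /= ?scale1r // exprSr -IH.
case: h => {a b} /=.
- by have [uY ->] := BYi_inv; rewrite mulVr // scale1r.
- by have [uY ->] := BYi_inv; rewrite mulrV // scale1r.
- by move=> i /BXi_inv[uX ->]; rewrite mulVr // scale1r.
- by move=> i /BXi_inv[uX ->]; rewrite mulrV // scale1r.
- move=> i hi; rewrite !mulr_algr !scaleN1r scale1r.
  by have [_ ->] := BXi_inv hi; apply: (bmw_skein P).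
- by move=> i j hi hj hf; apply/esym/(bmw_XX P).
- by move=> i j hi hj hf; apply/esym/(bmw_XEf P).
- by move=> i j hi hj hf; apply/esym/(bmw_EEf P).
- move=> i hi hj; rewrite !scale1r !mul1r -!mulrA; exact: (bmw_braid P).
- by move=> i hi; rewrite mulr_algr; apply: (bmw_EX P).
- by move=> i hi; rewrite mulr_algr; apply: (bmw_XE P).
- move=> i j hi hj ha; rewrite scale1r mul1r -!mulrA.
  by apply/esym/(bmw_EXX P); rewrite // adjacent_sym.
- move=> i j hi hj ha; rewrite scale1r mul1r -!mulrA.
  by apply/esym/(bmw_XXE P); rewrite // adjacent_sym.
- by move=> i j hi hj ha; rewrite scale1r mul1r -!mulrA; apply: (bmw_EEE P).
- by move=> i hi; rewrite mulr_algr; apply: (bmw_EE P).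
- rewrite starX (bmw_Yk P) -(big_mkord xpredT (fun i => qs i *: gen BY ^+ i)) /index_iota subn0.
  elim: (iota 0 k) => [|i s IH] /=; first by rewrite big_nil scale0r.
  by rewrite big_cons IH mulr_algr starX.
- by move=> h; rewrite !scale1r !mul1r -!mulrA; have := bmw_YXYX P h => /esym.
- by move=> i hi h1; apply/esym/(bmw_YX P).
- by move=> i hi h1; apply/esym/(bmw_YE P).
- by move=> h; rewrite scale1r mul1r mulr_algr -!mulrA; apply: (bmw_EYXY P).
- by move=> h; rewrite scale1r mul1r mulr_algr -!mulrA; apply: (bmw_YXYE P).
- move=> m h hm; rewrite scale1r mul1r mulr_algr starX -!mulrA.
  exact: (bmw_EYE P).
Qed.

Lemma presented_star : bmw_star (fun i => gen (BX i)) (fun i => gen (BXi i))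
  (fun i => gen (BE i)) (gen BY) (@qstar _ _ _ nontrivial).
Proof.
have sE a : qstar (cls nontrivial a) = cls nontrivial (tstar a).
  exact: qstarE tstar_brel a.
have gE g : qstar (gen g) = gen g by rewrite /gen sE.
have tstarK a : tstar (tstar a) = a :> term R bgen by elim: a => //= a -> b ->.
split=> //.
- elim/cls_ind=> a; elim/cls_ind=> b.
  by rewrite -[cls _ a + _]/(qadd _ _) qaddE !sE /= -qaddE.
- elim/cls_ind=> a; elim/cls_ind=> b.
  by rewrite -[cls _ a * _]/(qmul _ _) qmulE !sE /= -qmulE.
- move=> r; elim/cls_ind=> a.
  have scaleE b : r *: cls nontrivial b = cls nontrivial (TMul (TC _ r) b).
    exact: qmulE.
  by rewrite scaleE !sE scaleE /=; apply/clsP/teq_sym/teq_Ccomm.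
- by rewrite -[1]/(cls nontrivial (TC _ 1)) sE.
- by elim/cls_ind=> a; rewrite !sE tstarK.
Qed.

Lemma bmw_gen_cls a : ev (bmw_gen (fun i => gen (BX i)) (fun i => gen (BXi i))
  (fun i => gen (BE i)) (gen BY)) a = cls nontrivial a.
Proof.
rewrite -ev_cls -/gen; elim: a => [r|g|a IHa b IHb|a IHa b IHb] //=; last 2 first.
- by rewrite IHa IHb.
- by rewrite IHa IHb.
by case: g => //=; case: BYi_inv.
Qed.
End BMWAlgebra.

(** * From the presented algebra back to terms *)

(** Covers the degenerate presentation, for which the empty combination suffices. The rule 0 a = 0
    is not among the axioms: all scalars being equal, a + a = (-1) a + a = 0, while a = (0 + 0) a =
    a + a. *)
Lemma teq_trivial (R : comUnitRingType) (G : Type) (rel : term R G -> term R G -> Prop) a :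
  teq rel (TC G 1) (TC G 0) -> teq rel a (TC G 0).
Proof.
move=> h10.
have e0 r : teq rel (TC G r) (TC G 0).
  have h1 : teq rel (TMul (TC G r) (TC G 1)) (TMul (TC G r) (TC G 0)).
    by apply: teq_mulm => //; apply: teq_refl.
  apply: teq_trans (teq_sym (teq_mul1r rel _)) _; apply: teq_trans h1 _.
  by apply: teq_trans (teq_CM rel _ _) _; rewrite mulr0; apply: teq_refl.
have eM r : teq rel (TMul (TC G r) a) a.
  apply: teq_trans (teq_mul1l rel a); apply: teq_mulm; last exact: teq_refl.
  exact: teq_trans (e0 r) (teq_sym h10).
have eD : teq rel (TAdd a a) (TC G 0).
  apply: teq_trans (teq_addN rel a); apply: teq_addm; last exact: teq_refl.
  exact/teq_sym/eM.
apply: teq_trans eD; apply: teq_trans (teq_sym (eM 0)) _.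
apply: (@teq_trans _ _ _ _ (TMul (TAdd (TC G 0) (TC G 0)) a)).
  apply: teq_mulm; last exact: teq_refl.
  by apply/teq_sym; apply: teq_trans (teq_CD rel _ _) _; rewrite addr0; apply: teq_refl.
by apply: teq_trans (teq_mulDl rel _ _ _) _; apply: teq_addm.
Qed.

Lemma span_combination (R : comUnitRingType) (A : unitAlgType R) (G : Type)
    (f : G -> A) (S : term R G -> Prop) u :
  rspan (fun v => exists2 w, S w & v = ev f w) (@scalar R A) u ->
  exists (N : nat) (c : nat -> R) (w : nat -> term R G),
    (forall y, (y < N)%N -> S (w y)) /\
    u = ev f (tsum [seq tscale (c y) (w y) | y <- iota 0 N]).
Proof.
elim=> [|v b [w Sw ->] [r ->]|x y _ [N1 [c1 [w1 [h1 ->]]]] _ [N2 [c2 [w2 [h2 ->]]]]].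
- by exists 0%N, (fun=> 0), (fun=> TC G 0); split; rewrite //= scale0r.
- exists 1%N, (fun=> r), (fun=> w); split=> //.
  by rewrite ev_tcomb big_ord1 mulr_algr.
exists (N1 + N2)%N, (fun i => if (i < N1)%N then c1 i else c2 (i - N1)%N),
  (fun i => if (i < N1)%N then w1 i else w2 (i - N1)%N); split=> [i hi|].
  by case: ltnP => iN; [apply: h1 | apply: h2; lia].
rewrite !ev_tcomb big_split_ord /=; congr (_ + _); apply: eq_bigr => i _.
  by rewrite ltn_ord.
by rewrite ltnNge leq_addr /= addKn.
Qed.

Theorem mainTheorem5 (R : comUnitRingType) (n k : nat)
    (q0 q lam : R) (qs As : nat -> R)
    (d : nat -> nat) (chi : nat -> nat -> term R bgen) :
  (1 <= n)%N -> (1 <= k)%N ->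
  q0 \is a GRing.unit -> q \is a GRing.unit -> lam \is a GRing.unit ->
  qs 0%N = q0 ->
  lam - lam^-1 = (q - q^-1) * (1 - As 0%N) ->
  (* for 1 <= l <= n: chi l 0, ..., chi l (d l - 1) are elements of B_l^k(R)
     mapped by pi_l bijectively onto an R-basis of h_{l,k}(R) *)
  (forall l, (1 <= l <= n)%N ->
     [/\ (forall y, (y < d l)%N -> bwf l (chi l y)),
         (forall c : nat -> R,
            teq (hrel q qs l k)
                (tsum [seq tscale (c y) (piAK q (chi l y)) | y <- iota 0 (d l)])
                (TC _ 0) ->
            forall y, (y < d l)%N -> c y = 0) &
         (forall a : term R hgen, hwf l a ->
            exists c : nat -> R,
              teq (hrel q qs l k) a
                (tsum [seq tscale (c y) (piAK q (chi l y)) | y <- iota 0 (d l)]))]) ->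
  (* conclusion: B_n^k(R) is R-spanned by the displayed elements *)
  forall a : term R bgen, bwf n a ->
    exists (N : nat) (c : nat -> R) (w : nat -> term R bgen),
      (forall y, (y < N)%N -> spanning_elt n k d chi (w y)) /\
      teq (brel q lam qs As n k) a
          (tsum [seq tscale (c y) (w y) | y <- iota 0 N]).
Proof.
move=> n0 k0 uq0 uq ul qs0 _ hchi a ha.
case: (pselect (teq (brel q lam qs As n k) (TC bgen 1) (TC bgen 0))) => [triv|nt].
  by exists 0%N, (fun=> 0), (fun=> TC bgen 0); split=> //; apply: teq_trivial.
have uqs : qs 0%N \is a GRing.unit by rewrite qs0.
have wf l y : (0 < l <= n)%N -> (y < d l)%N -> bwf l (chi l y).
  by move=> hl; case: (hchi l hl) => h _ _; apply: h.
have gens l b : (0 < l <= n)%N -> hwf l b -> exists c : nat -> R,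
    teq (hrel q qs l k) b
      (tsum [seq tscale (c y) (piAK q (chi l y)) | y <- iota 0 (d l)]).
  by move=> hl; case: (hchi l hl) => _ _; apply.
have := spanning_theorem (presented_relations nt) (presented_star nt) uqs ul k0 uq wf gens n0 ha.
move/span_combination => [N [c [w [hw e]]]]; exists N, c, w; split=> //.
by move: e; rewrite !bmw_gen_cls => /clsP.
Qed.
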